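(* Let $K=\mathbb{C}\{\!\{t\}\!\}$ be the field of Puiseux series over $\mathbb{C}$ with its usual $t$-adic valuation $\operatorname{val}$, and let $X=V(f)\subset\mathbb{P}^2_K$ be the smooth plane quartic defined by $$f(x,y,z)=xyz(x+y+z)+t(x^2y^2+x^2z^2+y^2z^2)+t^2(x^3y+xy^3+x^3z+xz^3+y^3z+yz^3)+t^5(x^4+y^4+z^4).$$ The $28$ bitangents $Ax+By+z=0$ of $X$ (with $A,B\in K$) include \begin{itemize} \item exactly $4$ with $(\operatorname{val}(A),\operatorname{val}(B))=(0,0)$, \item exactly $4$ with $(\operatorname{val}(A),\operatorname{val}(B))=(-2,0)$, \item exactly $4$ with $(\operatorname{val}(A),\operatorname{val}(B))=(0,-2)$, \item exactly $4$ with $(\operatorname{val}(A),\operatorname{val}(B))=(2,2)$, \item exactly $2$ with $(\operatorname{val}(A),\operatorname{val}(B))=(-2,-2)$, \item exactly $2$ with $(\operatorname{val}(A),\operatorname{val}(B))=(-4,-4)$, \item exactly $2$ with $(\operatorname{val}(A),\operatorname{val}(B))=(2,0)$, \item exactly $2$ with $(\operatorname{val}(A),\operatorname{val}(B))=(4,0)$, \item exactly $2$ with $(\operatorname{val}(A),\operatorname{val}(B))=(0,2)$, \item exactly $2$ with $(\operatorname{val}(A),\operatorname{val}(B))=(0,4)$. \end{itemize}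
   Context: A bitangent of the smooth plane quartic $X$ is a line whose intersection divisor with $X$ has the form $2P+2Q$ (possibly $P=Q$). $X$ has exactly $28$ bitangents, and each of them has an equation of the form $Ax+By+z=0$ with $A,B\in K$. *)

(* Defs.v *)
(* MathComp (with the classical layer of MathComp-Analysis, real-closed and
   multinomials).  [mpoly] has to be imported before the classical files,
   otherwise their notations clash. *)
From HB Require Import structures.
From mathcomp Require Import all_boot all_order all_algebra.
From mathcomp Require Import mpoly.
From mathcomp Require Import boolp classical_sets functions cardinality fsbigop.
From mathcomp Require Import constructive_ereal reals complex.

Set Implicit Arguments.
Unset Strict Implicit.
Unset Printing Implicit Defensive.

Import Order.TTheory GRing.Theory Num.Theory.

Local Open Scope classical_set_scope.
Local Open Scope ring_scope.

(* -------------------------------------------------------------------------- *)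
(* Puiseux series over a field F: formal sums \sum_(k >= 0) c_k t^((m + k)/n)  *)
(* with m an integer and n a positive integer, represented by their            *)
(* coefficient function q |-> (coefficient of t^q).                            *)
(* -------------------------------------------------------------------------- *)

Definition pexp (n : nat) (m : int) (k : nat) : rat :=
  (m%:~R + k%:R) / n%:R.

Section PuiseuxSupport.
Variable F : fieldType.
Implicit Types (f g h : rat -> F) (n : nat) (m : int).

Definition psupp n m f := forall q, f q != 0 -> exists k, q = pexp n m k.

Definition is_puiseux : {pred rat -> F} :=
  fun f => `[< exists n m, (0 < n)%N /\ psupp n m f >].

Lemma is_puiseuxP f :
  reflect (exists n m, (0 < n)%N /\ psupp n m f) (f \in is_puiseux).
Proof. exact: asboolP. Qed.

Lemma pexp_inj n m : (0 < n)%N -> injective (pexp n m).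
Proof.
move=> n0 k k' /(congr1 (fun x => x * n%:R)).
rewrite /pexp !mulfVK ?pnatr_eq0 -?lt0n // => /addrI /eqP.
by rewrite eqr_nat => /eqP.
Qed.

Lemma pexpD n m m' k k' : pexp n m k + pexp n m' k' = pexp n (m + m') (k + k').
Proof. by rewrite /pexp -mulrDl intrD natrD addrACA. Qed.

Lemma psupp_le n m m' f : m' <= m -> psupp n m f -> psupp n m' f.
Proof.
move=> le fs q /fs[k ->]; exists (`|m - m'|%N + k)%N; congr (_ / _).
rewrite natrD addrA; congr (_ + _).
by rewrite -[`|_|%N%:R]/((`|m - m'|%N%:Z)%:~R) gez0_abs ?subr_ge0 // -intrD [m' + _]addrC subrK.
Qed.

Lemma psupp_mul n m d f : (0 < d)%N -> psupp n m f -> psupp (n * d) (m * d%:Z) f.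
Proof.
move=> d0 fs q /fs[k ->]; exists (k * d)%N.
rewrite /pexp intrM !natrM -mulrDl -mulf_div divff ?mulr1 //.
by rewrite pnatr_eq0 -lt0n.
Qed.

Lemma is_puiseux2 f g : f \in is_puiseux -> g \in is_puiseux ->
  exists n m, [/\ (0 < n)%N, psupp n m f & psupp n m g].
Proof.
move=> /is_puiseuxP[n1 [m1 [n10 f1]]] /is_puiseuxP[n2 [m2 [n20 f2]]].
exists (n1 * n2)%N, (Order.min (m1 * n2%:Z) (m2 * n1%:Z)).
split; first by rewrite muln_gt0 n10.
  by apply: psupp_le (psupp_mul n20 f1); rewrite ge_min lexx.
by rewrite mulnC; apply: psupp_le (psupp_mul n10 f2); rewrite ge_min lexx orbT.
Qed.

Lemma is_puiseux3 f g h :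
  f \in is_puiseux -> g \in is_puiseux -> h \in is_puiseux ->
  exists n m, [/\ (0 < n)%N, psupp n m f, psupp n m g & psupp n m h].
Proof.
move=> fP gP /is_puiseuxP[n2 [m2 [n20 h2]]].
have [n1 [m1 [n10 f1 g1]]] := is_puiseux2 fP gP.
exists (n1 * n2)%N, (Order.min (m1 * n2%:Z) (m2 * n1%:Z)).
split; first by rewrite muln_gt0 n10.
- by apply: psupp_le (psupp_mul n20 f1); rewrite ge_min lexx.
- by apply: psupp_le (psupp_mul n20 g1); rewrite ge_min lexx.
by rewrite mulnC; apply: psupp_le (psupp_mul n10 h2); rewrite ge_min lexx orbT.
Qed.

Lemma psuppD n m f g : psupp n m f -> psupp n m g -> psupp n m (f + g).
Proof.
move=> fs gs q; have [f0|/fs//] := eqVneq (f q) 0.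
by rewrite (_ : (f + g) q = f q + g q) // f0 add0r => /gs.
Qed.

Lemma psupp_ext n m f g : psupp n m f -> psupp n m g ->
  (forall k, f (pexp n m k) = g (pexp n m k)) -> f = g.
Proof.
move=> fs gs fg; apply/funext => q.
have [f0|/fs[k ->//]] := eqVneq (f q) 0.
by have [->//|/gs[k ->//]] := eqVneq (g q) 0.
Qed.

Lemma is_puiseux_zmod : zmod_closed is_puiseux.
Proof.
split=> [|f g fP gP].
  by apply/is_puiseuxP; exists 1%N, 0; split=> // q; rewrite eqxx.
have [n [m [n0 fs gs]]] := is_puiseux2 fP gP.
apply/is_puiseuxP; exists n, m; split=> //; apply: psuppD => // q.
by rewrite (_ : (- g) q = - g q) // oppr_eq0 => /gs.
Qed.

HB.instance Definition _ :=
  GRing.isZmodClosed.Build (rat -> F) is_puiseux is_puiseux_zmod.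

(* Cauchy product; the sum has finite support when f and g are Puiseux. *)
Definition pconv f g : rat -> F :=
  fun q => \sum_(r \in [set: rat]) f r * g (q - r).

Definition pdelta (q0 : rat) : rat -> F := fun q => (q == q0)%:R.

Lemma pconvE n m m' f g k : (0 < n)%N -> psupp n m f -> psupp n m' g ->
  pconv f g (pexp n (m + m') k) =
  \sum_(i < k.+1) f (pexp n m i) * g (pexp n m' (k - i)).
Proof.
move=> n0 fs gs; rewrite /pconv.
pose s := [seq pexp n m i | i <- iota 0 k.+1].
have us : uniq s by rewrite map_inj_uniq ?iota_uniq //; apply: pexp_inj.
rewrite -(fsbig_widen [set` s]) //; last first.
  move=> r [_ /= rs]; have [->|/fs[i ri]] := eqVneq (f r) 0; first by rewrite mul0r.
  have [->|/gs[j rj]] := eqVneq (g (pexp n (m + m') k - r)) 0; first by rewrite mulr0.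
  case: rs; apply/mapP; exists i => //; rewrite mem_iota /= add0n ltnS.
  move/eqP: rj; rewrite subr_eq ri pexpD addrC [m' + m]addrC => /eqP/(pexp_inj n0) ->.
  by rewrite leq_addl.
rewrite -fsbig_seq // big_map -[iota 0 k.+1]/(index_iota 0 k.+1) big_mkord.
apply: eq_bigr => -[i /= ik] _; congr (_ * g _).
by apply/eqP; rewrite subr_eq pexpD addrC subnK // addrC eqxx.
Qed.

Lemma psupp_conv n m m' f g :
  psupp n m f -> psupp n m' g -> psupp n (m + m') (pconv f g).
Proof.
move=> fs gs q; apply: contra_neqP => nq; apply: fsbig1 => r _.
have [->|/fs[i ri]] := eqVneq (f r) 0; first by rewrite mul0r.
have [->|/gs[j rj]] := eqVneq (g (q - r)) 0; first by rewrite mulr0.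
case: nq; exists (i + j)%N; rewrite -pexpD -ri -rj.
by rewrite addrC subrK.
Qed.

Lemma is_puiseux_conv f g :
  f \in is_puiseux -> g \in is_puiseux -> pconv f g \in is_puiseux.
Proof.
move=> fP gP; have [n [m [n0 fs gs]]] := is_puiseux2 fP gP.
by apply/is_puiseuxP; exists n, (m + m); split=> //; apply: psupp_conv.
Qed.

Lemma is_puiseux_delta (q : rat) : pdelta q \in is_puiseux.
Proof.
apply/is_puiseuxP; exists `|denq q|%N, (numq q).
split=> [|r]; first by rewrite absz_gt0.
rewrite /pdelta; have [-> _|_] := eqVneq r q; last by rewrite eqxx.
exists 0%N; rewrite /pexp addr0 -[`|_|%N%:R]/((`|denq q|%N%:Z)%:~R) absz_denq.
by rewrite divq_num_den.
Qed.

Lemma pconvC f g : f \in is_puiseux -> g \in is_puiseux -> pconv f g = pconv g f.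
Proof.
move=> fP gP; have [n [m [n0 fs gs]]] := is_puiseux2 fP gP.
apply: (psupp_ext (psupp_conv fs gs) (psupp_conv gs fs)) => k.
rewrite !pconvE // (reindex_inj rev_ord_inj); apply: eq_bigr => -[i /= ik] _.
by rewrite mulrC subSS subKn.
Qed.

(* The product agrees, up to any given order, with the product of the         *)
(* polynomials obtained by truncation.                                        *)
Definition ptrunc n m N f : {poly F} := \poly_(i < N) f (pexp n m i).

Lemma pconv_trunc n m m' f g N k :
  (0 < n)%N -> psupp n m f -> psupp n m' g -> (k < N)%N ->
  pconv f g (pexp n (m + m') k) = (ptrunc n m N f * ptrunc n m' N g)`_k.
Proof.
move=> n0 fs gs kN; rewrite pconvE // coefM; apply: eq_bigr => -[i /= ik] _.
by rewrite !coef_poly !ifT // (leq_ltn_trans _ kN) // leq_subr.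
Qed.

Lemma pconvA f g h :
  f \in is_puiseux -> g \in is_puiseux -> h \in is_puiseux ->
  pconv f (pconv g h) = pconv (pconv f g) h.
Proof.
move=> fP gP hP; have [n [m [n0 fs gs hs]]] := is_puiseux3 fP gP hP.
have ghs := psupp_conv gs hs; have fgs := psupp_conv fs gs.
have s1 := psupp_conv fs ghs; have s2 := psupp_conv fgs hs.
rewrite addrA in s1; apply: (psupp_ext s1 s2) => k.
pose N := k.+1.
have tr u v a b : psupp n a u -> psupp n b v ->
    forall i, (i < N)%N -> (ptrunc n (a + b) N (pconv u v))`_i =
                           (ptrunc n a N u * ptrunc n b N v)`_i.
  by move=> us vs i iN; rewrite coef_poly iN (pconv_trunc n0 us vs iN).
rewrite (pconv_trunc n0 fgs hs (ltnSn k)) -addrA (pconv_trunc n0 fs ghs (ltnSn k)).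
transitivity (ptrunc n m N f * (ptrunc n m N g * ptrunc n m N h))`_k.
  rewrite !coefM; apply: eq_bigr => -[i /= ik] _.
  by rewrite (tr g h) // /N ltnS leq_subr.
rewrite mulrA !coefM; apply: eq_bigr => -[i /= ik] _.
by rewrite (tr f g).
Qed.

Lemma pconvDl f g h :
  f \in is_puiseux -> g \in is_puiseux -> h \in is_puiseux ->
  pconv (f + g) h = pconv f h + pconv g h.
Proof.
move=> fP gP hP; have [n [m [n0 fs gs hs]]] := is_puiseux3 fP gP hP.
have fgs := psuppD fs gs.
apply: (psupp_ext (psupp_conv fgs hs)
                  (psuppD (psupp_conv fs hs) (psupp_conv gs hs))) => k.
rewrite (_ : (pconv f h + pconv g h) _ = pconv f h (pexp n (m + m) k)
  + pconv g h (pexp n (m + m) k)) // !pconvE // -big_split /=.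
by apply: eq_bigr => i _; rewrite -mulrDl.
Qed.

Lemma pconv1f f : pconv (pdelta 0) f = f.
Proof.
apply/funext => q; rewrite /pconv -(fsbig_widen [set (0 : rat)]) //; last first.
  by move=> r [_ /= /eqP/negPf r0]; rewrite /pdelta r0 mul0r.
by rewrite fsbig_set1 /pdelta eqxx mul1r subr0.
Qed.

(* Coefficients of the inverse of a power series with coefficients a. *)
Fixpoint pinv_seq (a : nat -> F) (N : nat) : seq F :=
  if N is N'.+1 then
    let s := pinv_seq a N' in
    rcons s (((N' == 0%N)%:R - \sum_(i < N') a i.+1 * s`_(N' - i.+1)) / a 0%N)
  else [::].

Lemma size_pinv_seq a N : size (pinv_seq a N) = N.
Proof. by elim: N => //= N IH; rewrite size_rcons IH. Qed.

Definition pinv_coef a N := (pinv_seq a N.+1)`_N.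

Lemma nth_pinv_seq a N i : (i < N)%N -> (pinv_seq a N)`_i = pinv_coef a i.
Proof.
elim: N => // N IH; rewrite ltnS leq_eqVlt => /predU1P[->//|iN] /=.
by rewrite nth_rcons size_pinv_seq iN IH.
Qed.

Lemma pinv_coefP a k : a 0%N != 0 ->
  \sum_(i < k.+1) a i * pinv_coef a (k - i) = (k == 0%N)%:R.
Proof.
move=> a0; rewrite big_ord_recl /= subn0 /pinv_coef /= nth_rcons.
rewrite size_pinv_seq ltnn eqxx mulrC mulfVK //.
rewrite addrC (eq_bigr (fun i : 'I_k => a i.+1 * (pinv_seq a k)`_(k - i.+1))).
  by rewrite addrC subrK.
move=> [i ik] _ /=; rewrite nth_pinv_seq //.
by rewrite -subSn // subSS leq_subr.
Qed.

Lemma pconv_inv f : f \in is_puiseux -> f != 0 ->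
  exists2 g, g \in is_puiseux & pconv f g = pdelta 0.
Proof.
move=> /is_puiseuxP[n [m0 [n0 fs0]]] fN0.
have exk : exists k, f (pexp n m0 k) != 0.
  apply: contra_neqP fN0 => /forallNP nf; apply: (@psupp_ext n m0) => //.
    by move=> q; rewrite eqxx.
  by move=> k; apply/eqP; apply/negPn/negP/nf.
case: (ex_minnP exk) => k0 fk0 k0min.
pose m := m0 + k0%:Z.
have pm k : pexp n m k = pexp n m0 (k0 + k) by rewrite /pexp intrD natrD addrA.
have fs : psupp n m f.
  move=> q fq; have [k qk] := fs0 q fq; exists (k - k0)%N.
  by rewrite pm subnKC // k0min // -qk.
have f0 : f (pexp n m 0) != 0 by rewrite pm addn0.
pose a k := f (pexp n m k).
pose idx (q : rat) : nat := `|numq (q * n%:R + m%:~R)|%N.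
pose g q := if q == pexp n (- m) (idx q) then pinv_coef a (idx q) else 0.
have idxE k : idx (pexp n (- m) k) = k.
  rewrite /idx /pexp mulfVK ?pnatr_eq0 -?lt0n // intrN addrAC addNr add0r.
  by rewrite -[k%:R]/((k%:Z)%:~R) numq_int.
have gs : psupp n (- m) g.
  by move=> q; rewrite /g; case: (q =P _) => [qE _|_]; [exists (idx q)|rewrite eqxx].
exists g; first by apply/is_puiseuxP; exists n, (- m).
have ds : psupp n (m - m) (pdelta 0).
  move=> q; rewrite /pdelta; have [-> _|_] := eqVneq q 0; last by rewrite eqxx.
  exists 0%N.
  by rewrite /pexp subrr addr0 mul0r.
apply: (psupp_ext (psupp_conv fs gs) ds) => k.
rewrite pconvE //.
rewrite (eq_bigr (fun i : 'I_k.+1 => a i * pinv_coef a (k - i))); last first.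
  by move=> i _; rewrite /g idxE eqxx.
rewrite pinv_coefP // /pdelta; congr (_%:R); congr nat_of_bool.
by rewrite /pexp subrr add0r mulf_eq0 invr_eq0 !pnatr_eq0 (gtn_eqF n0) orbF.
Qed.

End PuiseuxSupport.

Record puiseux (F : fieldType) := Puiseux {
  pcoef :> rat -> F;
  pcoefP : pcoef \in @is_puiseux F
}.

Section PuiseuxField.
Variable F : fieldType.
Local Notation K := (puiseux F).
Implicit Types a b c : K.

HB.instance Definition _ := [isSub for @pcoef F].
HB.instance Definition _ := [Choice of K by <:].
HB.instance Definition _ := [SubChoice_isSubZmodule of K by <:].

(* [pmonom q] is t^q. *)
Definition pmonom (q : rat) : K := Puiseux (is_puiseux_delta F q).
Definition pmul a b : K := Puiseux (is_puiseux_conv (pcoefP a) (pcoefP b)).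

Fact pmulA : associative pmul.
Proof. by move=> a b c; apply: val_inj; apply: pconvA; apply: pcoefP. Qed.

Fact pmulC : commutative pmul.
Proof. by move=> a b; apply: val_inj; apply: pconvC; apply: pcoefP. Qed.

Fact pmul1 : left_id (pmonom 0) pmul.
Proof. by move=> a; apply: val_inj; apply: pconv1f. Qed.

Fact pmulDl : left_distributive pmul +%R.
Proof. by move=> a b c; apply: val_inj; apply: pconvDl; apply: pcoefP. Qed.

Fact pmonom0_neq0 : pmonom 0 != 0.
Proof.
apply/eqP => /(congr1 (fun a : K => pcoef a 0)) /eqP.
by rewrite /= /pdelta eqxx [X in _ == X]/(0 : F) oner_eq0.
Qed.

HB.instance Definition _ :=
  GRing.Zmodule_isComNzRing.Build K pmulA pmulC pmul1 pmulDl pmonom0_neq0.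

Fact pinv_ex a : exists b, (a == 0 -> b = 0) /\ (a != 0 -> b * a = 1).
Proof.
have [->|aN0] := eqVneq a 0; first by exists 0.
have aN0' : pcoef a != 0.
  by apply: contra_neq aN0 => a0; apply: val_inj.
have [g gP ag] := pconv_inv (pcoefP a) aN0'.
by exists (Puiseux gP); split=> // _; rewrite mulrC; apply: val_inj.
Qed.

Definition pinv a : K := projT1 (cid (pinv_ex a)).

Fact pmulVf a : a != 0 -> pinv a * a = 1.
Proof. by move=> aN0; have [_] := projT2 (cid (pinv_ex a)); apply. Qed.

Fact pinv0 : pinv 0 = 0.
Proof. by have [+ _] := projT2 (cid (pinv_ex 0)); apply. Qed.

HB.instance Definition _ := GRing.ComNzRing_isField.Build K pmulVf pinv0.

(* The t-adic valuation: the least exponent of the support, and +oo at 0. *)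
Definition lead_exp a (q : rat) : Prop :=
  a q != 0 /\ forall r, a r != 0 -> q <= r.

Definition pval a : \bar rat :=
  if a == 0 then +oo%E else (xget 0 [set q | lead_exp a q])%:E%E.

Lemma pvalP a (q : rat) : pval a = q%:E%E <-> lead_exp a q.
Proof.
have uniq q1 q2 : lead_exp a q1 -> lead_exp a q2 -> q1 = q2.
  by move=> [n1 l1] [n2 l2]; apply/le_anti; rewrite l1 // l2.
rewrite /pval; have [->|aN0] := eqVneq; first by split=> // -[]; rewrite eqxx.
split=> [[<-]|aq]; last by congr (_%:E)%E; apply: xget_unique => // r /uniq; apply.
suff [r ar] : exists r, lead_exp a r by apply: xgetPex; exists r.
have /is_puiseuxP[n [m [n0 fs]]] := pcoefP a.
have exk : exists k, a (pexp n m k) != 0.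
  apply: contra_neqP aN0 => /forallNP nf; apply: val_inj.
  apply: (@psupp_ext _ n m) => //; first by move=> r; rewrite eqxx.
  by move=> k; apply/eqP; apply/negPn/negP/nf.
case: (ex_minnP exk) => k ak kmin; exists (pexp n m k); split=> // r.
move=> ar; have [j rj] := fs r ar; rewrite {r}rj in ar *.
by rewrite ler_pM2r ?invr_gt0 ?ltr0n // lerD2l ler_nat kmin.
Qed.

End PuiseuxField.

(* -------------------------------------------------------------------------- *)
(* Plane curves over a field K.  A point of P^2 is given by a nonzero row      *)
(* vector; two such vectors P, Q are the same point iff (P == Q)%MS (equal row *)
(* spans).  Likewise l represents the line l_0 x + l_1 y + l_2 z = 0.          *)
(* -------------------------------------------------------------------------- *)

Section PlaneCurves.
Variable K : fieldType.
Implicit Types (f : {mpoly K[3]}) (P Q R l : 'rV[K]_3).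

Definition on_line l P := P *m l^T = 0.

(* When K is algebraically closed (as for Puiseux series over C), this is      *)
(* smoothness of the curve V(f) in P^2.                                        *)
Definition smooth_plane_quartic f :=
  f \is 4.-homog /\
  forall P, P != 0 -> f.@[P 0] = 0 -> exists i, f^`M(i).@[P 0] != 0.

(* f (P + s Q), as a polynomial in s. *)
Definition restr_line f P Q : {poly K} :=
  mmap polyC (fun i => (P 0 i)%:P + Q 0 i *: 'X) f.

(* The line l is not a component of V(f), and d is the order of vanishing at P *)
(* of f restricted to l: here s is a local parameter at P on l, for any choice *)
(* of a second point Q of the line.                                            *)
Definition inter_mult f l P (d : nat) :=
  forall Q, on_line l Q -> ~~ (Q <= P)%MS ->
    restr_line f P Q != 0 /\ mup 0 (restr_line f P Q) = d.

(* The intersection divisor of V(f) and l is 2P + 2Q, with P = Q allowed. *)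
Definition bitangent f l :=
  l != 0 /\
  exists P Q, [/\ P != 0, Q != 0, on_line l P, on_line l Q &
    forall R, R != 0 -> on_line l R ->
      inter_mult f l R (2 * (R == P)%MS + 2 * (R == Q)%MS)].

(* The line A x + B y + z = 0, for AB = (A, B). *)
Definition affine_line (AB : K * K) : 'rV[K]_3 :=
  \row_i [:: AB.1; AB.2; 1]`_i.

End PlaneCurves.

Section Quartic.
Variable F : fieldType.
Local Notation K := (puiseux F).

Definition quartic : {mpoly K[3]} :=
  let t : K := pmonom F 1 in
  let x : {mpoly K[3]} := 'X_0 in
  let y : {mpoly K[3]} := 'X_1 in
  let z : {mpoly K[3]} := 'X_2 in
  x * y * z * (x + y + z)
  + t *: (x ^+ 2 * y ^+ 2 + x ^+ 2 * z ^+ 2 + y ^+ 2 * z ^+ 2)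
  + t ^+ 2 *: (x ^+ 3 * y + x * y ^+ 3 + x ^+ 3 * z + x * z ^+ 3
               + y ^+ 3 * z + y * z ^+ 3)
  + t ^+ 5 *: (x ^+ 4 + y ^+ 4 + z ^+ 4).

Definition has_val (a b : rat) (AB : K * K) : bool :=
  (pval AB.1 == a%:E%E) && (pval AB.2 == b%:E%E).

End Quartic.

(* Main.v *)
From HB Require Import structures.
Require Import Defs.
From mathcomp Require Import all_boot all_order all_algebra.
From mathcomp Require Import mpoly.
From mathcomp Require Import boolp classical_sets fsbigop.
From mathcomp Require Import constructive_ereal reals complex.
From mathcomp Require Import ring lra.


(** The quartic is symmetric in x, y, z.  Let w be a primitive cube root of
    unity and put u = x + y + z, X = x + w y + w^2 z, Y = x + w^2 y + w z.
    Then 27 f = alpha u^4 + beta u^2 XY + gamma (XY)^2 + delta u (X^3 + Y^3),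
    with four coefficients in Z[t] ([quartic_form_reduced]).

    Since every Puiseux series has a square root, a line is a bitangent exactly
    when f restricted to it is the square of a nonzero binary quadratic form
    ([bitangentP]).  A line through (1:1:1) is never one
    ([not_bitangent_sum0]); any other line is u = p X + q Y, and comparing the
    five coefficients of a binary quartic with those of a square leaves three
    possibilities ([square_lineE]):
    - p = q = 0: one line;
    - p^3 = q^3, hence, up to the action of w, p = q = r where r is a root of
      the cubic [diag_cubic]: 3 * 3 lines;
    - p^3 <> q^3: then m = pq is a root of the cubic [line_cubic], and p^3 + q^3
      is a polynomial in m: 3 * 6 lines.
    In terms of the coordinates of the line, scaled to have sum 3, these are
    (1, 1, 1), the permutations of (1 - 2r, 1 + r, 1 + r), and the permutations
    of a triple whose elementary symmetric functions are known from m
    ([bitangent_lines28]).  This makes 1 + 9 + 18 = 28 lines.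

    It remains to solve the two cubics over the Puiseux series and to read off
    valuations.  A root is first written as an explicit truncation plus
    t^k (a + y), with the truncation long enough for a to be a simple root of
    the leading part of the equation in y; Hensel's lemma ([hensel_cubic]) then
    gives y.  One finds r = O(t), r = -1 + 3 t^2 + t^(5/2) (+-6i + ...),
    m = 1 - 6 t^2 + ..., m = 1/4 - 3/4 t + 9/4 t^2 + ... and
    m = 1/4 - 3/4 t - 3/4 t^2 + ....  Up to permutation the coordinates of the
    lines have valuations (0,0,0) for (1,1,1) and for the first r, (0,2,2) for
    the other two r and the first m, (0,0,4) for the second m and (0,0,2) for
    the third.  Dividing by the last coordinate gives the ten classes.

    Smoothness: by symmetry, a singular point has two equal coordinates, and on
    the line X = Y the gradient amounts to a cubic and a conic without common
    zero, their resultant having leading term 52488 t^6. *)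

Set Implicit Arguments.
Unset Strict Implicit.
Unset Printing Implicit Defensive.

Import Order.TTheory GRing.Theory Num.Theory.

Local Open Scope ring_scope.

(** * Equalities that follow from linear combinations of equalities *)
Section LinearCombinations.
Variable R : comPzRingType.
Implicit Types x y a b c d k l : R.

(** A hypothesis enters a ring identity through an explicit multiplier; what
    is left is an identity that [ring] checks. *)
Lemma eq_lincomb k a b x y : a = b -> x - y = k * (a - b) -> x = y.
Proof. by move=> -> /eqP; rewrite subrr mulr0 subr_eq0 => /eqP. Qed.

Lemma eq_lincomb2 k l a b c d x y :
  a = b -> c = d -> x - y = k * (a - b) + l * (c - d) -> x = y.
Proof. by move=> -> -> /eqP; rewrite !subrr !mulr0 addr0 subr_eq0 => /eqP. Qed.

Lemma eq_lincomb3 k l m a b c d e f x y :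
  a = b -> c = d -> e = f ->
  x - y = k * (a - b) + l * (c - d) + m * (e - f) -> x = y.
Proof. by move=> -> -> -> /eqP; rewrite !subrr !mulr0 !addr0 subr_eq0 => /eqP. Qed.
End LinearCombinations.

(** * Lines on which the reduced quartic is a square *)
Section BinarySquares.
Variable K : fieldType.
Implicit Types (p q s X Y : K).
Hypotheses (n2 : 2%:R != 0 :> K) (n3 : 3%:R != 0 :> K).

(** The values at (1,0), (0,1), (1,1), (1,-1) and (2,1) determine the
    coefficients as soon as 2 and 3 are invertible. *)
Lemma binary_quartic_eq0 (a0 a1 a2 a3 a4 : K) :
  (forall X Y, a0 * X ^+ 4 + a1 * X ^+ 3 * Y + a2 * X ^+ 2 * Y ^+ 2
             + a3 * X * Y ^+ 3 + a4 * Y ^+ 4 = 0) ->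
  [/\ a0 = 0, a1 = 0, a2 = 0, a3 = 0 & a4 = 0].
Proof.
move=> H.
have e0 : a0 = 0 by rewrite -[RHS](H 1 0); ring.
have e4 : a4 = 0 by rewrite -[RHS](H 0 1); ring.
have e2 : a2 = 0.
  apply: (mulfI n2); rewrite mulr0.
  by apply: (eq_lincomb2 (k := 1) (l := 1) (H 1 1) (H 1 (-1)));
     rewrite e0 e4; ring.
have e1 : a1 = 0.
  apply: (mulfI n2); apply: (mulfI n3); rewrite !mulr0.
  by apply: (eq_lincomb2 (k := 1) (l := - 2%:R) (H 2%:R 1) (H 1 1));
     rewrite e0 e2 e4; ring.
have e3 : a3 = 0.
  by apply: (eq_lincomb (k := 1) (H 1 1)); rewrite e0 e1 e2 e4; ring.
by [].
Qed.

Variables al be ga de : K.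
Hypotheses (ga0 : ga != 0) (de0 : de != 0).

(** On the line u = pX + qY, the coefficient of X^3 Y is theta p^2 + delta q and
    that of X Y^3 is theta q^2 + delta p; theta depends on pq only. *)
Definition theta p q := 4%:R * al * (p * q) + be.

(** The five coefficients of the quartic on the line u = pX + qY, compared with
    those of (r0 X^2 + r1 XY + r2 Y^2)^2. *)
Definition square_line p q r0 r1 r2 :=
  [/\ al * p ^+ 4 + de * p = r0 ^+ 2,
      theta p q * p ^+ 2 + de * q = 2%:R * r0 * r1,
      6%:R * al * (p * q) ^+ 2 + 2%:R * be * (p * q) + ga = r1 ^+ 2 + 2%:R * r0 * r2,
      theta p q * q ^+ 2 + de * p = 2%:R * r1 * r2 &
      al * q ^+ 4 + de * q = r2 ^+ 2].

Lemma square_lineP p q r0 r1 r2 :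
  square_line p q r0 r1 r2 <->
  forall X Y, al * (p * X + q * Y) ^+ 4 + be * (p * X + q * Y) ^+ 2 * (X * Y)
    + ga * (X * Y) ^+ 2 + de * (p * X + q * Y) * (X ^+ 3 + Y ^+ 3)
    = (r0 * X ^+ 2 + r1 * (X * Y) + r2 * Y ^+ 2) ^+ 2.
Proof.
rewrite /square_line /theta; split=> [[e0 e1 e2 e3 e4] X Y|H].
  apply/eqP; rewrite -subr_eq0; apply/eqP.
  transitivity (
   (al * p ^+ 4 + de * p - r0 ^+ 2) * X ^+ 4
   + ((4%:R * al * (p * q) + be) * p ^+ 2 + de * q - 2%:R * r0 * r1) * X ^+ 3 * Y
   + (6%:R * al * (p * q) ^+ 2 + 2%:R * be * (p * q) + ga
      - (r1 ^+ 2 + 2%:R * r0 * r2)) * X ^+ 2 * Y ^+ 2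
   + ((4%:R * al * (p * q) + be) * q ^+ 2 + de * p - 2%:R * r1 * r2) * X * Y ^+ 3
   + (al * q ^+ 4 + de * q - r2 ^+ 2) * Y ^+ 4); first by ring.
  by rewrite e0 e1 e2 e3 e4 !subrr !mul0r !addr0.
have [] := @binary_quartic_eq0
   (al * p ^+ 4 + de * p - r0 ^+ 2)
   ((4%:R * al * (p * q) + be) * p ^+ 2 + de * q - 2%:R * r0 * r1)
   (6%:R * al * (p * q) ^+ 2 + 2%:R * be * (p * q) + ga - (r1 ^+ 2 + 2%:R * r0 * r2))
   ((4%:R * al * (p * q) + be) * q ^+ 2 + de * p - 2%:R * r1 * r2)
   (al * q ^+ 4 + de * q - r2 ^+ 2).
  move=> X Y; have /eqP := H X Y; rewrite -subr_eq0 => /eqP <-; ring.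
by do 5 move/subr0_eq => ?.
Qed.

Lemma square_lineC p q r0 r1 r2 :
  square_line p q r0 r1 r2 -> square_line q p r2 r1 r0.
Proof.
rewrite /square_line /theta => -[e0 e1 e2 e3 e4]; rewrite (mulrC q p).
by split=> //; rewrite ?e3 ?e2 ?e1; ring.
Qed.

(** For p = q the quartic is a quadratic polynomial in (X + Y)^2 and XY; up to
    the factor p, this is its discriminant. *)
Definition diag_cubic p := (be * p - 3%:R * de) ^+ 2 * p
  - 4%:R * ga * (al * p ^+ 3 + de).

Lemma square_line_diag p r0 r1 r2 :
  square_line p p r0 r1 r2 -> p = 0 \/ diag_cubic p = 0.
Proof.
rewrite /square_line /theta => -[e0 e1 e2 e3 e4].
(* The value at (1,-1), where u vanishes. *)
have eg : (r0 - r1 + r2) ^+ 2 = ga.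
  transitivity (r0 ^+ 2 - 2%:R * r0 * r1 + (r1 ^+ 2 + 2%:R * r0 * r2)
     - 2%:R * r1 * r2 + r2 ^+ 2); first by ring.
  by rewrite -e0 -e1 -e2 -e3 -e4; ring.
have r02 : r0 = r2.
  have h1 : r1 * (r0 - r2) = 0.
    apply: (mulfI n2).
    transitivity (2%:R * r0 * r1 - 2%:R * r1 * r2); first by ring.
    by rewrite -e1 -e3; ring.
  have /eqP : (r0 - r2) * (r0 + r2) = 0.
    transitivity (r0 ^+ 2 - r2 ^+ 2); first by ring.
    by rewrite -e0 -e4; ring.
  rewrite mulf_eq0 => /orP[|/eqP r02]; first by move/eqP/subr0_eq.
  move/eqP: h1; rewrite mulf_eq0 => /orP[/eqP r1E|]; last by move/eqP/subr0_eq.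
  case/eqP: ga0; rewrite -eg r1E subr0 r02; ring.
(* The left-hand side is the square of be p^2 - 3 de p. *)
have h : (2%:R * r0 * r1 - 4%:R * r0 ^+ 2) ^+ 2 = 4%:R * ga * r0 ^+ 2.
  by rewrite -eg -r02; ring.
have /eqP : p * diag_cubic p = 0.
  rewrite /diag_cubic.
  transitivity ((2%:R * r0 * r1 - 4%:R * r0 ^+ 2) ^+ 2 - 4%:R * ga * r0 ^+ 2).
    by rewrite -e1 -e0; ring.
  by rewrite h subrr.
by rewrite mulf_eq0 => /orP[]/eqP; [left|right].
Qed.

Definition square_line_ex p q := exists r0 r1 r2,
  (r0 != 0) || (r1 != 0) || (r2 != 0) /\ square_line p q r0 r1 r2.

Lemma diag_square_line p s : s ^+ 2 = ga -> diag_cubic p = 0 -> square_line_ex p p.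
Proof.
move=> sg Ep; have s0 : s != 0 by apply: contraNneq ga0 => s0; rewrite -sg s0 expr0n.
pose b := be * p ^+ 2 - 3%:R * de * p.
have hb : b ^+ 2 = 4%:R * s ^+ 2 * (al * p ^+ 4 + de * p).
  apply/eqP; rewrite -subr_eq0 sg; apply/eqP.
  transitivity (p * diag_cubic p); first by rewrite /diag_cubic /b; ring.
  by rewrite Ep mulr0.
(* The square root is s XY + (b / 2s) (X + Y)^2. *)
exists (b / (2%:R * s)), (s + b / s), (b / (2%:R * s)).
have n4 : 4%:R != 0 :> K by rewrite (natrM _ 2 2) mulf_neq0.
have a0E : al * p ^+ 4 + de * p = (b / (2%:R * s)) ^+ 2.
  rewrite expr_div_n hb; field; by rewrite n2 s0.
split.
  have [->|b0] := eqVneq b 0; first by rewrite !mul0r addr0 s0 orbT.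
  by rewrite mulf_neq0 // invr_eq0 mulf_neq0.
rewrite /square_line /theta a0E; split=> //.
- transitivity (4%:R * (al * p ^+ 4 + de * p) + b); first by rewrite /b; ring.
  by rewrite a0E; field; rewrite n2 s0.
- transitivity (6%:R * (al * p ^+ 4 + de * p) + 2%:R * b + s ^+ 2).
    by rewrite /b sg; ring.
  by rewrite a0E; field; rewrite n2 s0.
transitivity (4%:R * (al * p ^+ 4 + de * p) + b); first by rewrite /b; ring.
by rewrite a0E; field; rewrite n2 s0.
Qed.

Lemma zero_square_line s : s ^+ 2 = ga -> square_line_ex 0 0.
Proof.
move=> sg; have s0 : s != 0 by apply: contraNneq ga0 => s0; rewrite -sg s0 expr0n.
exists 0, s, 0; split; first by rewrite s0 orbT.
by rewrite /square_line /theta -sg; split; ring.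
Qed.

(** The first equation is a cubic for m = pq, the second then gives p^3 + q^3. *)
Definition general_line p q :=
  p * q * (theta p q ^+ 2 - 4%:R * al * ga) = de ^+ 2 /\
  de * (p ^+ 3 + q ^+ 3) = 4%:R * ga * (p * q) - 2%:R * theta p q * (p * q) ^+ 2.

(** Eliminating r0 from the first two coefficients gives a quadratic equation
    for p^3, and symmetrically q^3 satisfies the same equation.  As p^3 and q^3
    are distinct, they are its two roots, so that their sum and product are
    known in terms of m = pq and rho = r1^2.  The remaining coefficients then
    force rho = 0, which makes p^3 = q^3, or rho = gamma. *)
Lemma square_line_general p q r0 r1 r2 :
  p ^+ 3 != q ^+ 3 -> square_line p q r0 r1 r2 -> general_line p q.
Proof.
move=> PQ; have PQ0 : p ^+ 3 - q ^+ 3 != 0 by rewrite subr_eq0.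
move=> sq; have m0 : p * q != 0.
  have aux x y s0 s1 s2 : square_line x y s0 s1 s2 -> y = 0 -> x = 0.
    rewrite /square_line /theta => -[_ _ _ f3 f4] y0; rewrite y0 in f3 f4.
    have /eqP : s2 ^+ 2 = 0 by rewrite -f4; ring.
    rewrite sqrf_eq0 => /eqP s20; rewrite s20 in f3.
    by apply: (mulfI de0); apply: (eq_lincomb (k := 1) f3); ring.
  apply: contraNneq PQ => /eqP; rewrite mulf_eq0 => /orP[]/eqP z.
    by rewrite z (aux _ _ _ _ _ (square_lineC sq) z).
  by rewrite z (aux _ _ _ _ _ sq z).
move: sq; rewrite /square_line /general_line.
have := erefl (theta p q); rewrite {2}/theta.
move: (theta p q) => th thE.
set P := p ^+ 3 in PQ PQ0 *; set Q := q ^+ 3 in PQ PQ0 *.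
move=> [e0 e1 e2 e3 e4]; set rho := r1 ^+ 2 in e2.
have PQm : P * Q = (p * q) ^+ 3 by rewrite exprMn.
have qP : (th * P + de * (p * q)) ^+ 2 - 4%:R * rho * (al * P ^+ 2 + de * P) = 0.
  transitivity (p ^+ 2 * ((th * p ^+ 2 + de * q) ^+ 2
       - 4%:R * rho * (al * p ^+ 4 + de * p))); first by rewrite /P; ring.
  by rewrite e1 e0 /rho; ring.
have qQ : (th * Q + de * (p * q)) ^+ 2 - 4%:R * rho * (al * Q ^+ 2 + de * Q) = 0.
  transitivity (q ^+ 2 * ((th * q ^+ 2 + de * p) ^+ 2
       - 4%:R * rho * (al * q ^+ 4 + de * q))); first by rewrite /Q; ring.
  by rewrite e3 e4 /rho; ring.
set m := p * q in m0 e2 PQm qP qQ thE *.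
(* The sum and the product of the roots, read off from qP and qQ. *)
have hII : (th ^+ 2 - 4%:R * al * rho) * (P + Q) + 2%:R * th * de * m - 4%:R * de * rho = 0.
  by apply: (mulfI PQ0); apply: (eq_lincomb2 (k := 1) (l := -1) qP qQ); ring.
have hI : m * (th ^+ 2 - 4%:R * al * rho) = de ^+ 2.
  apply: (mulfI m0); apply: (mulfI m0).
  apply: (eq_lincomb3 (k := P) (l := -1) (m := - (th ^+ 2 - 4%:R * al * rho)) hII qP PQm).
  ring.
have hn : de * (P + Q) = 4%:R * rho * m - 2%:R * th * m ^+ 2.
  apply: (mulfI de0).
  apply: (eq_lincomb2 (k := m) (l := - (P + Q)) hII hI); ring.
(* The product of the second and fourth coefficients. *)
have h13 : rho * (r0 * r2 - m * (3%:R * al * m + be)) = 0.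
  have n4 : 4%:R != 0 :> K by rewrite (natrM _ 2 2) mulf_neq0.
  apply: (mulfI n4); rewrite mulr0.
  transitivity ((2%:R * r0 * r1) * (2%:R * r1 * r2)
    - 4%:R * rho * m * (3%:R * al * m + be)).
    by rewrite /rho; ring.
  rewrite -e1 -e3.
  transitivity (th ^+ 2 * m ^+ 2 + th * (de * (P + Q)) + de ^+ 2 * m
    - 4%:R * rho * m * (3%:R * al * m + be)).
    by rewrite /m /P /Q; ring.
  by rewrite hn -hI thE; ring.
have rhoE : rho = ga.
  move/eqP: h13; rewrite mulf_eq0 => /orP[/eqP rho0|/eqP/subr0_eq r02].
    case/eqP: PQ0; apply/eqP; rewrite -sqrf_eq0; apply/eqP.
    have de20 : de ^+ 2 != 0 by rewrite sqrf_eq0.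
    apply: (mulfI de20); rewrite mulr0.
    transitivity ((de * (P + Q)) ^+ 2 - 4%:R * de ^+ 2 * (P * Q)); first by ring.
    by rewrite hn PQm -hI rho0; ring.
  apply/eqP; rewrite -subr_eq0; apply/eqP.
  transitivity ((rho + 2%:R * r0 * r2) - ga - 2%:R * (r0 * r2)); first by ring.
  by rewrite -e2 r02; ring.
by rewrite -rhoE.
Qed.

(** Conversely, with r1 = s the coefficients r0 and r2 can be read off from
    those of X^3 Y and X Y^3. *)
Lemma general_square_line p q s : s ^+ 2 = ga -> general_line p q -> square_line_ex p q.
Proof.
move=> sg; have s0 : s != 0 by apply: contraNneq ga0 => s0; rewrite -sg s0 expr0n.
rewrite /general_line /square_line_ex /square_line.
have := erefl (theta p q); rewrite {2}/theta.
move: (theta p q) => th thE [hI hn].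
have m0 : p * q != 0.
  by apply: contraNneq de0 => m0; rewrite -sqrf_eq0 -hI m0 mul0r.
have /andP[p0 q0] : (p != 0) && (q != 0) by rewrite -negb_or -mulf_eq0.
have n4 : 4%:R != 0 :> K by rewrite (natrM _ 2 2) mulf_neq0.
have sq x y : x * y = p * q -> x != 0 -> x ^+ 3 + y ^+ 3 = p ^+ 3 + q ^+ 3 ->
    4%:R * ga * (al * x ^+ 4 + de * x) = (th * x ^+ 2 + de * y) ^+ 2.
  move=> xy x0 xy3; apply: (mulfI x0); apply: (mulfI x0); apply: (mulfI m0).
  rewrite -xy3 -xy in hI hn *.
  by apply: (eq_lincomb2 (k := - x ^+ 6) (l := - (de * x ^+ 3)) hI hn); ring.
have sp := sq p q erefl p0 erefl; have sqq := sq q p (mulrC _ _) q0 (addrC _ _).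
have s13 : (th * p ^+ 2 + de * q) * (th * q ^+ 2 + de * p)
    = 4%:R * ga * (p * q) * (th - al * (p * q)).
  by apply: (eq_lincomb2 (k := - (p * q)) (l := th) hI hn); ring.
exists ((th * p ^+ 2 + de * q) / (2%:R * s)), s, ((th * q ^+ 2 + de * p) / (2%:R * s)).
split; first by rewrite s0 orbT.
split.
- by rewrite expr_div_n -sp -sg; field; rewrite ?n2 ?s0.
- by field; rewrite ?n2 ?s0.
- transitivity (s ^+ 2 + (th * p ^+ 2 + de * q) * (th * q ^+ 2 + de * p)
    / (2%:R * s ^+ 2)); last by field; rewrite ?n2 ?s0.
  by rewrite s13 -sg thE; field; rewrite ?n2 ?s0.
- by field; rewrite ?n2 ?s0.
by rewrite expr_div_n -sqq -sg; field; rewrite ?n2 ?s0.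
Qed.

Variable w : K.
Hypothesis hw : w ^+ 2 + w + 1 = 0.

Lemma cube_root1 : w ^+ 3 = 1.
Proof. by apply: (eq_lincomb (k := w - 1) hw); ring. Qed.

(** The cyclic permutation of x, y, z fixes u and multiplies X and Y by inverse
    cube roots of unity. *)
Lemma square_line_rot p q : square_line_ex p q -> square_line_ex (w * p) (w ^+ 2 * q).
Proof.
have w3 := cube_root1.
have w0 : w != 0 by apply: contra_eq_neq w3 => ->; rewrite expr0n eq_sym oner_eq0.
move=> [r0 [r1 [r2 [rn [e0 e1 e2 e3 e4]]]]].
exists (w ^+ 2 * r0), r1, (w * r2); split.
  by rewrite !mulf_eq0 !(negPf w0).
have th : theta (w * p) (w ^+ 2 * q) = theta p q.
  by apply: (eq_lincomb (k := 4%:R * al * (p * q)) w3); rewrite /theta; ring.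
have pq : w * p * (w ^+ 2 * q) = p * q by apply: (eq_lincomb (k := p * q) w3); ring.
rewrite /square_line th pq; split.
- by apply: (eq_lincomb2 (k := w) (l := w * (al * p ^+ 4 - r0 ^+ 2)) e0 w3); ring.
- by apply: (eq_lincomb (k := w ^+ 2) e1); ring.
- by apply: (eq_lincomb2 (k := 1) (l := - (2%:R * r0 * r2)) e2 w3); ring.
- by apply: (eq_lincomb2 (k := w) (l := w * theta p q * q ^+ 2) e3 w3); ring.
apply: (eq_lincomb2 (k := w ^+ 2) (l := w ^+ 2 * (w ^+ 3 + 1) * (al * q ^+ 4)) e4 w3).
by ring.
Qed.

Definition diag_line p q := exists2 r, diag_cubic r = 0 &
  [\/ p = r /\ q = r, p = w * r /\ q = w ^+ 2 * r | p = w ^+ 2 * r /\ q = w * r].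

(** If p^3 = q^3 then q = p, q = w p or q = w^2 p; the rotation reduces the last
    two cases to the first. *)
Lemma square_lineE p q s : s ^+ 2 = ga ->
  square_line_ex p q <->
  [\/ p = 0 /\ q = 0, diag_line p q | general_line p q].
Proof.
have w3 := cube_root1; move=> sg; split; last first.
  move=> [[-> ->]|[r Er pq]|gpq]; first exact: (zero_square_line sg).
    have h0 := diag_square_line sg Er.
    case: pq => -[-> ->] //; first exact: square_line_rot.
    have := square_line_rot (square_line_rot h0).
    have -> : w * (w * r) = w ^+ 2 * r by ring.
    by have -> : w ^+ 2 * (w ^+ 2 * r) = w * r by apply: (eq_lincomb (k := w * r) w3); ring.
  exact: (general_square_line sg).
move=> sq; have [PQ|PQ] := eqVneq (p ^+ 3) (q ^+ 3); last first.
  by move: sq => [r0 [r1 [r2 [_ sq]]]]; apply: Or33; apply: square_line_general PQ sq.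
have diag r : square_line_ex r r -> r = 0 \/ diag_cubic r = 0.
  by move=> [r0 [r1 [r2 [_ h]]]]; apply: square_line_diag h.
have /eqP : (p - q) * ((p - w * q) * (p - w ^+ 2 * q)) = 0.
  apply: (eq_lincomb2 (k := 1) (l := - (p - q) * (p * q - (w - 1) * q ^+ 2)) PQ hw).
  ring.
rewrite !mulf_eq0 => /or3P[] /eqP/subr0_eq pE; rewrite {PQ}pE in sq *.
- by have [->|h] := diag _ sq; [apply: Or31|apply: Or32; exists q => //; apply: Or31].
- have := square_line_rot sq; rewrite (_ : w * (w * q) = w ^+ 2 * q); last by ring.
  move=> /diag[/eqP|h]; last first.
    apply: Or32; exists (w ^+ 2 * q) => //; apply: Or33.
    by split; [apply: (eq_lincomb (k := - w * q) w3)|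
               apply: (eq_lincomb (k := - q) w3)]; ring.
  rewrite mulf_eq0 => /orP[/eqP w20|/eqP->]; last by apply: Or31; rewrite mulr0.
  have := w3; rewrite exprS w20 mulr0 => /eqP.
  by rewrite eq_sym oner_eq0.
have := square_line_rot (square_line_rot sq).
rewrite (_ : w * (w * (w ^+ 2 * q)) = w * q); last first.
  by apply: (eq_lincomb (k := w * q) w3); ring.
rewrite (_ : w ^+ 2 * (w ^+ 2 * q) = w * q); last first.
  by apply: (eq_lincomb (k := w * q) w3); ring.
move=> /diag[/eqP|h]; last first.
  apply: Or32; exists (w * q) => //; apply: Or32.
  by split; [ring|apply: (eq_lincomb (k := - q) w3); ring].
rewrite mulf_eq0 => /orP[/eqP w0|/eqP->]; last by apply: Or31; rewrite mulr0.
have := w3; rewrite exprS w0 mul0r => /eqP.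
by rewrite eq_sym oner_eq0.
Qed.
End BinarySquares.

(** * Bitangents and squares of binary quadratic forms *)
Section Bitangents.
Variable K : fieldType.
Hypothesis char0 : forall n, (0 < n)%N -> n%:R != 0 :> K.
Hypothesis sqrtK : forall x : K, exists y, y ^+ 2 = x.
Implicit Types (P Q R l : 'rV[K]_3).

(** A field of characteristic 0 is infinite. *)
Lemma poly_horner_ext (p q : {poly K}) : (forall s, p.[s] = q.[s]) -> p = q.
Proof.
move=> pq; apply/eqP; rewrite -subr_eq0; apply/negPn/negP => r0.
pose rs := [seq (i%:R : K) | i <- iota 0 (size (p - q))].
have : (size rs < size (p - q)%R)%N.
  apply: max_poly_roots => //.
    by apply/allP => x _; rewrite /root hornerD hornerN pq subrr.
  have inj i j : (i < j)%N -> (i%:R : K) != j%:R.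
    move=> ij; rewrite -(subnK (ltnW ij)) natrD -subr_eq0 opprD addrCA subrr addr0.
    by rewrite oppr_eq0 char0 // subn_gt0.
  rewrite map_inj_uniq ?iota_uniq // => i j /eqP ij.
  by have [/inj/negPf|/inj/negPf|//] := ltngtP i j; rewrite ?ij // eq_sym ij.
by rewrite size_map size_iota ltnn.
Qed.

Lemma restr_lineE (f : {mpoly K[3]}) P Q s :
  (restr_line f P Q).[s] = f.@[(P + s *: Q) 0].
Proof.
rewrite /restr_line /meval /mmap horner_sum; apply: eq_bigr => m _.
rewrite hornerM hornerC; congr (_ * _); rewrite /mmap1 horner_prod.
apply: eq_bigr => i _; rewrite horner_exp !(hornerE, mxE).
by rewrite mulrC.
Qed.

Lemma row_eqmx_scale (P Q : 'rV[K]_3) : P != 0 ->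
  reflect (exists2 a, a != 0 & P = a *: Q) (P == Q)%MS.
Proof.
move=> P0; apply: (iffP andP) => [[/sub_rVP[a PaQ] _]|[a a0 PaQ]].
  exists a => //; apply: contraNneq P0 => a0.
  by rewrite PaQ a0 scale0r.
split; apply/sub_rVP; first by exists a.
by exists a^-1; rewrite PaQ scalerA mulVf // scale1r.
Qed.

Lemma binary_quadratic_split (r0 r1 r2 : K) :
  (r0 != 0) || (r1 != 0) || (r2 != 0) ->
  exists u1 v1 u2 v2, [/\ (u1 != 0) || (v1 != 0), (u2 != 0) || (v2 != 0) &
   forall X Y, r0 * X ^+ 2 + r1 * (X * Y) + r2 * Y ^+ 2
     = (u1 * X + v1 * Y) * (u2 * X + v2 * Y)].
Proof.
have [->|r00] := eqVneq r0 0.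
  rewrite /= => r12; exists 0, 1, r1, r2; split=> //.
    by rewrite oner_eq0 orbT.
  by move=> X Y; ring.
move=> _; have [d dE] := sqrtK (r1 ^+ 2 - 4%:R * r0 * r2).
have n2 := char0 (ltn0Sn 1); have n4 := char0 (ltn0Sn 3).
exists r0, ((r1 + d) / 2%:R), 1, ((r1 - d) / (2%:R * r0)); rewrite r00 oner_eq0.
split=> // X Y; have r2E : r2 = (r1 ^+ 2 - d ^+ 2) / (4%:R * r0).
  by rewrite dE; field; rewrite ?r00 ?n4.
by rewrite r2E; field; rewrite ?n2 ?n4 ?r00.
Qed.

(** The bool on the right-hand side is the multiplicity: 1 if c = 0, else 0. *)
Lemma mup_linear (c d : K) : (c != 0) || (d != 0) ->
  mup 0 (c%:P + d *: 'X) = (c == 0).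
Proof.
have [->|c0] /= := eqVneq c 0; last first.
  move=> _; apply: mupNroot.
  by rewrite /root !hornerE.
move=> d0; rewrite polyC0 add0r.
have -> : d *: 'X = d%:P * ('X - 0%:P) ^+ 1 :> {poly K} by rewrite expr1 subr0 mul_polyC.
rewrite mupMr ?mup_XsubCX ?eqxx //.
by rewrite /root hornerC.
Qed.

Definition binary_quartic (f : {mpoly K[3]}) P Q (c0 c1 c2 c3 c4 : K) :=
  forall a b, f.@[(a *: P + b *: Q) 0] =
    c0 * a ^+ 4 + c1 * a ^+ 3 * b + c2 * a ^+ 2 * b ^+ 2 + c3 * a * b ^+ 3
    + c4 * b ^+ 4.

Lemma restr_line_coef f P Q c0 c1 c2 c3 c4 :
  binary_quartic f P Q c0 c1 c2 c3 c4 ->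
  restr_line f P Q = Poly [:: c0; c1; c2; c3; c4].
Proof.
move=> fPQ; apply: poly_horner_ext => s; rewrite restr_lineE.
rewrite -{1}[P]scale1r fPQ !expr1n horner_Poly /=; ring.
Qed.

Lemma mup_coef0 (p : {poly K}) d i : p != 0 -> mup 0 p = d -> (i < d)%N -> p`_i = 0.
Proof.
move=> p0 pd id; have : (d <= mup 0 p)%N by rewrite pd.
by rewrite mup_geq // subr0 => /dvdpP[h ->]; rewrite coefMXn id.
Qed.

Variables (f : {mpoly K[3]}).
Hypothesis f_quartic : forall P Q, exists c0 c1 c2 c3 c4,
  binary_quartic f P Q c0 c1 c2 c3 c4.

(** If P and Q are distinct, f vanishes to order 2 at both, so that only the
    middle coefficient of f (a P + b Q) survives; if P = Q, f vanishes to order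
    4 at P, so that only b^4 survives.  The parameter k is 1 in the first case
    and 0 in the second. *)
Lemma bitangent_square_form l (P Q : 'rV[K]_3) :
  on_line l P -> on_line l Q -> P != 0 ->
  (exists2 S, on_line l S & ~~ (S <= P)%MS) ->
  (forall R, R != 0 -> on_line l R ->
      inter_mult f l R (2 * (R == P)%MS + 2 * (R == Q)%MS)) ->
  Q != 0 ->
  exists S, exists c k, [/\ on_line l S, ~~ (S <= P)%MS, c != 0 &
     (forall a b, f.@[(a *: P + b *: S) 0] = c * (b * (k * a + (1 - k) * b)) ^+ 2)].
Proof.
move=> lP lQ P0 [S lS SP] mult Q0.
have PP : (P == P)%MS by apply/row_eqmx_scale => //; exists 1; rewrite ?oner_eq0 ?scale1r.
have [PQ|PQ] := boolP (P == Q)%MS.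
  have [c0 [c1 [c2 [c3 [c4 fE]]]]] := f_quartic P S.
  have [r0 rm] := mult P P0 lP S lS SP; rewrite PP PQ /= in rm.
  have h i := mup_coef0 r0 rm (i := i).
  rewrite (restr_line_coef fE) in r0 h.
  have := h 0%N isT; have := h 1%N isT; have := h 2%N isT; have := h 3%N isT.
  rewrite !coef_Poly /= => c30 c20 c10 c00.
  exists S, c4, 0; split=> //.
    apply: contraNneq r0 => c40; apply/eqP/polyP => i; rewrite coef_Poly coef0.
    by rewrite c00 c10 c20 c30 c40; do 5 case: i => [|i] //=; rewrite nth_nil.
  by move=> a b; rewrite fE c00 c10 c20 c30; ring.
have QP : ~~ (Q <= P)%MS.
  apply: contraNN PQ => /sub_rVP[a QaP]; apply/row_eqmx_scale => //.
  have a0 : a != 0 by apply: contraNneq Q0 => a0; rewrite QaP a0 scale0r.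
  by exists a^-1; rewrite ?invr_eq0 // QaP scalerA mulVf // scale1r.
have PQ' : ~~ (P <= Q)%MS.
  apply: contraNN PQ => /sub_rVP[a PaQ]; apply/row_eqmx_scale => //.
  by exists a => //; apply: contraNneq P0 => a0; rewrite PaQ a0 scale0r.
have QPn : (Q == P)%MS = false by apply/negP => /andP[]; rewrite (negPf QP).
have QQ : (Q == Q)%MS by apply/row_eqmx_scale => //; exists 1; rewrite ?oner_eq0 ?scale1r.
have [c0 [c1 [c2 [c3 [c4 fE]]]]] := f_quartic P Q.
have fE' : binary_quartic f Q P c4 c3 c2 c1 c0.
  by move=> a b; rewrite addrC fE; ring.
have [r0 rm] := mult P P0 lP Q lQ QP; rewrite PP (negPf PQ) /= in rm.
have [r0' rm'] := mult Q Q0 lQ P lP PQ'; rewrite QPn QQ /= in rm'.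
have h i := mup_coef0 r0 rm (i := i); have h' i := mup_coef0 r0' rm' (i := i).
rewrite (restr_line_coef fE) in r0 h; rewrite (restr_line_coef fE') in r0' h'.
have := h 0%N isT; have := h 1%N isT; have := h' 0%N isT; have := h' 1%N isT.
rewrite !coef_Poly /= => c30 c40 c10 c00.
exists Q, c2, 1; split=> //.
  apply: contraNneq r0 => c20; apply/eqP/polyP => i; rewrite coef_Poly coef0.
  by rewrite c00 c10 c20 c30 c40; do 5 case: i => [|i] //=; rewrite nth_nil.
by move=> a b; rewrite fE c00 c10 c40 c30; ring.
Qed.

(** From here on e, e' is a basis of the plane of vectors on the line l, and k
    is a scaling factor, which the square absorbs. *)
Variables (l e e' : 'rV[K]_3) (k : K).
Hypotheses (k0 : k != 0) (l0 : l != 0).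
Hypotheses (le : on_line l e) (le' : on_line l e').
Hypothesis free : forall a b, a *: e + b *: e' = 0 -> a = 0 /\ b = 0.
Hypothesis span : forall R, on_line l R -> exists a b, R = a *: e + b *: e'.

Lemma on_lineD a b R S : on_line l R -> on_line l S -> on_line l (a *: R + b *: S).
Proof. by rewrite /on_line mulmxDl -!scalemxAl => -> ->; rewrite !scaler0 addr0. Qed.

(** From left to right, the square root is the quadratic form found in
    [bitangent_square_form], written in the basis e, e'.  From right to left, it
    splits into two linear forms, whose zeros are the points of tangency. *)
Lemma bitangentP :
  bitangent f l <-> exists r0 r1 r2, (r0 != 0) || (r1 != 0) || (r2 != 0) /\
    forall X Y, k * f.@[(X *: e + Y *: e') 0]
      = (r0 * X ^+ 2 + r1 * (X * Y) + r2 * Y ^+ 2) ^+ 2.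
Proof.
split=> [[_ [P [Q [P0 Q0 lP lQ mult]]]]|[r0 [r1 [r2 [rn0 H]]]]].
  have [S lS SP] : exists2 S, on_line l S & ~~ (S <= P)%MS.
    have [/sub_rVP[a ea]|] := boolP (e <= P)%MS; last by exists e.
    have [/sub_rVP[b eb]|] := boolP (e' <= P)%MS; last by exists e'.
    have [b0 a0] : b = 0 /\ - a = 0.
      by apply: free; rewrite ea eb !scalerA mulNr [b * a]mulrC scaleNr subrr.
    have [/eqP] : 1 = 0 :> K /\ 0 = 0 :> K.
      apply: free; rewrite ea (_ : a = 0) ?scale0r ?scaler0 ?addr0 //.
      by rewrite -[a]opprK a0 oppr0.
    by rewrite oner_eq0.
  have [T [c [kk [lT TP c0 fE]]]] :=
    bitangent_square_form lP lQ P0 (ex_intro2 _ _ S lS SP) mult Q0.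
  have [x1 [y1 PE]] := span lP; have [x2 [y2 TE]] := span lT.
  (* Cramer's rule expresses e and e' in terms of P and T. *)
  pose D := x1 * y2 - x2 * y1.
  have D0 : D != 0.
    apply: contraNneq TP => /eqP D0; apply/sub_rVP.
    have /orP x1y1 : (x1 != 0) || (y1 != 0).
      rewrite -negb_and; apply: contraNN P0 => /andP[/eqP x10 /eqP y10].
      by rewrite PE x10 y10 !scale0r addr0.
    have {}D0 : x1 * y2 = x2 * y1 by apply/eqP; rewrite -subr_eq0.
    rewrite TE PE; case: x1y1 => [z|z].
      exists (x2 / x1); rewrite scalerDr !scalerA mulfVK //; congr (_ + _ *: _).
      by rewrite mulrAC -D0 mulrC mulKf.
    exists (y2 / y1); rewrite scalerDr !scalerA mulfVK //; congr (_ *: _ + _).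
    by rewrite mulrAC [y2 * x1]mulrC D0 mulfK.
  have [h hc] := sqrtK (k * c).
  have h0 : h != 0.
    apply/eqP => h0; move/eqP: hc.
    by rewrite h0 expr0n /= eq_sym mulf_eq0 (negPf k0) (negPf c0).
  pose a1 := y2 / D; pose a2 := - x2 / D; pose b1 := - y1 / D; pose b2 := x1 / D.
  pose d1 := kk * a1 + (1 - kk) * b1; pose d2 := kk * a2 + (1 - kk) * b2.
  have E X Y : k * f.@[(X *: e + Y *: e') 0] =
      (h * (b1 * d1) * X ^+ 2 + h * (b1 * d2 + b2 * d1) * (X * Y)
       + h * (b2 * d2) * Y ^+ 2) ^+ 2.
    have -> : X *: e + Y *: e' = (a1 * X + a2 * Y) *: P + (b1 * X + b2 * Y) *: T.
      rewrite PE TE !scalerDr !scalerA addrACA -!scalerDl.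
      by congr (_ *: _ + _ *: _); rewrite /a1 /a2 /b1 /b2 /D; field; exact: D0.
    rewrite fE mulrA -hc /d1 /d2; ring.
  exists (h * (b1 * d1)), (h * (b1 * d2 + b2 * d1)), (h * (b2 * d2)).
  split=> //; rewrite -!negb_and; apply/negP => /andP[/andP[/eqP z0 /eqP z1] /eqP z2].
  have /eqP : k * f.@[((kk + (1 - kk)) *: P + 1 *: T) 0] = 0.
    rewrite PE TE !scalerDr !scalerA addrACA -!scalerDl E z0 z1 z2; ring.
  rewrite fE !mul1r -/(1 - kk).
  have -> : kk * (kk + (1 - kk)) + (1 - kk) * 1 = 1 by ring.
  by rewrite expr1n mulr1 mulf_eq0 (negPf k0) (negPf c0).
have [u1 [v1 [u2 [v2 [n1 n2 rE]]]]] := binary_quadratic_split rn0.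
split=> //.
(* The linear form u X + v Y vanishes exactly at the point v e - u e'. *)
have lineE (u v x y : K) : (u != 0) || (v != 0) -> x *: e + y *: e' != 0 ->
    ((x *: e + y *: e')%R == (v *: e + (- u) *: e')%R)%MS = (u * x + v * y == 0).
  move=> uv R0; apply/(row_eqmx_scale _ R0)/eqP => [[c c0]|uxvy].
    move=> /eqP; rewrite -subr_eq0 scalerDr !scalerA opprD addrACA -!scalerBl.
    move=> /eqP/free[/subr0_eq -> /subr0_eq ->]; ring.
  have [c xE yE] : exists2 c, x = c * v & y = c * - u.
    have [uz|u0] := eqVneq u 0.
      rewrite uz eqxx /= in uv; exists (x / v); first by rewrite mulfVK.
      move/eqP: uxvy; rewrite uz mul0r add0r mulf_eq0 (negPf uv) /= => /eqP ->.
      by rewrite oppr0 mulr0.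
    exists (- y / u); last by field.
    by apply: (mulfI u0); apply: (eq_lincomb (k := 1) uxvy); field.
  exists c; last by rewrite scalerDr !scalerA -xE -yE.
  by apply: contraNneq R0 => c0; rewrite xE yE c0 !mul0r !scale0r addr0.
have neq0 (u v : K) : (u != 0) || (v != 0) -> v *: e + (- u) *: e' != 0.
  move=> uv; apply/eqP => /free[v0 /eqP]; rewrite oppr_eq0 => /eqP u0.
  by rewrite u0 v0 eqxx in uv.
exists (v1 *: e + (- u1) *: e'), (v2 *: e + (- u2) *: e').
split; [exact: neq0|exact: neq0|exact: on_lineD|exact: on_lineD|].
move=> R R0 lR S lS SR.
have [x [y RE]] := span lR; have [x' [y' SE]] := span lS.
have SRn0 (u v : K) : (u != 0) || (v != 0) ->
    (u * x + v * y != 0) || (u * x' + v * y' != 0).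
  move=> uv; rewrite -negb_and; apply: contraNN SR => /andP[hR hS].
  have := lineE u v x y uv; rewrite -RE R0 => /(_ isT); rewrite hR.
  move=> /(row_eqmx_scale _ R0)[c c0 Rc].
  have [->|S0] := eqVneq S 0; first exact: sub0mx.
  have := lineE u v x' y' uv; rewrite -SE S0 => /(_ isT); rewrite hS.
  move=> /(row_eqmx_scale _ S0)[c' c'0 Sc]; apply/sub_rVP.
  by exists (c' / c); rewrite Rc Sc scalerA mulfVK.
pose p1 := (u1 * x + v1 * y)%:P + (u1 * x' + v1 * y') *: 'X.
pose p2 := (u2 * x + v2 * y)%:P + (u2 * x' + v2 * y') *: 'X.
have pn0 (c d : K) : (c != 0) || (d != 0) -> c%:P + d *: 'X != 0 :> {poly K}.
  apply: contraTneq => /polyP pE; have := pE 0%N; have := pE 1%N.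
  by rewrite !coefE !mulr0 !mulr1 !addr0 !add0r => -> ->; rewrite eqxx.
have p10 : p1 != 0 by apply/pn0/SRn0.
have p20 : p2 != 0 by apply/pn0/SRn0.
have -> : restr_line f R S = (k^-1)%:P * ((p1 * p1) * (p2 * p2)).
  apply: poly_horner_ext => s; rewrite restr_lineE RE SE.
  rewrite scalerDr !scalerA addrACA -!scalerDl.
  apply: (mulfI k0); rewrite H rE hornerM hornerC mulVKf // /p1 /p2 !hornerE /=; ring.
have kp : (k^-1)%:P != 0 :> {poly K} by rewrite polyC_eq0 invr_eq0.
split; first by rewrite !mulf_neq0.
have mc : mup 0 (k^-1)%:P = 0%N by apply: mupNroot; rewrite /root hornerC invr_eq0.
have m1 : mup 0 p1 = (u1 * x + v1 * y == 0) by apply/mup_linear/SRn0.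
have m2 : mup 0 p2 = (u2 * x + v2 * y == 0) by apply/mup_linear/SRn0.
have R1 := lineE u1 v1 x y n1; have R2 := lineE u2 v2 x y n2; rewrite -RE in R1 R2.
by rewrite !mupM ?mulf_neq0 // mc m1 m2 R1 // R2 // add0n !addnn !mul2n.
Qed.
End Bitangents.

(** * Coordinates in the projective plane *)
Section Coordinates.
Variable K : fieldType.
Implicit Types (x y z : K) (l P : 'rV[K]_3).

Definition row3 x y z : 'rV[K]_3 := \row_i [:: x; y; z]`_i.

Lemma row3_0 x y z : row3 x y z 0 0 = x. Proof. by rewrite mxE. Qed.
Lemma row3_1 x y z : row3 x y z 0 1 = y. Proof. by rewrite mxE. Qed.
Lemma row3_2 x y z : row3 x y z 0 2 = z. Proof. by rewrite mxE. Qed.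
Definition row3E := (row3_0, row3_1, row3_2).

Lemma ord3P (A : 'I_3 -> Prop) : A 0 -> A 1 -> A 2 -> forall i, A i.
Proof.
by move=> A0 A1 A2 [[|[|[|//]]] i3]; [move: A0|move: A1|move: A2];
   congr (A _); apply: val_inj.
Qed.

Lemma row3_ext l P : l 0 0 = P 0 0 -> l 0 1 = P 0 1 -> l 0 2 = P 0 2 -> l = P.
Proof. by move=> e0 e1 e2; apply/rowP; apply: ord3P. Qed.

Lemma row3_eta l : l = row3 (l 0 0) (l 0 1) (l 0 2).
Proof. by apply: row3_ext; rewrite row3E. Qed.

Lemma row3Z a x y z : a *: row3 x y z = row3 (a * x) (a * y) (a * z).
Proof. by apply: row3_ext; rewrite mxE !row3E. Qed.

Lemma row3D x y z x' y' z' : row3 x y z + row3 x' y' z' = row3 (x + x') (y + y') (z + z').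
Proof. by apply: row3_ext; rewrite mxE !row3E. Qed.

Lemma row3_inj x y z x' y' z' : row3 x y z = row3 x' y' z' -> [/\ x = x', y = y' & z = z'].
Proof.
move=> e; split.
- by have := congr1 (fun l : 'rV_3 => l 0 0) e; rewrite !row3E.
- by have := congr1 (fun l : 'rV_3 => l 0 1) e; rewrite !row3E.
by have := congr1 (fun l : 'rV_3 => l 0 2) e; rewrite !row3E.
Qed.

Lemma row3_eq0 x y z : (row3 x y z == 0) = [&& x == 0, y == 0 & z == 0].
Proof.
have -> : 0 = row3 0 0 0 by apply: row3_ext; rewrite mxE row3E.
apply/eqP/and3P => [/row3_inj[-> -> ->]|[/eqP-> /eqP-> /eqP->]] //.
Qed.

Lemma on_lineE l P :
  on_line l P <-> l 0 0 * P 0 0 + l 0 1 * P 0 1 + l 0 2 * P 0 2 = 0.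
Proof.
rewrite /on_line; have -> : P *m l^T = (l 0 0 * P 0 0 + l 0 1 * P 0 1 + l 0 2 * P 0 2)%:M.
  apply/matrixP => i j; rewrite !ord1 !mxE eqxx mulr1n !big_ord_recl big_ord0 addr0 addrA.
  rewrite !mxE ![l 0 _ * _]mulrC; congr (_ * _ + _ * _ + _ * _);
    by congr (_ _ _); apply: val_inj.
split=> [/matrixP/(_ 0 0)|->]; last exact: raddf0.
by rewrite !mxE eqxx mulr1n.
Qed.

End Coordinates.

(** * The quartic and its derivatives *)
Section QuarticForm.
Variable K : comNzRingType.
Implicit Types t x y z : K.

Definition quartic_form t x y z :=
  x * y * z * (x + y + z)
  + t * (x ^+ 2 * y ^+ 2 + x ^+ 2 * z ^+ 2 + y ^+ 2 * z ^+ 2)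
  + t ^+ 2 * (x ^+ 3 * y + x * y ^+ 3 + x ^+ 3 * z + x * z ^+ 3
               + y ^+ 3 * z + y * z ^+ 3)
  + t ^+ 5 * (x ^+ 4 + y ^+ 4 + z ^+ 4).

(** The derivative with respect to x; by symmetry, permuting the arguments gives
    the other two partial derivatives. *)
Definition quartic_dx t x y z :=
  y * z * (x + y + z) + x * y * z
  + t * (x * y ^+ 2 + x * z ^+ 2) *+ 2
  + t ^+ 2 * (x ^+ 2 * y *+ 3 + y ^+ 3 + x ^+ 2 * z *+ 3 + z ^+ 3)
  + t ^+ 5 * x ^+ 3 *+ 4.

Lemma quartic_form_binary t x y z x' y' z' : exists c0 c1 c2 c3 c4,
  forall a b, quartic_form t (a * x + b * x') (a * y + b * y') (a * z + b * z') =
    c0 * a ^+ 4 + c1 * a ^+ 3 * b + c2 * a ^+ 2 * b ^+ 2 + c3 * a * b ^+ 3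
    + c4 * b ^+ 4.
Proof.
pose c0 := quartic_form t x y z; pose c4 := quartic_form t x' y' z'.
pose D x y z x' y' z' := x' * quartic_dx t x y z + y' * quartic_dx t y x z
   + z' * quartic_dx t z x y.
pose c1 := D x y z x' y' z'; pose c3 := D x' y' z' x y z.
pose c2 := quartic_form t (x + x') (y + y') (z + z') - c0 - c1 - c3 - c4.
exists c0, c1, c2, c3, c4 => a b.
rewrite /c2 /c0 /c1 /c3 /c4 /D /quartic_form /quartic_dx; ring.
Qed.
End QuarticForm.

Section QuarticPoly.
Variables (K : fieldType) (t : K).

(** [quartic] with an arbitrary parameter in an arbitrary field: the geometry
    below does not depend on Puiseux series. *)
Definition quartic_poly : {mpoly K[3]} :=
  let x : {mpoly K[3]} := 'X_0 in
  let y : {mpoly K[3]} := 'X_1 in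
  let z : {mpoly K[3]} := 'X_2 in
  x * y * z * (x + y + z)
  + t *: (x ^+ 2 * y ^+ 2 + x ^+ 2 * z ^+ 2 + y ^+ 2 * z ^+ 2)
  + t ^+ 2 *: (x ^+ 3 * y + x * y ^+ 3 + x ^+ 3 * z + x * z ^+ 3
               + y ^+ 3 * z + y * z ^+ 3)
  + t ^+ 5 *: (x ^+ 4 + y ^+ 4 + z ^+ 4).

Lemma mderivXU (i j : 'I_3) : ('X_j : {mpoly K[3]})^`M(i) = (i == j)%:R.
Proof.
rewrite mderivX mnm1E eq_sym; have [->|_] := eqVneq i j; last by rewrite scale0r.
rewrite scale1r; apply/mpolyP => m; rewrite mcoeffX mcoeff1.
congr (_%:R); congr nat_of_bool; rewrite eq_sym; congr (_ == _).
by apply/mnmP => k; rewrite mnmBE subnn mnm0E.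
Qed.

Lemma mderivXUn (i j : 'I_3) n :
  ('X_j ^+ n : {mpoly K[3]})^`M(i) = (i == j)%:R * 'X_j ^+ n.-1 *+ n.
Proof.
elim: n => [|n IH]; first by rewrite expr0 mulr0n -mpolyC1 mderivC.
rewrite exprS mderivM IH mderivXU; case: n {IH} => [|n].
  by rewrite mulr0n mulr0 addr0 expr0.
by rewrite /= mulrnAr mulrCA -exprS [RHS]mulrS.
Qed.

(** A value together with a partial derivative: the pair is propagated along the
    structure of the polynomial by the rules for sums and products. *)
Definition eval_deriv i (v : 'I_3 -> K) (p : {mpoly K[3]}) (a d : K) :=
  p.@[v] = a /\ p^`M(i).@[v] = d.

Lemma quartic_eval_deriv i (v : 'I_3 -> K) :
  let x := v 0 in let y := v 1 in let z := v 2 in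
  eval_deriv i v quartic_poly (quartic_form t x y z)
    ((i == 0)%:R * quartic_dx t x y z + (i == 1)%:R * quartic_dx t y x z
     + (i == 2)%:R * quartic_dx t z x y).
Proof.
pose ed := eval_deriv i v.
have edV j : ed 'X_j (v j) (i == j)%:R.
  by split; rewrite ?mevalXU // mderivXU raddfMn /= meval1.
have edD p q a b c d : ed p a c -> ed q b d -> ed (p + q) (a + b) (c + d).
  by move=> [<- <-] [<- <-]; rewrite /ed /eval_deriv mderivD !mevalD.
have edM p q a b c d : ed p a c -> ed q b d -> ed (p * q) (a * b) (c * b + a * d).
  by move=> [<- <-] [<- <-]; rewrite /ed /eval_deriv mderivM mevalD !mevalM.
have edZ k p a c : ed p a c -> ed (k *: p) (k * a) (k * c).
  by move=> [<- <-]; rewrite /ed /eval_deriv mderivZ !mevalZ.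
have edX j n : ed ('X_j ^+ n) (v j ^+ n) ((i == j)%:R * v j ^+ n.-1 *+ n).
  split; first by rewrite rmorphXn /= mevalXU.
  by rewrite mderivXUn mevalMn mevalM rmorphXn /= mevalXU -mderivXU (edV j).2.
have D p q a b c d (hp : ed p a c) (hq : ed q b d) := edD p q a b c d hp hq.
have M p q a b c d (hp : ed p a c) (hq : ed q b d) := edM p q a b c d hp hq.
have X22 j k := M _ _ _ _ _ _ (edX j 2) (edX k 2).
have X31 j k := M _ _ _ _ _ _ (edX j 3) (edV k).
have X13 j k := M _ _ _ _ _ _ (edV j) (edX k 3).
have Xyz := M _ _ _ _ _ _ (M _ _ _ _ _ _ (edV 0) (edV 1)) (edV 2).
have DX := D _ _ _ _ _ _ (D _ _ _ _ _ _ (edV 0) (edV 1)) (edV 2).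
have D22 := D _ _ _ _ _ _ (D _ _ _ _ _ _ (X22 0 1) (X22 0 2)) (X22 1 2).
have D31 := D _ _ _ _ _ _ (D _ _ _ _ _ _ (D _ _ _ _ _ _ (X31 0 1) (X13 0 1))
  (X31 0 2)) (X13 0 2).
have D13 := D _ _ _ _ _ _ (D _ _ _ _ _ _ D31 (X31 1 2)) (X13 1 2).
have D4 := D _ _ _ _ _ _ (D _ _ _ _ _ _ (edX 0 4) (edX 1 4)) (edX 2 4).
have [e de] := D _ _ _ _ _ _ (D _ _ _ _ _ _ (D _ _ _ _ _ _
  (M _ _ _ _ _ _ Xyz DX) (edZ t _ _ _ D22)) (edZ (t ^+ 2) _ _ _ D13))
  (edZ (t ^+ 5) _ _ _ D4).
move=> x y z; split; first exact: e.
rewrite [LHS]de -/x -/y -/z /=.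
move: (i == 0)%:R (i == 1)%:R (i == 2)%:R => d0 d1 d2.
by rewrite /quartic_dx; ring.
Qed.

Lemma quartic_eval (v : 'I_3 -> K) :
  quartic_poly.@[v] = quartic_form t (v 0) (v 1) (v 2).
Proof. exact: (quartic_eval_deriv 0 v).1. Qed.

Lemma quartic_deriv (v : 'I_3 -> K) :
  [/\ quartic_poly^`M(0).@[v] = quartic_dx t (v 0) (v 1) (v 2),
      quartic_poly^`M(1).@[v] = quartic_dx t (v 1) (v 0) (v 2) &
      quartic_poly^`M(2).@[v] = quartic_dx t (v 2) (v 0) (v 1)].
Proof.
by split; rewrite (quartic_eval_deriv _ v).2 /= !(mul0r, mul1r, add0r, addr0).
Qed.

Lemma quartic_homog : quartic_poly \is 4.-homog.
Proof.
have X i : ('X_i : {mpoly K[3]}) \is 1.-homog by rewrite dhomogX /= mdeg1.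
have M d e (p q : {mpoly K[3]}) :
    p \is d.-homog -> q \is e.-homog -> p * q \is (d + e).-homog.
  exact: dhomogM.
have Xn i n : ('X_i ^+ n : {mpoly K[3]}) \is n.-homog.
  elim: n => [|n IH]; first by rewrite expr0 dhomog1.
  by rewrite exprS; apply: (M 1%N n).
have D (p q : {mpoly K[3]}) d : p \is d.-homog -> q \is d.-homog -> p + q \is d.-homog.
  exact: rpredD.
have Z c (p : {mpoly K[3]}) d : p \is d.-homog -> c *: p \is d.-homog by apply: rpredZ.
have X22 i j := M 2%N 2%N _ _ (Xn i 2%N) (Xn j 2%N).
have X31 i j := M 3%N 1%N _ _ (Xn i 3%N) (X j).
have X13 i j := M 1%N 3%N _ _ (X i) (Xn j 3%N).
have Xyz := M 2%N 1%N _ _ (M 1%N 1%N _ _ (X 0) (X 1)) (X 2).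
have Xyzs := M 3%N 1%N _ _ Xyz (D _ _ _ (D _ _ _ (X 0) (X 1)) (X 2)).
have D22 := D _ _ _ (D _ _ _ (X22 0 1) (X22 0 2)) (X22 1 2).
have D31 := D _ _ _ (D _ _ _ (D _ _ _ (X31 0 1) (X13 0 1)) (X31 0 2)) (X13 0 2).
have D13 := D _ _ _ (D _ _ _ D31 (X31 1 2)) (X13 1 2).
have D4 := D _ _ _ (D _ _ _ (Xn 0 4%N) (Xn 1 4%N)) (Xn 2 4%N).
exact: D _ _ _ (D _ _ _ (D _ _ _ Xyzs (Z t _ _ D22)) (Z _ _ _ D13)) (Z _ _ _ D4).
Qed.
End QuarticPoly.

Lemma quartic_polyE (F : fieldType) : quartic F = quartic_poly (pmonom F 1).
Proof. by []. Qed.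

(** * Reduction of the quartic and of its lines *)
Section Lines.
Variable K : fieldType.
Hypothesis char0 : forall n, (0 < n)%N -> n%:R != 0 :> K.
Hypothesis sqrtK : forall x : K, exists y, y ^+ 2 = x.
Variables (t w : K).
Hypothesis hw : w ^+ 2 + w + 1 = 0.
Implicit Types (x y z u X Y p q : K) (l P : 'rV[K]_3).

Let n3 : 3%:R != 0 :> K. Proof. exact: char0. Qed.

(** The coefficients of the quartic as a polynomial in the elementary symmetric
    functions e1, e2, e3: [coef_e13] is that of e1 e3, [coef_e22] that of e2^2,
    [coef_e112] that of e1^2 e2 and [coef_e1111] that of e1^4. *)
Definition coef_e13 := 1 - 2%:R * t - t ^+ 2 + 4%:R * t ^+ 5.
Definition coef_e22 := t - 2%:R * t ^+ 2 + 2%:R * t ^+ 5.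
Definition coef_e112 := t ^+ 2 - 4%:R * t ^+ 5.
Definition coef_e1111 := t ^+ 5.

Definition alpha := coef_e13 + 3%:R * coef_e22 + 9%:R * coef_e112 + 27%:R * coef_e1111.
Definition beta := - 3%:R * coef_e13 - 6%:R * coef_e22 - 9%:R * coef_e112.
Definition gamma := 3%:R * coef_e22.
Definition delta := coef_e13.

Definition reduced_form u X Y :=
  alpha * u ^+ 4 + beta * u ^+ 2 * (X * Y) + gamma * (X * Y) ^+ 2
  + delta * u * (X ^+ 3 + Y ^+ 3).

Lemma quartic_form_sym x y z :
  let e1 := x + (y + z) in let e2 := x * (y + z) + y * z in let e3 := x * (y * z) in
  quartic_form t x y z = coef_e1111 * e1 ^+ 4 + coef_e112 * e1 ^+ 2 * e2
   + coef_e22 * e2 ^+ 2 + coef_e13 * e1 * e3.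
Proof.
rewrite /quartic_form /coef_e1111 /coef_e112 /coef_e22 /coef_e13 /=; ring.
Qed.

Lemma quartic_form_reduced u X Y :
  quartic_form t (u + X + Y) (u + w ^+ 2 * X + w * Y) (u + w * X + w ^+ 2 * Y)
  = 3%:R * reduced_form u X Y.
Proof.
rewrite quartic_form_sym.
have -> : u + w ^+ 2 * X + w * Y + (u + w * X + w ^+ 2 * Y) = 2%:R * u - X - Y.
  by apply: (eq_lincomb (k := X + Y) hw); ring.
have -> : (u + w ^+ 2 * X + w * Y) * (u + w * X + w ^+ 2 * Y)
    = u ^+ 2 - u * (X + Y) + X ^+ 2 + Y ^+ 2 - X * Y.
  by apply: (eq_lincomb (k := u * (X + Y) + (w - 1) * (X ^+ 2 + Y ^+ 2)
    + (1 + w ^+ 2 - w) * (X * Y)) hw); ring.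
rewrite /reduced_form /alpha /beta /gamma /delta; ring.
Qed.

(** The line u = pX + qY in the original coordinates. *)
Definition line_of p q : 'rV[K]_3 :=
  row3 (1 - p - q) (1 - w * p - w ^+ 2 * q) (1 - w ^+ 2 * p - w * q).

Lemma quartic_poly_binary (P Q : 'rV[K]_3) : exists c0 c1 c2 c3 c4,
  binary_quartic (quartic_poly t) P Q c0 c1 c2 c3 c4.
Proof.
have [c0 [c1 [c2 [c3 [c4 E]]]]] := quartic_form_binary t
  (P 0 0) (P 0 1) (P 0 2) (Q 0 0) (Q 0 1) (Q 0 2).
exists c0, c1, c2, c3, c4 => a b.
by rewrite quartic_eval !mxE -E.
Qed.

Lemma bitangent_line_of c p q : c != 0 ->
  bitangent (quartic_poly t) (c *: line_of p q) <->
  exists r0 r1 r2, (r0 != 0) || (r1 != 0) || (r2 != 0) /\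
    square_line alpha beta gamma delta p q r0 r1 r2.
Proof.
move=> c0.
pose e := row3 (p + 1) (p + w ^+ 2) (p + w).
pose e' := row3 (q + 1) (q + w) (q + w ^+ 2).
have cE : c *: line_of p q = row3 (c * (1 - p - q)) (c * (1 - w * p - w ^+ 2 * q))
   (c * (1 - w ^+ 2 * p - w * q)) by rewrite row3Z.
have le : on_line (c *: line_of p q) e.
  apply/on_lineE; rewrite cE !row3E.
  by apply: (eq_lincomb (k := c * (1 - (p + q) * p - 2%:R * (w - 1) * p
     - q * (w ^+ 2 - w + 1))) hw); ring.
have le' : on_line (c *: line_of p q) e'.
  apply/on_lineE; rewrite cE !row3E.
  by apply: (eq_lincomb (k := c * (1 - (p + q) * q - 2%:R * (w - 1) * q
     - p * (w ^+ 2 - w + 1))) hw); ring.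
have eE a b : a *: e + b *: e' = row3 (a * (p + 1) + b * (q + 1))
   (a * (p + w ^+ 2) + b * (q + w)) (a * (p + w) + b * (q + w ^+ 2)).
  by rewrite !row3Z row3D.
have free a b : a *: e + b *: e' = 0 -> a = 0 /\ b = 0.
  rewrite eE => /eqP; rewrite row3_eq0 => /and3P[/eqP h0 /eqP h1 /eqP h2].
  split; apply: (mulfI n3); rewrite mulr0.
    have h : (a * (p + 1) + b * (q + 1)) + w * (a * (p + w ^+ 2) + b * (q + w))
       + w ^+ 2 * (a * (p + w) + b * (q + w ^+ 2)) = 0 by rewrite h0 h1 h2; ring.
    by apply: (eq_lincomb2 (k := 1) (l := - (a * p + b * q + 2%:R * (w - 1) * a
      + b * (w ^+ 2 - w + 1))) h hw); ring.
  have h : (a * (p + 1) + b * (q + 1)) + w ^+ 2 * (a * (p + w ^+ 2) + b * (q + w))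
       + w * (a * (p + w) + b * (q + w ^+ 2)) = 0 by rewrite h0 h1 h2; ring.
  by apply: (eq_lincomb2 (k := 1) (l := - (a * p + b * q + 2%:R * (w - 1) * b
      + a * (w ^+ 2 - w + 1))) h hw); ring.
have span R : on_line (c *: line_of p q) R -> exists a b, R = a *: e + b *: e'.
  move/on_lineE; rewrite cE !row3E [R]row3_eta.
  move: (R 0 0) (R 0 1) (R 0 2) => x y z; rewrite !row3E => h.
  have {}h : x + y + z = p * (x + w * y + w ^+ 2 * z) + q * (x + w ^+ 2 * y + w * z).
    by apply: (mulfI c0); apply: (eq_lincomb (k := 1) h); ring.
  exists ((x + w * y + w ^+ 2 * z) / 3%:R), ((x + w ^+ 2 * y + w * z) / 3%:R).
  rewrite eE; congr row3.
  - by apply: (eq_lincomb2 (k := 3%:R^-1) (l := - (y + z) / 3%:R) h hw); field.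
  - by apply: (eq_lincomb2 (k := 3%:R^-1)
      (l := - (x + 2%:R * (w - 1) * y + (w ^+ 2 - w + 1) * z) / 3%:R) h hw); field.
  by apply: (eq_lincomb2 (k := 3%:R^-1)
      (l := - (x + 2%:R * (w - 1) * z + (w ^+ 2 - w + 1) * y) / 3%:R) h hw); field.
have l0 : c *: line_of p q != 0.
  rewrite scaler_eq0 negb_or c0 row3_eq0; apply/negP => /and3P[/eqP h0 /eqP h1 /eqP h2].
  have : (1 - p - q) + (1 - w * p - w ^+ 2 * q) + (1 - w ^+ 2 * p - w * q) = 0.
    by rewrite h0 h1 h2 !addr0.
  move=> h; case/eqP: n3; apply: (eq_lincomb2 (k := 1) (l := p + q) h hw); ring.
have n3' : 3%:R^-1 != 0 :> K by rewrite invr_eq0.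
rewrite (bitangentP char0 sqrtK quartic_poly_binary n3' l0 le le' free span).
have E X Y : 3%:R^-1 * (quartic_poly t).@[(X *: e + Y *: e') 0] =
   alpha * (p * X + q * Y) ^+ 4 + beta * (p * X + q * Y) ^+ 2 * (X * Y)
    + gamma * (X * Y) ^+ 2 + delta * (p * X + q * Y) * (X ^+ 3 + Y ^+ 3).
  rewrite quartic_eval eE !row3E.
  rewrite [X in quartic_form _ X](_ : _ = (p * X + q * Y) + X + Y); last by ring.
  rewrite [X in quartic_form _ _ X](_ : _ = (p * X + q * Y) + w ^+ 2 * X + w * Y);
    last by ring.
  rewrite [X in quartic_form _ _ _ X](_ : _ = (p * X + q * Y) + w * X + w ^+ 2 * Y);
    last by ring.
  by rewrite quartic_form_reduced mulKf.
have n2 : 2%:R != 0 :> K by apply: char0.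
split=> -[r0 [r1 [r2 [rn H]]]]; exists r0, r1, r2; split=> //.
  by apply/(square_lineP n2 n3) => X Y; rewrite -E H.
by move/(square_lineP n2 n3): H => H X Y; rewrite E H.
Qed.

Hypotheses (al0 : alpha != 0) (ga0 : gamma != 0) (de0 : delta != 0)
  (disc0 : beta ^+ 2 - 4%:R * alpha * gamma != 0).

(** A line of coordinate sum 0 passes through (1:1:1).  With this point and
    w = l x (1,1,1) as a basis, the coefficients of the quartic on the line
    involve only the elementary symmetric functions of w.  If it is a square,
    these functions all vanish, hence so do w and l. *)
Lemma not_bitangent_sum0 l : l 0 0 + l 0 1 + l 0 2 = 0 -> ~ bitangent (quartic_poly t) l.
Proof.
move=> ls; have [->|l0] := eqVneq l 0; first by case; rewrite eqxx.
have n2 : 2%:R != 0 :> K by apply: char0.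
move: ls l0 (row3_eta l); move: (l 0 0) (l 0 1) (l 0 2) => l1 l2 l3 ls l0 lE.
pose w1 := l2 - l3; pose w2 := l3 - l1; pose w3 := l1 - l2.
have w0 : ~~ [&& w1 == 0, w2 == 0 & w3 == 0].
  apply: contraNN l0 => /and3P[/eqP/subr0_eq h1 /eqP/subr0_eq h2 _].
  have h3 : l3 = 0 by apply: (mulfI n3); rewrite mulr0 -ls h1 -h2; ring.
  by rewrite lE row3_eq0 h1 -h2 h3 eqxx.
pose e : 'rV[K]_3 := row3 1 1 1; pose e' := row3 w1 w2 w3.
have le : on_line l e by apply/on_lineE; rewrite lE !row3E !mulr1.
have le' : on_line l e' by apply/on_lineE; rewrite lE !row3E /w1 /w2 /w3; ring.
have eE a b : a *: e + b *: e' = row3 (a + b * w1) (a + b * w2) (a + b * w3).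
  by rewrite !row3Z row3D !mulr1.
have free a b : a *: e + b *: e' = 0 -> a = 0 /\ b = 0.
  rewrite eE => /eqP; rewrite row3_eq0 => /and3P[/eqP h0 /eqP h1 /eqP h2].
  have a0 : a = 0.
    apply: (mulfI n3); rewrite mulr0.
    transitivity ((a + b * w1) + (a + b * w2) + (a + b * w3)); last first.
      by rewrite h0 h1 h2 !addr0.
    by rewrite /w1 /w2 /w3; ring.
  split=> //; apply/eqP; apply: contraNT w0 => b0.
  rewrite a0 !add0r in h0 h1 h2; move/eqP: h0; move/eqP: h1; move/eqP: h2.
  by rewrite !mulf_eq0 (negPf b0) /= => -> -> ->.
have span R : on_line l R -> exists a b, R = a *: e + b *: e'.
  move/on_lineE; rewrite lE !row3E [R]row3_eta.
  move: (R 0 0) (R 0 1) (R 0 2) => x y z; rewrite !row3E => h.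
  pose a := (x + y + z) / 3%:R.
  have m3 : (x - a) * w2 = (y - a) * w1.
    by apply: (eq_lincomb2 (k := -1) (l := a - 0) h ls); rewrite /a /w1 /w2; field.
  have m1 : (y - a) * w3 = (z - a) * w2.
    by apply: (eq_lincomb2 (k := -1) (l := a) h ls); rewrite /a /w3 /w2; field.
  have m2 : (z - a) * w1 = (x - a) * w3.
    by apply: (eq_lincomb2 (k := -1) (l := a) h ls); rewrite /a /w3 /w1; field.
  have [b [b1 b2 b3]] : exists b, [/\ x - a = b * w1, y - a = b * w2 & z - a = b * w3].
    have [z1|z1] := eqVneq w1 0; last first.
      exists ((x - a) / w1); split; first by rewrite mulfVK.
        by rewrite mulrAC m3 mulfK.
      by rewrite mulrAC -m2 mulfK.
    have [z2|z2] := eqVneq w2 0; last first.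
      exists ((y - a) / w2); split; last by rewrite mulrAC m1 mulfK.
        by rewrite mulrAC -m3 mulfK.
      by rewrite mulfVK.
    have z3 : w3 != 0 by move: w0; rewrite z1 z2 eqxx.
    exists ((z - a) / w3); split; last by rewrite mulfVK.
      by rewrite mulrAC m2 mulfK.
    by rewrite mulrAC -m1 mulfK.
  by exists a, b; rewrite eE -b1 -b2 -b3; congr row3; ring.
move/(bitangentP char0 sqrtK quartic_poly_binary (oner_neq0 K) l0 le le' free span).
move=> [r0 [r1 [r2 [_ H]]]].
pose s2 := w1 * w2 + w2 * w3 + w3 * w1; pose s3 := w1 * w2 * w3.
have w123 : w1 + w2 + w3 = 0 by rewrite /w1 /w2 /w3; ring.
have w3E : w3 = - w1 - w2 by rewrite /w1 /w2 /w3; ring.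
have [] := @binary_quartic_eq0 K n2 n3 (3%:R * alpha - r0 ^+ 2) (- (2%:R * r0 * r1))
   (- (beta * s2) - (r1 ^+ 2 + 2%:R * r0 * r2))
   (3%:R * delta * s3 - 2%:R * r1 * r2) (gamma * s2 ^+ 2 / 3%:R - r2 ^+ 2).
  move=> X Y; have := H X Y.
  rewrite mul1r quartic_eval eE !row3E quartic_form_sym /= => /eqP.
  rewrite -subr_eq0 => /eqP <-.
  by rewrite /alpha /beta /gamma /delta /s2 /s3 w3E; field.
move=> /subr0_eq h0 h1 /subr0_eq h2 /subr0_eq h3 /subr0_eq h4.
have r00 : r0 != 0 by rewrite -sqrf_eq0 -h0 mulf_neq0.
have r10 : r1 = 0.
  by move/eqP: h1; rewrite oppr_eq0 !mulf_eq0 (negPf n2) (negPf r00) => /eqP.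
have s30 : s3 = 0.
  by apply: (mulfI (mulf_neq0 n3 de0)); rewrite h3 r10; ring.
have s20 : s2 = 0.
  have /eqP : (beta ^+ 2 - 4%:R * alpha * gamma) * s2 ^+ 2 = 0.
    rewrite r10 in h2.
    have h2' : (beta * s2) ^+ 2 = 4%:R * r0 ^+ 2 * r2 ^+ 2.
      by rewrite -[beta * s2]opprK h2; ring.
    by apply: (eq_lincomb (k := 1) h2'); rewrite -h0 -h4; field.
  by rewrite mulf_eq0 (negPf disc0) sqrf_eq0 => /eqP.
have w1_0 x : (x - w1) * (x - w2) * (x - w3) = 0 -> x = 0.
  have -> : (x - w1) * (x - w2) * (x - w3) = x ^+ 3.
    apply: (eq_lincomb3 (k := - x ^+ 2) (l := x) (m := -1) w123 s20 s30).
    by rewrite /s2 /s3; ring.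
  by move/eqP; rewrite expf_eq0 => /eqP.
case/negP: w0; apply/and3P; split; apply/eqP; apply: w1_0;
  by rewrite subrr ?mul0r ?mulr0 ?mul0r.
Qed.
End Lines.

Ltac unfold_coefs := rewrite /alpha /beta /gamma /delta
  /coef_e13 /coef_e22 /coef_e112 /coef_e1111.

(** * The twenty-eight lines *)
Lemma uniq_flatten_key (A B : eqType) (key : A -> B) (bs : seq (B * seq A)) :
  uniq (unzip1 bs) ->
  all (fun b => uniq b.2 && all (fun x => key x == b.1) b.2) bs ->
  uniq (flatten (unzip2 bs)).
Proof.
elim: bs => [//|[k s] bs IH] /= /andP[kn u] /andP[/andP[us /allP ks] h].
rewrite cat_uniq us IH // andbT /=; apply/hasPn => x /flattenP[s' /mapP[[k' s''] b /= ->] xs'].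
apply: contraNN kn => xs; apply/mapP; exists (k', s'') => //=.
have /allP/(_ _ b)/andP[_ /allP/(_ _ xs')/eqP e] := h.
by apply: etrans e; apply/esym/eqP/ks.
Qed.

Section Enumeration.
Variable K : fieldType.
Hypothesis char0 : forall n, (0 < n)%N -> n%:R != 0 :> K.
Hypothesis sqrtK : forall x : K, exists y, y ^+ 2 = x.
Variables (t w : K).
Hypothesis hw : w ^+ 2 + w + 1 = 0.
Implicit Types (x y z m r p q : K) (l : 'rV[K]_3) (T : K * K * K).
Local Notation al := (alpha t).
Local Notation be := (beta t).
Local Notation ga := (gamma t).
Local Notation de := (delta t).
Hypotheses (al0 : al != 0) (ga0 : ga != 0) (de0 : de != 0)
  (disc0 : be ^+ 2 - 4%:R * al * ga != 0).

Let n2 : 2%:R != 0 :> K. Proof. exact: char0. Qed.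
Let n3 : 3%:R != 0 :> K. Proof. exact: char0. Qed.

(** The equation for m = pq in [general_line]. *)
Definition line_cubic m := m * ((4%:R * al * m + be) ^+ 2 - 4%:R * al * ga) - de ^+ 2.

(** The value of delta l0 l1 l2 for a line with coordinates (l0, l1, l2) of sum
    3, obtained from l0 l1 l2 = 1 - 3 pq - (p^3 + q^3). *)
Definition line_e3 m := de * (1 - 3%:R * m)
  - (4%:R * ga * m - 2%:R * (4%:R * al * m + be) * m ^+ 2).

Definition perms3 r : seq (K * K * K) :=
  [:: (1 - 2%:R * r, 1 + r, 1 + r); (1 + r, 1 - 2%:R * r, 1 + r);
      (1 + r, 1 + r, 1 - 2%:R * r)].

Definition perms6 T : seq (K * K * K) := let: (a, b, c) := T in
  [:: (a, b, c); (a, c, b); (b, a, c); (b, c, a); (c, a, b); (c, b, a)].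

Definition general_triple m T := let: (x, y, z) := T in
  [/\ line_cubic m = 0, x + y + z = 3%:R, x * y + y * z + z * x = 3%:R - 3%:R * m &
      de * (x * y * z) = line_e3 m].

(** [square_lineE] in terms of the line coordinates: one has l = [line_of] p q
    with e2 = 3 - 3 pq and e3 = 1 - 3 pq - (p^3 + q^3). *)
Lemma bitangent_triple c x y z : c != 0 -> x + y + z = 3%:R ->
  bitangent (quartic_poly t) (c *: row3 x y z) <->
  [\/ (x, y, z) = (1, 1, 1),
      exists2 r, diag_cubic al be ga de r = 0 & (x, y, z) \in perms3 r |
      exists m, general_triple m (x, y, z)].
Proof.
move=> c0 s3.
pose p := - (x + w ^+ 2 * y + w * z) / 3%:R; pose q := - (x + w * y + w ^+ 2 * z) / 3%:R.
have zE : z = 3%:R - x - y by rewrite -s3; ring.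
have xE : x = 1 - p - q.
  by apply: (eq_lincomb2 (k := 3%:R^-1) (l := - (y + z) / 3%:R) s3 hw); rewrite /p /q; field.
have yE : y = 1 - w * p - w ^+ 2 * q.
  by apply: (eq_lincomb2 (k := 3%:R^-1)
      (l := - (x + 2%:R * (w - 1) * y + (w ^+ 2 - w + 1) * z) / 3%:R) s3 hw);
    rewrite /p /q; field.
have zE' : z = 1 - w ^+ 2 * p - w * q.
  by apply: (eq_lincomb2 (k := 3%:R^-1)
      (l := - (x + 2%:R * (w - 1) * z + (w ^+ 2 - w + 1) * y) / 3%:R) s3 hw);
    rewrite /p /q; field.
have -> : row3 x y z = line_of w p q by rewrite {1}xE {1}yE {1}zE'.
have [s sg] := sqrtK ga.
rewrite bitangent_line_of // -/(square_line_ex _ _ _ _ p q).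
rewrite (square_lineE n2 al be ga0 de0 hw p q sg).
have yz : y * z = 1 + (p + q) + p ^+ 2 + q ^+ 2 - p * q.
  rewrite yE zE'; apply: (eq_lincomb (k := - (p + q) + (w - 1) * (p ^+ 2 + q ^+ 2)
    + (1 + w ^+ 2 - w) * (p * q)) hw); ring.
have yzD : y + z = 2%:R + p + q by rewrite zE xE; ring.
have e2 : x * y + y * z + z * x = 3%:R - 3%:R * (p * q).
  transitivity (x * (y + z) + y * z); first by ring.
  by rewrite yz yzD xE; ring.
have e3 : x * y * z = 1 - 3%:R * (p * q) - (p ^+ 3 + q ^+ 3).
  by rewrite -mulrA yz xE; ring.
have w3 := cube_root1 hw.
split.
- move=> [[p0 q0]|[r Er pq]|[gI gn]].
  + by apply: Or31; congr (_, _, _); rewrite ?xE ?yE ?zE' p0 q0; ring.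
  + apply: Or32; exists r => //; rewrite !inE xE yE zE'.
    case: pq => -[-> ->]; [apply/or3P/Or31|apply/or3P/Or33|apply/or3P/Or32].
    * apply/eqP; congr (_, _, _); first by ring.
        by apply: (eq_lincomb (k := - r) hw); ring.
      by apply: (eq_lincomb (k := - r) hw); ring.
    * apply/eqP; congr (_, _, _); first by apply: (eq_lincomb (k := - r) hw); ring.
        by apply: (eq_lincomb2 (k := - r) (l := - w * r) hw w3); ring.
      by apply: (eq_lincomb (k := - 2%:R * r) w3); ring.
    * apply/eqP; congr (_, _, _); first by apply: (eq_lincomb (k := - r) hw); ring.
        by apply: (eq_lincomb (k := - 2%:R * r) w3); ring.
      by apply: (eq_lincomb2 (k := - r) (l := - w * r) hw w3); ring.
  apply: Or33; exists (p * q); split=> //; first by rewrite /line_cubic gI subrr.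
  by rewrite e3 mulrBr gn.
move=> [[x1 y1 z1]|[r Er]|[m [mI _ e2' e3']]].
- apply: Or31; rewrite /p /q x1 y1 z1; split;
  by apply: (eq_lincomb (k := - 3%:R^-1) hw); field.
- rewrite !inE => /or3P[] /eqP[x1 y1 z1]; apply: Or32; exists r => //;
    rewrite /p /q x1 y1 z1.
  + apply: Or31; split; by apply: (eq_lincomb (k := - (1 + r) / 3%:R) hw); field.
  + apply: Or33; split.
      by apply: (eq_lincomb (k := - (1 + r) / 3%:R) hw); field.
    by apply: (eq_lincomb (k := - (1 + r) / 3%:R) hw); field.
  apply: Or32; split; by apply: (eq_lincomb (k := - (1 + r) / 3%:R) hw); field.
have mE : p * q = m.
  by apply: (mulfI n3); apply: (eq_lincomb2 (k := -1) (l := 1) e2' e2); ring.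
apply: Or33; rewrite /general_line /theta mE; split; first exact: subr0_eq.
rewrite mE in e3; move: e3'; rewrite e3 /line_e3 => e3'.
by apply: (eq_lincomb (k := -1) e3'); ring.
Qed.

Lemma cubic_roots (k0 k1 k2 k3 x1 x2 x3 x : K) :
  k3 != 0 -> uniq [:: x1; x2; x3] ->
  (forall y, y \in [:: x; x1; x2; x3] -> k0 + k1 * y + k2 * y ^+ 2 + k3 * y ^+ 3 = 0) ->
  x \in [:: x1; x2; x3].
Proof.
move=> k30 u H; apply: contraNT k30 => xn.
have P0 : Poly [:: k0; k1; k2; k3] = 0.
  apply/eqP; apply/negPn/negP => P0.
  have := @max_poly_roots K (Poly [:: k0; k1; k2; k3]) [:: x; x1; x2; x3] P0.
  have -> : all (root (Poly [:: k0; k1; k2; k3])) [:: x; x1; x2; x3].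
    apply/allP => y /H e; rewrite /root horner_Poly /= -[X in _ == X]e; apply/eqP; ring.
  move=> /(_ isT); rewrite cons_uniq xn u => /(_ isT).
  by rewrite ltnNge size_Poly.
by have := congr1 (fun P : {poly K} => P`_3) P0; rewrite coef_Poly coef0 /= => ->.
Qed.

(** A triple is determined up to permutation by its elementary symmetric
    functions. *)
Lemma same_triple x y z a b c :
  x + y + z = a + b + c -> x * y + y * z + z * x = a * b + b * c + c * a ->
  x * y * z = a * b * c -> (x, y, z) \in perms6 (a, b, c).
Proof.
move=> h1 h2 h3.
have pair (u v u' v' : K) : u + v = u' + v' -> u * v = u' * v' ->
    (u, v) = (u', v') \/ (u, v) = (v', u').
  move=> hs hp; have /eqP : (u - u') * (u - v') = 0.
    by apply: (eq_lincomb2 (k := u) (l := -1) hs hp); ring.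
  rewrite mulf_eq0 => /orP[]/eqP/subr0_eq uE; [left|right]; congr (_, _) => //.
    by apply: (eq_lincomb (k := 1) hs); rewrite uE; ring.
  by apply: (eq_lincomb (k := 1) hs); rewrite uE; ring.
have rest (d e f : K) : d + e + f = a + b + c ->
    d * e + e * f + f * d = a * b + b * c + c * a -> x = d ->
    (y, z) = (e, f) \/ (y, z) = (f, e).
  move=> g1 g2 xd; have hs : y + z = e + f.
    by apply: (eq_lincomb2 (k := 1) (l := -1) h1 g1); rewrite xd; ring.
  apply: pair => //; apply: (eq_lincomb3 (k := 1) (l := -1) (m := - d) h2 g2 hs).
  by rewrite xd; ring.
have /eqP : (x - a) * ((x - b) * (x - c)) = 0.
  by apply: (eq_lincomb3 (k := x ^+ 2) (l := - x) (m := 1) h1 h2 h3); ring.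
rewrite /perms6 !mulf_eq0 => /or3P[] /eqP/subr0_eq xE.
- by have [||[-> ->]|[-> ->]] := rest a b c _ _ xE; rewrite ?xE ?inE ?eqxx ?orbT.
- have [||[-> ->]|[-> ->]] := rest b a c _ _ xE; rewrite ?xE ?inE ?eqxx ?orbT //; ring.
have [||[-> ->]|[-> ->]] := rest c a b _ _ xE; rewrite ?xE ?inE ?eqxx ?orbT //; ring.
Qed.

(** All the roots of the two cubics, and for each root m of [line_cubic] one
    triple with the symmetric functions that it prescribes. *)
Variables (rs : seq K) (Ts : seq (K * (K * K * K))).
Hypothesis rs_uniq : uniq rs.
Hypothesis rs_roots : forall r, r \in rs <-> diag_cubic al be ga de r = 0.
Hypothesis ms_uniq : uniq (unzip1 Ts).
Hypothesis ms_roots : forall m, m \in unzip1 Ts <-> line_cubic m = 0.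
Hypothesis Ts_general : forall mT, mT \in Ts ->
  general_triple mT.1 mT.2 /\ uniq [:: mT.2.1.1; mT.2.1.2; mT.2.2].

Definition lines28 : seq (K * K * K) :=
  (1, 1, 1) :: flatten [seq perms3 r | r <- rs] ++ flatten [seq perms6 mT.2 | mT <- Ts].

Lemma perms6_sum T T' : T' \in perms6 T ->
  let: (a, b, c) := T in let: (x, y, z) := T' in
  [/\ x + y + z = a + b + c, x * y + y * z + z * x = a * b + b * c + c * a &
      x * y * z = a * b * c].
Proof.
case: T T' => [[a b] c] [[x y] z]; rewrite !inE.
by case/or4P => [||| /or3P[]] /eqP[-> -> ->]; split; ring.
Qed.

Lemma lines28_sum x y z : (x, y, z) \in lines28 -> x + y + z = 3%:R.
Proof.
rewrite inE mem_cat.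
case/or3P=> [/eqP[-> -> ->]|/flatten_mapP[r _]|/flatten_mapP[[m [[a b] c]] mT]].
- by ring.
- by rewrite !inE => /or3P[]/eqP[-> -> ->]; ring.
by move=> /perms6_sum[-> _ _]; have [[]] := Ts_general mT.
Qed.

Lemma lines28P x y z : x + y + z = 3%:R ->
  (x, y, z) \in lines28 <->
  [\/ (x, y, z) = (1, 1, 1),
      exists2 r, diag_cubic al be ga de r = 0 & (x, y, z) \in perms3 r |
      exists m, general_triple m (x, y, z)].
Proof.
move=> s3; rewrite inE mem_cat; split.
  move=> /or3P[/eqP h|/flatten_mapP[r /rs_roots h rE]|/flatten_mapP[[m [[a b] c]] mT h]].
  - exact: Or31.
  - by apply: Or32; exists r.
  apply: Or33; exists m; have [_ h2 h3] := perms6_sum h.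
  have [[/= g0 g1 g2 g3] _] := Ts_general mT.
  by split=> //; rewrite ?h2 ?h3.
move=> [->|[r /rs_roots rr xr]|[m [m0 _ e2 e3]]].
- by rewrite eqxx.
- by apply/or3P/Or32; apply/flatten_mapP; exists r.
apply/or3P/Or33; apply/flatten_mapP.
have /ms_roots/mapP[[m' [[a b] c]] mT /= mE] := m0.
exists (m', (a, b, c)) => //; have [[/= _ g1 g2 g3] _] := Ts_general mT.
rewrite -mE in g2 g3; apply: same_triple; first by rewrite s3 g1.
  by rewrite e2 g2.
by apply: (mulfI de0); rewrite e3 g3.
Qed.

Lemma bitangent_lines28 l :
  bitangent (quartic_poly t) l <->
  exists T c, [/\ T \in lines28, c != 0 & l = c *: row3 T.1.1 T.1.2 T.2].
Proof.
split=> [bl|[[[x y] z] [c [T c0 ->]]]]; last first.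
  have s3 := lines28_sum T.
  by apply/(bitangent_triple c0 s3)/lines28P.
have [s0|s0] := eqVneq (l 0 0 + l 0 1 + l 0 2) 0.
  by case: (not_bitangent_sum0 char0 sqrtK al0 de0 disc0 s0 bl).
move: bl; rewrite [l]row3_eta; move: (l 0 0) (l 0 1) (l 0 2) s0 => l0 l1 l2 s0 bl.
pose k := 3%:R / (l0 + l1 + l2); pose c := (l0 + l1 + l2) / 3%:R.
have c0 : c != 0 by rewrite mulf_neq0 ?invr_eq0.
have lE : row3 l0 l1 l2 = c *: row3 (k * l0) (k * l1) (k * l2).
  by rewrite row3Z /c /k; congr row3; field; rewrite ?s0.
have s3 : k * l0 + k * l1 + k * l2 = 3%:R by rewrite /k; field.
exists (k * l0, k * l1, k * l2), c; split=> //.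
by apply/(lines28P s3)/(bitangent_triple c0 s3); rewrite -lE.
Qed.

Lemma line_cubic_neq0 m : line_cubic m = 0 -> m != 0.
Proof.
move=> mE; apply: contraNneq de0 => m0; rewrite -sqrf_eq0 -oppr_eq0.
by rewrite -mE /line_cubic m0; apply/eqP; ring.
Qed.

Lemma diag_root_neq0 r : diag_cubic al be ga de r = 0 -> r != 0.
Proof.
move=> rE; apply: contraNneq (mulf_neq0 ga0 de0) => r0.
have n4 : - 4%:R != 0 :> K by rewrite oppr_eq0 char0.
by apply/eqP/(mulfI n4); rewrite mulr0 -rE /diag_cubic r0; ring.
Qed.

(** The second and third elementary symmetric functions separate the roots; the
    last component separates the lines with a repeated coordinate from the
    others. *)
Let key T := let: (x, y, z) := T in
  (x * y + y * z + z * x, x * y * z, (x - y) * (y - z) * (z - x) == 0).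

Lemma lines28_uniq : uniq lines28.
Proof.
pose bs := ((3%:R, 1, true), [:: (1, 1, 1)])
  :: [seq ((3%:R - 3%:R * r ^+ 2, 1 - 3%:R * r ^+ 2 - 2%:R * r ^+ 3, true),
           perms3 r) | r <- rs]
  ++ [seq ((3%:R - 3%:R * mT.1, line_e3 mT.1 / de, false),
           perms6 mT.2) | mT <- Ts].
have -> : lines28 = flatten (unzip2 bs).
  rewrite /bs /= /unzip2 map_cat -!map_comp flatten_cat /lines28.
  by congr (_ :: flatten _ ++ flatten _); apply: eq_map.
apply: (@uniq_flatten_key _ _ key).
  rewrite /bs /= /unzip1 map_cat -!map_comp mem_cat negb_or cat_uniq; apply/and3P; split.
  - apply/andP; split; apply/mapP => -[]; last by move=> ? _ [].
    move=> r /rs_roots/diag_root_neq0/negP r0 [/eqP]; rewrite -subr_eq0 => e _; apply: r0.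
    rewrite -sqrf_eq0; apply: contraTT e => e.
    by rewrite opprB addrCA subrr addr0 mulf_neq0.
  - rewrite map_inj_in_uniq // => r r' /rs_roots/diag_root_neq0 r0 _ [e2 e3].
    have e2' : r ^+ 2 = r' ^+ 2.
      by apply: (mulfI n3); apply: (eq_lincomb (k := -1) e2); ring.
    apply: (mulfI (expf_neq0 2 r0)); rewrite {2}e2' -!exprSr.
    by apply: (mulfI n2); apply: (eq_lincomb2 (k := -1) (l := - 3%:R) e3 e2'); ring.
  apply/andP; split.
    by apply/hasPn => k /mapP[mT _ ->] /=; apply/mapP => -[? _ []].
  rewrite (_ : map _ _ =
      map (fun m => (3%:R - 3%:R * m, line_e3 m / de, false)) (unzip1 Ts)); last first.
    by rewrite -map_comp.
  rewrite map_inj_uniq // => m m' [e2 _].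
  by apply: (mulfI n3); apply: (eq_lincomb (k := -1) e2); ring.
rewrite /bs /= all_cat !all_map; apply/and3P; split.
- rewrite andbT /key; apply/eqP; congr (_, _, _); [ring|ring|].
  by rewrite subrr mulr0 eqxx.
- apply/allP => r /rs_roots/diag_root_neq0 r0 /=.
  have r3 : 3%:R * r != 0 by rewrite mulf_neq0.
  have d1 : 1 + r != 1 - 2%:R * r.
    by rewrite -subr_eq0 (_ : _ - _ = 3%:R * r) //; ring.
  apply/andP; split.
    by rewrite !inE !xpair_eqE !eqxx (eq_sym (1 - 2%:R * r)) (negPf d1) /=.
  rewrite !subrr !(mulr0, mul0r) eqxx andbT; apply/and3P.
  by split; apply/eqP; congr (_, _, _); ring.
apply/allP => -[m [[a b] c]] mT; have [[/= _ g1 g2 g3]] := Ts_general mT.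
rewrite !inE negb_or andbT => /andP[/andP[ab ac] bc].
have D0 : (a - b) * (b - c) * (c - a) != 0.
  by rewrite !mulf_neq0 // subr_eq0 // eq_sym.
have kall : all (fun T => key T == (3%:R - 3%:R * m, line_e3 m / de, false))
    (perms6 (a, b, c)).
  apply/allP => T' /[dup] T'p /perms6_sum; case: T' T'p => [[x y] z] T'p [_ h2 h3].
  rewrite /key h2 h3 g2 -g3 [de * _]mulrC mulfK // !xpair_eqE !eqxx /=.
  suff : ((x - y) * (y - z) * (z - x)) ^+ 2 = ((a - b) * (b - c) * (c - a)) ^+ 2.
    by move=> e; rewrite eqbF_neg -sqrf_eq0 e sqrf_eq0.
  by move: T'p; rewrite !inE; case/or4P => [||| /or3P[]] /eqP[-> -> ->]; ring.
apply/andP; split.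
  rewrite !xpair_eqE !eqxx !(eq_sym c) !(eq_sym b a).
  by rewrite (negPf ab) (negPf ac) (negPf bc) /= ?andbF.
exact: kall.
Qed.

End Enumeration.

(** * Smoothness *)
Section Smoothness.
Variable K : fieldType.
Hypothesis char0 : forall n, (0 < n)%N -> n%:R != 0 :> K.
Variable t : K.
Implicit Types (x y z u X Y : K).
Local Notation al := (alpha t).
Local Notation be := (beta t).
Local Notation ga := (gamma t).
Local Notation de := (delta t).
Hypotheses (al0 : al != 0) (ga0 : ga != 0) (de0 : de != 0).

(** At a singular point with X = Y one finds sing_den * X = sing_num * u;
    [sing_res] is the conic be u^2 + 3 de uX + 2 ga X^2 at
    (u : X) = (sing_den : sing_num). *)
Definition sing_num := 2%:R * ga * (be ^+ 2 - 4%:R * al * ga) - 3%:R * be * de ^+ 2.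
Definition sing_den := de * (9%:R * de ^+ 2 - 8%:R * be * ga).
Definition sing_res := 2%:R * ga * sing_num ^+ 2 + 3%:R * de * sing_num * sing_den
  + be * sing_den ^+ 2.
Hypothesis res0 : sing_res != 0.

Let n2 : 2%:R != 0 :> K. Proof. exact: char0. Qed.
Let n3 : 3%:R != 0 :> K. Proof. exact: char0. Qed.

Lemma quartic_dxC x y z : quartic_dx t x y z = quartic_dx t x z y.
Proof. by rewrite /quartic_dx; ring. Qed.

(** In the coordinates (u, X) of the line X = Y, the equations are a cubic g1,
    the derivative with respect to u, and X times a conic g2.  Reducing g1
    modulo g2 gives a second conic, and the two conics a linear relation. *)
Lemma no_sing_two_equal x z :
  quartic_dx t x x z = 0 -> quartic_dx t z x x = 0 -> x = 0 /\ z = 0.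
Proof.
move=> hx hz.
pose u := (2%:R * x + z) / 3%:R; pose X := (z - x) / 3%:R.
have n6 : 6%:R != 0 :> K by apply: char0.
have xE : x = u - X by rewrite /u /X; field.
have zE : z = u + 2%:R * X by rewrite /u /X; field.
rewrite xE zE in hx hz; move: u X xE zE hx hz => u X -> -> hx hz.
have g1 : 2%:R * al * u ^+ 3 + be * u * X ^+ 2 + de * X ^+ 3 = 0.
  apply: (mulfI n6); apply: (eq_lincomb2 (k := 2%:R) (l := 1) hx hz).
  rewrite /alpha /beta /delta /coef_e13 /coef_e22 /coef_e112 /coef_e1111 /quartic_dx; ring.
have g2' : X * (be * u ^+ 2 + 3%:R * de * u * X + 2%:R * ga * X ^+ 2) = 0.
  apply: (mulfI n6); apply: (eq_lincomb2 (k := - 2%:R) (l := 2%:R) hx hz).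
  rewrite /gamma /beta /delta /coef_e13 /coef_e22 /coef_e112 /coef_e1111 /quartic_dx; ring.
have [X0|X0] := eqVneq X 0.
  have /eqP : u ^+ 3 = 0.
    by apply: (mulfI (mulf_neq0 n2 al0)); apply: (eq_lincomb (k := 1) g1); rewrite X0; ring.
  by rewrite expf_eq0 X0 => /eqP ->; split; ring.
have {}g2' : be * u ^+ 2 + 3%:R * de * u * X + 2%:R * ga * X ^+ 2 = 0.
  by apply: (mulfI X0); rewrite mulr0.
have u0 : u != 0.
  apply: contraNneq X0 => u0; have /eqP : X ^+ 3 = 0.
    by apply: (mulfI de0); apply: (eq_lincomb (k := 1) g1); rewrite u0; ring.
  by rewrite expf_eq0.
have g3 : (4%:R * al * ga - be ^+ 2) * u ^+ 2 - 4%:R * be * de * u * X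
    - 3%:R * de ^+ 2 * X ^+ 2 = 0.
  apply: (mulfI u0).
  by apply: (eq_lincomb2 (k := 2%:R * ga) (l := - (be * u + de * X)) g1 g2'); ring.
have g4 : sing_den * X = sing_num * u.
  apply: (mulfI u0); apply: (eq_lincomb2 (k := 2%:R * ga) (l := 3%:R * de ^+ 2) g3 g2').
  by rewrite /sing_den /sing_num; ring.
case/eqP: res0; apply: (mulfI (expf_neq0 2 u0)).
apply: (eq_lincomb2 (k := sing_den ^+ 2)
  (l := - (2%:R * ga * (sing_den * X + sing_num * u) + 3%:R * de * sing_den * u)) g2' g4).
by rewrite /sing_res; ring.
Qed.

(** The difference of two partial derivatives is divisible by the difference of
    the two variables, and the quotient is linear in the third variable.  So for
    distinct coordinates e1 = 0, then e2 = 0 and e3 = 0. *)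
Lemma no_sing x y z :
  quartic_dx t x y z = 0 -> quartic_dx t y x z = 0 -> quartic_dx t z x y = 0 ->
  [/\ x = 0, y = 0 & z = 0].
Proof.
move=> hx hy hz.
have [xy|xy] := eqVneq x y.
  by rewrite -xy in hx hz *; have [-> ->] := no_sing_two_equal hx hz.
have [xz|xz] := eqVneq x z.
  rewrite -xz (quartic_dxC x y x) in hx hy hz *.
  by have [-> ->] := no_sing_two_equal hx hy.
have [yz|yz] := eqVneq y z.
  rewrite -yz (quartic_dxC y x y) in hx hy hz *.
  by have [-> ->] := no_sing_two_equal hy hx.
pose e1 := x + y + z; pose e2 := x * y + y * z + z * x.
pose B := coef_e112 t * e1 ^+ 2 + 2%:R * coef_e22 t * e2.
have aux a b c : b - a != 0 -> quartic_dx t a b c = 0 -> quartic_dx t b a c = 0 ->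
   a + b + c = e1 -> a * b + b * c + c * a = e2 -> B + de * e1 * c = 0.
  move=> ab ha hb e1E e2E; apply: (mulfI ab).
  apply: (eq_lincomb2 (k := 1) (l := -1) ha hb); rewrite /B -e1E -e2E.
  rewrite /delta /coef_e13 /coef_e22 /coef_e112 /quartic_dx; ring.
have hz' : B + de * e1 * z = 0.
  by apply: (aux x y z) => //; rewrite subr_eq0 eq_sym.
have hy' : B + de * e1 * y = 0.
  apply: (aux x z y); rewrite // ?subr_eq0 1?eq_sym // 1?quartic_dxC //.
  - by rewrite /e1; ring.
  by rewrite /e2; ring.
have e10 : e1 = 0.
  have yz' : y - z != 0 by rewrite subr_eq0.
  apply: (mulIf yz'); apply: (mulfI de0).
  by apply: (eq_lincomb2 (k := 1) (l := -1) hy' hz'); ring.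
have e20 : e2 = 0.
  by apply: (mulfI ga0); apply: (mulfI n2); rewrite !mulr0;
     apply: (eq_lincomb (k := 3%:R) hz'); rewrite /B e10 /gamma; ring.
have e30 : x * y * z = 0.
  apply: (mulfI de0); apply: (eq_lincomb3 (k := 1) (l := - (4%:R * coef_e1111 t * e1 ^+ 2
     + 2%:R * coef_e112 t * e2 + coef_e112 t * e1 * (e1 - x) + de * y * z))
     (m := - (2%:R * coef_e22 t * (e1 - x))) hx e10 e20).
  rewrite /e1 /e2 /delta /coef_e13 /coef_e22 /coef_e112 /coef_e1111 /quartic_dx; ring.
have root0 a : (a - x) * (a - y) * (a - z) = 0 -> a = 0.
  move=> a3; have /eqP : a ^+ 3 = 0.
    rewrite -[RHS]a3; apply: (eq_lincomb3 (k := a ^+ 2) (l := - a) (m := 1) e10 e20 e30).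
    by rewrite /e1 /e2; ring.
  by rewrite expf_eq0 => /eqP.
by split; apply: root0; rewrite subrr ?mul0r ?mulr0 ?mul0r.
Qed.

Lemma quartic_poly_smooth : smooth_plane_quartic (quartic_poly t).
Proof.
split; first exact: quartic_homog.
move=> P P0 _; have [d0 d1 d2] := quartic_deriv t (P 0).
have [dx|dx] := eqVneq (quartic_dx t (P 0 0) (P 0 1) (P 0 2)) 0; last first.
  by exists 0; rewrite d0.
have [dy|dy] := eqVneq (quartic_dx t (P 0 1) (P 0 0) (P 0 2)) 0; last first.
  by exists 1; rewrite d1.
have [dz|dz] := eqVneq (quartic_dx t (P 0 2) (P 0 0) (P 0 1)) 0; last first.
  by exists 2; rewrite d2.
have [x0 y0 z0] := no_sing dx dy dz; case/eqP: P0.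
by apply: row3_ext; rewrite mxE.
Qed.
End Smoothness.

(** * The valuation ring of the Puiseux series *)
Section Valuation.
Variable F : fieldType.
Local Notation K := (puiseux F).
Implicit Types (x y : K) (q r : rat).

(** The valuation of x is at least r. *)
Definition vge r x := forall q, q < r -> x q = 0.

Lemma pcoefD x y q : (x + y) q = x q + y q. Proof. by []. Qed.
Lemma pcoefN x q : (- x) q = - x q. Proof. by []. Qed.
Lemma pcoef0 q : (0 : K) q = 0. Proof. by []. Qed.
Lemma pcoef1 q : (1 : K) q = (q == 0)%:R. Proof. by []. Qed.
Lemma pcoefM x y : (x * y : K) = pconv x y :> (rat -> F). Proof. by []. Qed.

Lemma puiseux_ext x y : (forall q, x q = y q) -> x = y.
Proof. by move=> xy; apply: val_inj; apply/funext. Qed.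

Lemma vge_le r q x : q <= r -> vge r x -> vge q x.
Proof. by move=> qr xr s sq; apply: xr; apply: lt_le_trans sq qr. Qed.

Lemma vgeD r x y : vge r x -> vge r y -> vge r (x + y).
Proof. by move=> xr yr q qr; rewrite pcoefD xr // yr // addr0. Qed.

Lemma vgeN r x : vge r x -> vge r (- x).
Proof. by move=> xr q qr; rewrite pcoefN xr // oppr0. Qed.

Lemma vgeB r x y : vge r x -> vge r y -> vge r (x - y).
Proof. by move=> xr yr; apply: vgeD => //; apply: vgeN. Qed.

Lemma vgeM r q x y : vge r x -> vge q y -> vge (r + q) (x * y).
Proof.
move=> xr yq s srq; rewrite pcoefM; apply: fsbig1 => a _.
have [/xr->|ra] := ltP a r; first by rewrite mul0r.
by rewrite yq ?mulr0 // ltrBlDl; apply: lt_le_trans srq _; rewrite lerD2r.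
Qed.

(** Only one pair of exponents contributes to the lowest coefficient of a
    product. *)
Lemma vge_coefM r q x y : vge r x -> vge q y -> (x * y) (r + q) = x r * y q.
Proof.
move=> xr yq; rewrite pcoefM /pconv -(fsbig_widen [set r]) //; last first.
  move=> a [_ /= /eqP ar].
  have [/xr->|ra] := ltP a r; first by rewrite mul0r.
  rewrite yq ?mulr0 // ltrBlDl ltrD2r lt_neqAle ra andbT eq_sym.
  exact/eqP/eqP.
by rewrite fsbig_set1 [r + q]addrC addrK.
Qed.

Lemma vge_1 : vge 0 (1 : K).
Proof. by move=> q q0; rewrite pcoef1 lt_eqF. Qed.


Lemma lead_expE x q : lead_exp x q <-> x q != 0 /\ vge q x.
Proof.
split=> -[xq0 xq]; split=> // r.
  by move=> rq; apply: contraTeq rq => /xq; rewrite leNgt.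
by apply: contra_neqT; rewrite -ltNge => /xq.
Qed.

Lemma lead_expM x y q r :
  lead_exp x q -> lead_exp y r -> lead_exp (x * y) (q + r).
Proof.
move=> /lead_expE[xq0 xq] /lead_expE[yr0 yr]; apply/lead_expE; split.
  by rewrite vge_coefM // mulf_neq0.
exact: vgeM.
Qed.

Lemma lead_exp_inj x q r : lead_exp x q -> lead_exp x r -> q = r.
Proof. by move=> [n1 l1] [n2 l2]; apply/le_anti; rewrite l1 // l2. Qed.

Lemma lead_exp_neq0 x q : lead_exp x q -> x != 0.
Proof. by move=> [+ _]; apply: contraNneq => ->; rewrite pcoef0. Qed.

Lemma lead_exp_ex x : x != 0 -> exists q, lead_exp x q.
Proof.
move=> x0; have := @pvalP F x; rewrite /pval (negPf x0).
by move=> H; eexists; apply/H.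
Qed.

Lemma lead_exp_monom q : lead_exp (pmonom F q) q.
Proof.
apply/lead_expE; split; first by rewrite /= /pdelta eqxx oner_eq0.
by move=> r rq /=; rewrite /pdelta lt_eqF.
Qed.

Lemma lead_expV x q : lead_exp x q -> lead_exp x^-1 (- q).
Proof.
move=> xq; have x0 := lead_exp_neq0 xq.
have [r xr] : exists r, lead_exp x^-1 r by apply: lead_exp_ex; rewrite invr_eq0.
have := lead_expM xq xr; rewrite divff // => /lead_exp_inj/(_ (lead_exp_monom 0)).
by move/eqP; rewrite addrC addr_eq0 => /eqP <-.
Qed.

(** The valuation ring, its maximal ideal [vmax] and its group of units
    [vunit]; the residue of x is its coefficient at 0. *)
Definition vring : {pred K} := fun x => `[< vge 0 x >].
Lemma vringP x : reflect (vge 0 x) (x \in vring).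
Proof. exact: asboolP. Qed.

Lemma vring_subring : subring_closed vring.
Proof.
split; first by apply/vringP/vge_1.
  by move=> x y /vringP xO /vringP yO; apply/vringP/vgeB.
move=> x y /vringP xO /vringP yO; apply/vringP.
by rewrite -[0]addr0; apply: vgeM.
Qed.
HB.instance Definition _ := GRing.isSubringClosed.Build K vring vring_subring.

Lemma res_M x y : x \in vring -> y \in vring -> (x * y) 0 = x 0 * y 0.
Proof. by move=> /vringP xO /vringP yO; rewrite -{1}[0]addr0 vge_coefM. Qed.

Lemma res_nat n : (n%:R : K) 0 = n%:R.
Proof. by elim: n => [//|n IH]; rewrite !mulrS pcoefD IH. Qed.

Definition vmax : {pred K} := fun x => (x \in vring) && (x 0 == 0).
Definition vunit : {pred K} := fun x => (x \in vring) && (x 0 != 0).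

Lemma vmax_zmod : zmod_closed vmax.
Proof.
split=> [|x y /andP[xO /eqP x0] /andP[yO /eqP y0]].
  by rewrite unfold_in rpred0 pcoef0 eqxx.
have e : (x - y) 0 = x 0 - y 0 by [].
by apply/andP; split; [exact: rpredB|rewrite e x0 y0 subrr].
Qed.
HB.instance Definition _ := GRing.isZmodClosed.Build K vmax vmax_zmod.

Lemma vmax_ring x : x \in vmax -> x \in vring.
Proof. by case/andP. Qed.
Lemma vunit_ring x : x \in vunit -> x \in vring.
Proof. by case/andP. Qed.

Lemma vmaxMl x y : x \in vmax -> y \in vring -> x * y \in vmax.
Proof.
move=> /andP[xO /eqP x0] yO; apply/andP; split; first exact: rpredM.
by rewrite res_M // x0 mul0r.
Qed.

Lemma vmaxMr x y : x \in vring -> y \in vmax -> x * y \in vmax.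
Proof. by move=> xO ym; rewrite mulrC vmaxMl. Qed.

Lemma vunitM x y : x \in vunit -> y \in vunit -> x * y \in vunit.
Proof.
move=> /andP[xO x0] /andP[yO y0].
by apply/andP; split; [exact: rpredM|rewrite res_M // mulf_neq0].
Qed.

Lemma vunitD x y : x \in vunit -> y \in vmax -> x + y \in vunit.
Proof.
move=> /andP[xO x0] /andP[yO /eqP y0].
by apply/andP; split; [exact: rpredD|rewrite pcoefD y0 addr0].
Qed.

Lemma vunit_lead x : x \in vunit <-> lead_exp x 0.
Proof.
rewrite lead_expE; split=> [/andP[/vringP]//|[x0 /vringP xO]].
by rewrite unfold_in xO.
Qed.

Lemma vunit_neq0 x : x \in vunit -> x != 0.
Proof. by move=> /vunit_lead/lead_exp_neq0. Qed.

Lemma vunitV x : x \in vunit -> x^-1 \in vunit.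
Proof. by move=> /vunit_lead/lead_expV; rewrite oppr0 => /vunit_lead. Qed.

Lemma lead_expMu x y q : lead_exp x q -> y \in vunit -> lead_exp (x * y) q.
Proof. by move=> xq /vunit_lead yu; rewrite -[q]addr0; apply: lead_expM. Qed.

Lemma pmonomD q r : pmonom F q * pmonom F r = pmonom F (q + r).
Proof.
apply: puiseux_ext => s.
rewrite (_ : (_ * _ : K) s = pconv (pdelta F q) (pdelta F r) s) // /pconv.
rewrite -(fsbig_widen [set q]%classic) //; last first.
  by move=> a [_ /= /eqP/negPf aq]; rewrite /pdelta aq mul0r.
rewrite fsbig_set1 /= /pdelta eqxx mul1r; congr (_%:R); congr nat_of_bool.
by apply/eqP/eqP => [/eqP|->]; [rewrite subr_eq addrC => /eqP|rewrite addrC addKr].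
Qed.

Lemma pmonom_vmax q : 0 < q -> pmonom F q \in vmax.
Proof.
move=> q0; have /lead_expE[_ vq] := lead_exp_monom q.
rewrite unfold_in; apply/andP; split; last by rewrite vq.
by apply/vringP/(vge_le (ltW q0)).
Qed.

(** With exponents in (1/n) Z, a positive valuation is at least 1/n. *)
Lemma vge_pos_supp n x : (0 < n)%N -> psupp n 0 x -> x \in vmax ->
  vge (1 / n%:R) x.
Proof.
move=> n0 xs /andP[_ /eqP x0] q; apply: contraTeq => /[dup] xq0 /xs[[|k] qk].
  by move: xq0; rewrite qk /pexp addr0 mul0r x0 eqxx.
rewrite qk /pexp add0r -leNgt ler_pM2r ?invr_gt0 ?ltr0n //.
by rewrite (ler_nat _ 1).
Qed.

Lemma vring_supp n m x : (0 < n)%N -> psupp n m x -> x \in vring -> psupp n 0 x.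
Proof.
move=> n0 xs /vringP xO q /[dup] xq0 /xs[k qk].
have : 0 <= q by rewrite leNgt; apply: contraNN xq0 => /xO ->.
rewrite qk /pexp pmulr_lge0 ?invr_gt0 ?ltr0n // => mk0.
exists `|(m + k%:Z)%R|%N; congr (_ / _); rewrite add0r.
rewrite -[`|_|%N%:R]/((`|(m + k%:Z)%R|%N%:Z)%:~R) gez0_abs -?(ler_int rat) ?intrD //.
Qed.

End Valuation.

Arguments vring {F} : simpl never.
Arguments vmax {F} : simpl never.
Arguments vunit {F} : simpl never.

(** * Hensel's lemma for cubic equations *)
Section Hensel.
Variable F : fieldType.
Local Notation K := (puiseux F).

(** The map y |-> a0 + a2 y^2 + a3 y^3 is a contraction of the maximal ideal: as
    all the coefficients have their exponents in (1/n) N, each iteration brings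
    two points closer by 1/n at least.  The coefficients of the iterates at a
    given exponent are therefore eventually constant, and their limits are the
    coefficients of a fixed point. *)
Section FixedPoint.
Variables (n : nat) (a0 a2 a3 : K).
Hypotheses (n0 : (0 < n)%N) (a0m : a0 \in vmax) (a2O : a2 \in vring)
  (a3O : a3 \in vring).
Hypotheses (s0 : psupp n 0 a0) (s2 : psupp n 0 a2) (s3 : psupp n 0 a3).

Let psuppDn (x y : K) : psupp n 0 x -> psupp n 0 y -> psupp n 0 (x + y).
Proof. exact: psuppD. Qed.

Let psuppBn (x y : K) : psupp n 0 x -> psupp n 0 y -> psupp n 0 (x - y).
Proof.
move=> xs ys; apply: psuppD => // q yq; apply: ys; apply: contra_neq yq => y0.
by rewrite [LHS](_ : _ = - y q) // y0 oppr0.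
Qed.

Let psuppMn (x y : K) : psupp n 0 x -> psupp n 0 y -> psupp n 0 (x * y).
Proof. by move=> xs ys; rewrite -[0]addr0; apply: psupp_conv. Qed.

Let phi (y : K) := a0 + (a2 * (y * y) + a3 * (y * (y * y))).
Let good (y : K) := y \in vmax /\ psupp n 0 y.

Let good_phi y : good y -> good (phi y).
Proof.
move=> [ym ys]; split; last first.
  by apply: psuppDn => //; apply: psuppDn; apply: psuppMn => //;
     repeat apply: psuppMn => //.
have yO := vmax_ring ym.
by apply: rpredD => //; apply: rpredD; apply: vmaxMr => //; apply: vmaxMl => //;
   apply: rpredM.
Qed.

Let vge_phi k y z : good y -> good z -> vge (k%:R / n%:R) (y - z) ->
  vge (k.+1%:R / n%:R) (phi y - phi z).
Proof.
move=> [ym ys] [zm zs] yz.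
have -> : phi y - phi z =
  (y - z) * (a2 * (y + z) + a3 * (y * y + (y * z + z * z))).
  by rewrite /phi; ring.
rewrite -natr1 mulrDl; apply: vgeM => //; apply: vge_pos_supp => //.
  by apply: psuppDn; apply: psuppMn => //; apply: psuppDn => //;
     [|apply: psuppDn]; apply: psuppMn.
have yO := vmax_ring ym; have zO := vmax_ring zm.
apply: rpredD; apply: vmaxMr => //; apply: rpredD => //; first exact: vmaxMl.
by apply: rpredD; apply: vmaxMl.
Qed.

Let it k := iter k phi 0.
Let good_it k : good (it k).
Proof.
elim: k => [|k IH]; last exact: good_phi.
by split; [apply: rpred0|move=> q; rewrite eqxx].
Qed.

Let vge_itS k : vge (k%:R / n%:R) (it k.+1 - it k).
Proof.
elim: k => [|k IH]; last exact: (vge_phi (good_it k.+1) (good_it k)).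
rewrite mul0r; apply/vringP/rpredB; apply/vmax_ring; [|exact: (good_it 0).1].
exact: (good_it 1).1.
Qed.

Let vge_it k j : vge (k%:R / n%:R) (it (k + j) - it k).
Proof.
elim: j => [|j IH]; first by rewrite addn0 subrr.
rewrite addnS -(subrKA (it (k + j))); apply: vgeD => //.
apply: vge_le (@vge_itS (k + j)); rewrite ler_pM2r ?invr_gt0 ?ltr0n //.
by rewrite ler_nat leq_addr.
Qed.

(** The exponent k/n stabilizes after k + 1 iterations. *)
Let idx (q : rat) : nat := `|numq (q * n%:R)|%N.
Let idxE k : idx (pexp n 0 k) = k.
Proof.
rewrite /idx /pexp mulfVK ?pnatr_eq0 -?lt0n // add0r.
by rewrite -[k%:R]/((k%:Z)%:~R) numq_int.
Qed.

Let lim_fun (q : rat) : F := it (idx q).+1 q.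
Let lim_supp : psupp n 0 lim_fun.
Proof. by move=> q; apply: (good_it _).2. Qed.
Let lim_puiseux : lim_fun \in @is_puiseux F.
Proof. by apply/is_puiseuxP; exists n, 0; split. Qed.
Let lim : K := Puiseux lim_puiseux.

Let vge_lim k : vge (k%:R / n%:R) (lim - it k).
Proof.
move=> q qk; apply: contraTeq qk => /[dup] qn0.
have ls : psupp n 0 (lim - it k) by apply: psuppBn => //; apply: (good_it k).2.
move=> /ls[j qj]; rewrite qj /pexp add0r -leNgt ler_pM2r ?invr_gt0 ?ltr0n //.
rewrite ler_nat leqNgt; apply: contraNN qn0 => jk.
have -> : (lim - it k) q = (it j.+1 - it k) q.
  rewrite (_ : (lim - it k) q = lim_fun q - it k q) // /lim_fun qj idxE.
  by [].
have -> : (it j.+1 - it k) q = - (it (j.+1 + (k - j.+1)) - it j.+1) q.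
  rewrite subnKC // (_ : (it j.+1 - it k) q = it j.+1 q - it k q) //.
  by rewrite (_ : (it k - it j.+1) q = it k q - it j.+1 q) // opprB.
rewrite vge_it ?oppr0 // qj /pexp add0r ltr_pM2r ?invr_gt0 ?ltr0n //.
by rewrite ltr_nat.
Qed.

Let good_lim : good lim.
Proof.
split=> //.
have : vge (0%:R / n%:R) (lim - it 0) by apply: vge_lim.
have : (lim - it 1) 0 = 0.
  by rewrite vge_lim // divr_gt0 ?ltr0n.
rewrite mul0r (_ : it 0 = 0) // subr0 => l1 l0.
apply/andP; split; first exact/vringP.
have := (good_it 1).1 => /andP[_ /eqP i1].
by move: l1; rewrite (_ : (lim - it 1) 0 = lim 0 - it 1 0) // i1 subr0 => ->.
Qed.

Lemma contraction_fixpoint :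
  exists2 y, y \in vmax & y = a0 + (a2 * (y * y) + a3 * (y * (y * y))).
Proof.
exists lim; first exact: good_lim.1.
apply/eqP; rewrite -subr_eq0; apply/eqP; apply: puiseux_ext => q.
pose k := Num.bound `|q * n%:R|.
have qk : q < k%:R / n%:R.
  rewrite ltr_pdivlMr ?ltr0n //; apply: le_lt_trans (ler_norm _) _.
  exact: archi_boundP.
have -> : lim - phi lim = (lim - it k.+1) + - (phi lim - phi (it k)).
  by rewrite opprB addrA subrK.
have kk : k%:R / n%:R <= k.+1%:R / n%:R :> rat.
  by rewrite ler_pM2r ?invr_gt0 ?ltr0n // ler_nat.
apply: (_ : vge (k%:R / n%:R) _) => //; apply: vgeB.
  exact: vge_le (@vge_lim k.+1).
apply: vge_le kk _; apply: vge_phi => //; exact: vge_lim.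
Qed.
End FixedPoint.

Lemma hensel_cubic0 (k0 k1 k2 k3 : K) :
  k0 \in vmax -> k1 \in vunit -> k2 \in vring -> k3 \in vring ->
  exists2 y, y \in vmax & k0 + k1 * y + k2 * y ^+ 2 + k3 * y ^+ 3 = 0.
Proof.
move=> k0m k1u k2O k3O; have k1O := vunit_ring (vunitV k1u).
have k1n := vunit_neq0 k1u.
pose a0 := - k0 / k1; pose a2 := - k2 / k1; pose a3 := - k3 / k1.
have a0m : a0 \in vmax by apply: vmaxMl => //; rewrite rpredN.
have a2O : a2 \in vring by apply: rpredM => //; rewrite rpredN.
have a3O : a3 \in vring by apply: rpredM => //; rewrite rpredN.
have [n [m [n0 s0 s2 s3]]] := is_puiseux3 (pcoefP a0) (pcoefP a2) (pcoefP a3).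
have [] := @contraction_fixpoint n a0 a2 a3 n0 a0m a2O a3O.
- exact: vring_supp n0 s0 (vmax_ring a0m).
- exact: vring_supp n0 s2 a2O.
- exact: vring_supp n0 s3 a3O.
move=> y ym ye; exists y => //.
have {}ye : y - (a0 + (a2 * (y * y) + a3 * (y * (y * y)))) = 0 by rewrite -ye subrr.
have -> : k0 + k1 * y + k2 * y ^+ 2 + k3 * y ^+ 3 =
  k1 * (y - (a0 + (a2 * (y * y) + a3 * (y * (y * y))))).
  by rewrite /a0 /a2 /a3; field.
by rewrite ye mulr0.
Qed.

(** The case of an approximate root a reduces to that of 0 by translation. *)
Lemma hensel_cubic (a k0 k1 k2 k3 : K) :
  a \in vring -> k2 \in vring -> k3 \in vring ->
  k0 + k1 * a + k2 * a ^+ 2 + k3 * a ^+ 3 \in vmax ->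
  k1 + k2 * a *+ 2 + k3 * a ^+ 2 *+ 3 \in vunit ->
  exists2 y, y \in vmax &
   k0 + k1 * (a + y) + k2 * (a + y) ^+ 2 + k3 * (a + y) ^+ 3 = 0.
Proof.
move=> aO k2O k3O p0 p1.
have k2aO : k2 + k3 * a *+ 3 \in vring by rewrite rpredD // rpredMn // rpredM.
have [y ym ye] := hensel_cubic0 p0 p1 k2aO k3O.
exists y => //; rewrite -[RHS]ye; ring.
Qed.

End Hensel.

(** * Square roots of Puiseux series *)
Section SquareRoots.
Variable F : numClosedFieldType.
Local Notation K := (puiseux F).
Implicit Types (x y : K) (q r : rat).

Lemma natr_vunit n : (0 < n)%N -> (n%:R : K) \in vunit.
Proof.
move=> n0; apply/andP; split; first exact: rpred_nat.
by rewrite res_nat pnatr_eq0 -lt0n.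
Qed.

Lemma natr_neq0 n : (0 < n)%N -> (n%:R : K) != 0.
Proof. by move=> /natr_vunit/vunit_neq0. Qed.

Fact pconst_subproof (c : F) : (fun q => c * pdelta F 0 q) \in @is_puiseux F.
Proof.
apply/is_puiseuxP; exists 1%N, 0; split=> // q; rewrite /pdelta.
have [-> _|_] := eqVneq q 0; last by rewrite mulr0 eqxx.
by exists 0%N; rewrite /pexp addr0 mul0r.
Qed.

Definition pconst (c : F) : K := Puiseux (pconst_subproof c).

Lemma pconst_res c : pconst c 0 = c.
Proof. by rewrite /= /pdelta eqxx mulr1. Qed.

Lemma pconst_vring c : pconst c \in vring.
Proof. by apply/vringP => q q0; rewrite /= /pdelta lt_eqF // mulr0. Qed.

Lemma lead_exp_unit x q : lead_exp x q ->
  exists2 u, u \in vunit & x = pmonom F q * u.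
Proof.
move=> xq; exists (pmonom F (- q) * x).
  by apply/vunit_lead; rewrite -(addNr q); apply: lead_expM => //; apply: lead_exp_monom.
by rewrite mulrA pmonomD subrr mul1r.
Qed.

(** A square root of the residue is a simple approximate root of Y^2 - x. *)
Lemma vunit_sqrt x : x \in vunit -> exists y, y ^+ 2 = x.
Proof.
move=> /[dup] xu /andP[xO x0]; pose a := pconst (sqrtC (x 0)).
have aO : a \in vring by apply: pconst_vring.
have au : a \in vunit by apply/andP; split=> //; rewrite pconst_res sqrtC_eq0.
have [||||y ym ye] := @hensel_cubic F a (- x) 0 1 0 aO.
- exact: rpred1.
- exact: rpred0.
- rewrite !mul0r mul1r !addr0; apply/andP; split.
    by rewrite rpredD ?rpredN ?rpredX.
  by rewrite pcoefD pcoefN expr2 res_M // pconst_res -expr2 sqrtCK addNr.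
- by rewrite mul0r mul0rn addr0 add0r mul1r -mulr_natl; apply: vunitM => //; apply: natr_vunit.
exists (a + y); apply/eqP; rewrite -subr_eq0 -ye; apply/eqP; ring.
Qed.

Lemma puiseux_sqrt x : exists y, y ^+ 2 = x.
Proof.
have [->|/lead_exp_ex[q /lead_exp_unit[u /vunit_sqrt[v vu] ->]]] := eqVneq x 0.
  by exists 0; rewrite expr0n.
exists (pmonom F (q / 2) * v); rewrite exprMn vu expr2 pmonomD.
by rewrite -splitr.
Qed.

Lemma vring_sqr x : x ^+ 2 \in vring -> x \in vring.
Proof.
have [->|/lead_exp_ex[q xq]] := eqVneq x 0; first by rewrite rpred0.
move=> /vringP x2; have [x2q _] := lead_expM xq xq.
have q0 : 0 <= q.
  rewrite leNgt; apply: contraNN x2q => q0.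
  by rewrite -expr2 x2 //; lra.
by case/lead_expE: xq => _ xq; apply/vringP; apply: vge_le xq.
Qed.

Lemma vunit_prod x y : x \in vring -> y \in vring -> x * y \in vunit -> x \in vunit.
Proof.
move=> xO yO /andP[_]; rewrite res_M // mulf_eq0 negb_or => /andP[x0 _].
exact/andP.
Qed.

(** The roots of Y^2 - s Y + p are integral over the valuation ring, hence in
    it, and they are units because their product is one. *)
Lemma vunit_quadratic s p : s \in (vring : {pred K}) -> p \in vunit ->
  exists x y, [/\ x \in (vunit : {pred K}), y \in vunit, x + y = s & x * y = p].
Proof.
move=> sO pu; have pO := vunit_ring pu.
have [d de] := puiseux_sqrt (s ^+ 2 - p *+ 4).
have dO : d \in vring by apply: vring_sqr; rewrite de rpredB ?rpredX ?rpredMn.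
have h2 : (2%:R : K)^-1 \in vring by apply/vunit_ring/vunitV/natr_vunit.
have n2 : (2%:R : K) != 0 by apply: natr_neq0.
exists ((s + d) / 2%:R), ((s - d) / 2%:R).
have xO : (s + d) / 2%:R \in vring by rewrite rpredM ?rpredD.
have yO : (s - d) / 2%:R \in vring by rewrite rpredM ?rpredB.
have xy : (s + d) / 2%:R * ((s - d) / 2%:R) = p.
  transitivity ((s ^+ 2 - d ^+ 2) / 4%:R).
    by field; rewrite n2 natr_neq0.
  by rewrite de; field; rewrite natr_neq0.
split=> //; last by field.
- by apply: vunit_prod xO yO _; rewrite xy.
by apply: vunit_prod yO xO _; rewrite mulrC xy.
Qed.

End SquareRoots.

(** * Expansions of the two cubics near their roots *)
Section Expansions.
Variable K : fieldType.
Hypothesis n2 : 2%:R != 0 :> K.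
Variable t : K.
Implicit Types (a s m : K) (c : seq K).

Let n4 : 4%:R != 0 :> K. Proof. by rewrite (natrM _ 2 2) mulf_neq0. Qed.

(** The polynomial with coefficients c at s, in a form that unfolds to an
    expression without evaluating the large numerals in c. *)
Definition horner_seq c s : K := foldr (fun x y => x + s * y) 0 c.

(** A polynomial in s and a, of degree at most 3 in a; its value at s = 0 is
    [horner2_const], and the tails of the lists exhibit the rest as s times an
    integral expression. *)
Definition horner2 c0 c1 c2 c3 s a : K :=
  horner_seq c0 s + horner_seq c1 s * a + horner_seq c2 s * a ^+ 2
  + horner_seq c3 s * a ^+ 3.

Definition horner2_const c0 c1 c2 c3 a : K :=
  head 0 c0 + head 0 c1 * a + head 0 c2 * a ^+ 2
  + head 0 c3 * a ^+ 3.

Lemma horner_seq_lead c s : horner_seq c s = head 0 c + s * horner_seq (behead c) s.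
Proof. by case: c => [|x c] //=; rewrite mulr0 addr0. Qed.

Lemma horner2_lead c0 c1 c2 c3 s a :
  horner2 c0 c1 c2 c3 s a = horner2_const c0 c1 c2 c3 a
  + s * horner2 (behead c0) (behead c1) (behead c2) (behead c3) s a.
Proof.
rewrite /horner2 /horner2_const (horner_seq_lead c0) (horner_seq_lead c1).
by rewrite (horner_seq_lead c2) (horner_seq_lead c3); ring.
Qed.

(** Approximations of the three roots of [line_cubic], found by Newton's method.
    They are long enough for a to be determined, as a simple root, by the
    leading part of the equation. *)
Definition root1 a := 1 - 6%:R * t ^+ 2 + 12%:R * t ^+ 3 + t ^+ 4 * a.
Definition root2 a :=
  (1 - 3%:R * t + 9%:R * t ^+ 2 - 33%:R * t ^+ 3 + t ^+ 4 * a) / 4%:R.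
Definition root3 a := (1 - 3%:R * t + t ^+ 2 * a) / 4%:R.

(** The nontrivial factor of the discriminant of a triple, see
    [general_triple_disc]. *)
Definition line_disc m := gamma t - beta t * m - 3%:R * alpha t * m ^+ 2.

(** Here s stands for the square root of t: the leading part -324 - 9 a^2 gives
    the two roots near -1, a = 6i and a = -6i. *)
Lemma diag_cubic_expansion s a :
  diag_cubic (alpha (s ^+ 2)) (beta (s ^+ 2)) (gamma (s ^+ 2)) (delta (s ^+ 2))
    (- 1 + 3%:R * s ^+ 4 + s ^+ 5 * a) = s ^+ 10 * horner2
     [:: - 324%:R; 0; 1296%:R; 0; - 324%:R; 0; - 4212%:R; 0; 3888%:R; 0;
     3888%:R; 0; - 6480%:R; 0; 2268%:R; 0; 3240%:R; 0; - 5832%:R; 0; 0; 0;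
     3240%:R] [:: 0; - 108%:R; 0; 540%:R; 0; - 108%:R; 0; - 2484%:R; 0;
     2160%:R; 0; 3780%:R; 0; - 5184%:R; 0; 108%:R; 0; 3240%:R; 0; - 3888%:R;
     0; 0; 0; 3240%:R] [:: - 9%:R; 0; 0; 0; 99%:R; 0; - 36%:R; 0; - 432%:R; 0;
     288%:R; 0; 1008%:R; 0; - 1296%:R; 0; - 324%:R; 0; 1080%:R; 0; - 648%:R;
     0; 0; 0; 1080%:R] [:: 0; 0; 0; 0; 0; 9%:R; 0; - 12%:R; 0; - 24%:R; 0; 0;
     0; 84%:R; 0; - 96%:R; 0; - 36%:R; 0; 120%:R; 0; 0; 0; 0; 0; 120%:R]
    s a.
Proof.
by cbv [horner2 horner_seq foldr];
  rewrite /diag_cubic; unfold_coefs; ring.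
Qed.

Lemma line_cubic_root1 a :
  line_cubic t (root1 a) = t ^+ 4 * horner2
     [:: 243%:R; 0; - 972%:R; 3456%:R; - 6696%:R; 31968%:R; - 49032%:R;
     60480%:R; - 57456%:R; 121824%:R; 60480%:R; - 131328%:R; 127872%:R;
     20736%:R; - 41472%:R; 27648%:R] [:: 9%:R; 36%:R; - 72%:R; 0; 1044%:R; -
     432%:R; 4284%:R; - 8136%:R; 15552%:R; 2880%:R; 28008%:R; 6912%:R; -
     15552%:R; 31104%:R; 1728%:R; - 6912%:R; 6912%:R] [:: 0; 0; 0; 0; 24%:R;
     72%:R; - 48%:R; 240%:R; 0; 1896%:R; 1344%:R; 2160%:R; 576%:R; 0; 2448%:R;
     0; - 288%:R; 576%:R] [:: 0; 0; 0; 0; 0; 0; 0; 0; 16%:R; 32%:R; 80%:R;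
     64%:R; 64%:R; 32%:R; 32%:R; 64%:R; 0; 0; 16%:R]
    t a.
Proof.
by cbv [horner2 horner_seq foldr];
  rewrite /line_cubic /root1; unfold_coefs; ring.
Qed.

Lemma line_cubic_root2 a :
  16%:R * line_cubic t (root2 a) = t ^+ 6 * horner2
     [:: 16848%:R; - 87696%:R; 123444%:R; - 143316%:R; 185976%:R; - 382320%:R;
     - 257688%:R; - 100008%:R; - 306288%:R; 112320%:R; - 433080%:R; -
     71280%:R; 117612%:R; - 143748%:R] [:: - 144%:R; 144%:R; 3672%:R; -
     6552%:R; 9144%:R; - 5976%:R; 43236%:R; 26856%:R; 23796%:R; 24624%:R; -
     324%:R; 44496%:R; 3348%:R; - 7128%:R; 13068%:R] [:: 0; 0; - 12%:R; -
     36%:R; 96%:R; - 264%:R; - 252%:R; - 1596%:R; - 1104%:R; - 1152%:R; -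
     720%:R; - 360%:R; - 1476%:R; - 36%:R; 108%:R; - 396%:R] [:: 0; 0; 0; 0;
     0; 0; 4%:R; 8%:R; 20%:R; 16%:R; 16%:R; 8%:R; 8%:R; 16%:R; 0; 0; 4%:R]
    t a.
Proof.
by cbv [horner2 horner_seq foldr];
  rewrite /line_cubic /root2; unfold_coefs; field.
Qed.

Lemma line_cubic_root3 a :
  16%:R * line_cubic t (root3 a) = t ^+ 4 * horner2
     [:: 324%:R; - 1836%:R; 1728%:R; 1080%:R; - 2160%:R; 2376%:R; - 108%:R; -
     2052%:R; 972%:R; - 108%:R] [:: 72%:R; 0; 540%:R; - 648%:R; - 72%:R;
     504%:R; - 1512%:R; 432%:R; 684%:R; - 648%:R; 108%:R] [:: - 12%:R; -
     36%:R; - 12%:R; - 84%:R; 0; - 48%:R; 48%:R; 216%:R; - 144%:R; 0; 108%:R;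
     - 36%:R] [:: 0; 0; 4%:R; 8%:R; 20%:R; 16%:R; 16%:R; 8%:R; 8%:R; 16%:R; 0;
     0; 4%:R]
    t a.
Proof.
by cbv [horner2 horner_seq foldr];
  rewrite /line_cubic /root3; unfold_coefs; field.
Qed.

Lemma line_e3_root1 a :
  line_e3 t (root1 a) = t ^+ 4 * horner2
     [:: 270%:R; - 540%:R; - 432%:R; 3240%:R; - 4752%:R; 15552%:R; - 34560%:R;
     32832%:R; 10368%:R; - 20736%:R; 13824%:R] [:: 9%:R; 18%:R; - 117%:R;
     144%:R; 720%:R; - 1116%:R; 1728%:R; - 4032%:R; 8064%:R; 864%:R; -
     3456%:R; 3456%:R] [:: 0; 0; 0; 0; 18%:R; 24%:R; - 84%:R; 144%:R; 0;
     624%:R; 0; - 144%:R; 288%:R] [:: 0; 0; 0; 0; 0; 0; 0; 0; 8%:R; 8%:R;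
     16%:R; 0; 0; 8%:R]
    t a.
Proof.
by cbv [horner2 horner_seq foldr];
  rewrite /line_e3 /root1; unfold_coefs; ring.
Qed.

Lemma line_e3_root2 a :
  16%:R * line_e3 t (root2 a) = t ^+ 4 * horner2
     [:: 2214%:R; - 7290%:R; 13284%:R; - 38232%:R; 74898%:R; - 75492%:R;
     24678%:R; - 98928%:R; - 35640%:R; 58806%:R; - 71874%:R] [:: - 18%:R; -
     18%:R; 162%:R; - 306%:R; 1494%:R; - 4212%:R; 6138%:R; 0; 10764%:R;
     1674%:R; - 3564%:R; 6534%:R] [:: 0; 0; 0; 0; 0; - 12%:R; 60%:R; - 180%:R;
     - 90%:R; - 366%:R; - 18%:R; 54%:R; - 198%:R] [:: 0; 0; 0; 0; 0; 0; 0; 0;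
     2%:R; 2%:R; 4%:R; 0; 0; 2%:R]
    t a.
Proof.
by cbv [horner2 horner_seq foldr];
  rewrite /line_e3 /root2; unfold_coefs; field.
Qed.

Lemma line_e3_root3 a :
  16%:R * line_e3 t (root3 a) = t ^+ 2 * horner2
     [:: 162%:R; - 432%:R; 162%:R; - 162%:R; 270%:R; 270%:R; - 54%:R] [:: -
     18%:R; - 18%:R; 162%:R; - 90%:R; 108%:R; - 90%:R; - 180%:R; 54%:R] [:: 0;
     0; 0; - 12%:R; 6%:R; - 36%:R; 0; 30%:R; - 18%:R] [:: 0; 0; 0; 0; 2%:R;
     2%:R; 4%:R; 0; 0; 2%:R]
    t a.
Proof.
by cbv [horner2 horner_seq foldr];
  rewrite /line_e3 /root3; unfold_coefs; field.
Qed.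

Lemma line_disc_root1 a :
  line_disc (root1 a) = t ^+ 4 * horner2
     [:: - 72%:R; 99%:R; - 216%:R; 540%:R; - 1080%:R; - 108%:R; 432%:R; -
     432%:R] [:: - 3%:R; - 6%:R; 18%:R; - 36%:R; 0; - 162%:R; 0; 36%:R; -
     72%:R] [:: 0; 0; 0; 0; - 3%:R; - 3%:R; - 6%:R; 0; 0; - 3%:R] [:: ]
    t a.
Proof.
by cbv [horner2 horner_seq foldr];
  rewrite /line_disc /root1; unfold_coefs; ring.
Qed.

Lemma line_disc_root2 a :
  16%:R * line_disc (root2 a) = 1 * horner2
     [:: 9%:R; 27%:R; - 81%:R; - 9%:R; - 855%:R; 2502%:R; - 2997%:R; - 216%:R;
     - 4590%:R; - 837%:R; 1782%:R; - 3267%:R] [:: 0; 0; 0; 0; 6%:R; 12%:R; -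
     72%:R; 180%:R; 90%:R; 342%:R; 18%:R; - 54%:R; 198%:R] [:: 0; 0; 0; 0; 0;
     0; 0; 0; - 3%:R; - 3%:R; - 6%:R; 0; 0; - 3%:R] [:: ]
    t a.
Proof.
by cbv [horner2 horner_seq foldr];
  rewrite /line_disc /root2; unfold_coefs; field.
Qed.

Lemma line_disc_root3 a :
  16%:R * line_disc (root3 a) = 1 * horner2
     [:: 9%:R; 27%:R; - 135%:R; 81%:R; - 54%:R; 45%:R; 162%:R; - 27%:R] [:: 0;
     0; 6%:R; 12%:R; - 18%:R; 36%:R; 0; - 54%:R; 18%:R] [:: 0; 0; 0; 0; -
     3%:R; - 3%:R; - 6%:R; 0; 0; - 3%:R] [:: ]
    t a.
Proof.
by cbv [horner2 horner_seq foldr];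
  rewrite /line_disc /root3; unfold_coefs; field.
Qed.

Lemma sing_res_expansion :
  sing_res t = t ^+ 6 * horner_seq
     [:: 52488%:R; - 157464%:R; - 1364688%:R; 7768224%:R; - 11074968%:R; -
     5511240%:R; 9132912%:R; 50388480%:R; - 69704064%:R; - 41727960%:R;
     56896992%:R; 107705376%:R; - 124081632%:R; - 19315584%:R; 31072896%:R;
     73063296%:R; - 114213888%:R; 22884768%:R; 45349632%:R; - 10077696%:R; -
     13436928%:R; 40310784%:R; 0; - 40310784%:R; - 26873856%:R; 40310784%:R; -
     26873856%:R; 0; 0; 26873856%:R] t.
Proof.
cbv [horner_seq foldr]; rewrite /sing_res /sing_num /sing_den.
by unfold_coefs; ring.
Qed.
End Expansions.

(** * Triples with prescribed symmetric functions *)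
Section GeneralTriples.
Variable K : fieldType.
Hypothesis char0 : forall n, (0 < n)%N -> n%:R != 0 :> K.
Variable t : K.
Implicit Types (a b c m T : K).

(** T is a root of the cubic with the prescribed coefficients, and b, c are the
    roots of its quotient by Y - T. *)
Lemma general_tripleI m T b c : delta t != 0 -> line_cubic t m = 0 ->
  delta t * (T * (T ^+ 2 - 3%:R * T + 3%:R * (1 - m))) = line_e3 t m ->
  b + c = 3%:R - T -> b * c = T ^+ 2 - 3%:R * T + 3%:R * (1 - m) ->
  general_triple t m (T, b, c).
Proof.
move=> de0 mE LT hs hp; split=> //.
- by apply: (eq_lincomb (k := 1) hs); ring.
- by apply: (eq_lincomb2 (k := T) (l := 1) hs hp); ring.
by rewrite -LT -hp mulrA.
Qed.

(** The left-hand side is delta^2 times the discriminant of the triple, which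
    equals -27 ((p^3 + q^3)^2 - 4 (pq)^3). *)
Lemma general_triple_disc m a b c : general_triple t m (a, b, c) ->
  delta t ^+ 2 * ((a - b) * (b - c) * (c - a)) ^+ 2
  = - 432%:R * (gamma t * m ^+ 2 * line_disc t m).
Proof.
move=> [mE e1 e2 e3].
pose N := 4%:R * gamma t * m - 2%:R * (4%:R * alpha t * m + beta t) * m ^+ 2.
transitivity (- 27%:R * (N ^+ 2 - 4%:R * m ^+ 3 * delta t ^+ 2)); last first.
  apply: (eq_lincomb (k := - 108%:R * m ^+ 3) mE).
  by rewrite /line_cubic /line_disc /N; ring.
have -> : ((a - b) * (b - c) * (c - a)) ^+ 2 =
  (a + b + c) ^+ 2 * (a * b + b * c + c * a) ^+ 2
  - 4%:R * (a * b + b * c + c * a) ^+ 3 - 4%:R * (a + b + c) ^+ 3 * (a * b * c)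
  + 18%:R * (a + b + c) * (a * b + b * c + c * a) * (a * b * c)
  - 27%:R * (a * b * c) ^+ 2 by ring.
rewrite e1 e2; move: (a * b * c) e3 => e3 e3E.
rewrite /line_e3 -/N in e3E.
have NE : N = delta t * (1 - 3%:R * m - e3) by rewrite mulrBr e3E; ring.
by rewrite NE; ring.
Qed.

Lemma general_triple_uniq m a b c : general_triple t m (a, b, c) ->
  gamma t != 0 -> m != 0 -> line_disc t m != 0 -> uniq [:: a; b; c].
Proof.
move=> /general_triple_disc; have [|D0] := eqVneq ((a - b) * (b - c) * (c - a)) 0.
  move=> -> + ga0 m0 d0; rewrite expr0n mulr0 => /esym/eqP.
  have n432 : - 432%:R != 0 :> K by rewrite oppr_eq0 char0.
  by rewrite (negPf (mulf_neq0 n432 (mulf_neq0 (mulf_neq0 ga0 (expf_neq0 2 m0)) d0))).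
move=> _ _ _ _; move: D0; rewrite !mulf_eq0 !negb_or !subr_eq0.
by move=> /andP[/andP[ab bc] ca]; rewrite /= !inE negb_or ab bc eq_sym ca.
Qed.

Lemma line_cubic_coef m : line_cubic t m = - delta t ^+ 2
  + (beta t ^+ 2 - 4%:R * alpha t * gamma t) * m
  + 8%:R * alpha t * beta t * m ^+ 2 + 16%:R * alpha t ^+ 2 * m ^+ 3.
Proof. by rewrite /line_cubic; ring. Qed.

Lemma diag_cubic_coef (al be ga de r : K) : diag_cubic al be ga de r = - 4%:R * ga * de
  + 9%:R * de ^+ 2 * r - 6%:R * be * de * r ^+ 2 + (be ^+ 2 - 4%:R * al * ga) * r ^+ 3.
Proof. by rewrite /diag_cubic; ring. Qed.
End GeneralTriples.

(** * Roots and valuations over the Puiseux series *)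
Section IntegralExpressions.
Variable F : fieldType.
Local Notation K := (puiseux F).
Implicit Types (x y : K) (c : seq K).

Lemma vringD x y : x \in vring -> y \in vring -> x + y \in vring.
Proof. exact: rpredD. Qed.

Lemma vringN x : x \in vring -> - x \in vring.
Proof. by rewrite rpredN. Qed.

Lemma vringM x y : x \in vring -> y \in vring -> x * y \in vring.
Proof. exact: rpredM. Qed.

Lemma vringX x n : x \in vring -> x ^+ n \in vring.
Proof. exact: rpredX. Qed.

Lemma vring_nat n : n%:R \in (vring : {pred K}).
Proof. exact: rpred_nat. Qed.

Definition integral_coefs c := all (fun x => x \in vring) c.

Lemma integral_coefs_cons x c : x \in vring -> integral_coefs c -> integral_coefs (x :: c).
Proof. by move=> xO cO; apply/andP. Qed.

Lemma integral_coefs_nat n c : integral_coefs c -> integral_coefs (n%:R :: c).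
Proof. by move=> cO; apply: integral_coefs_cons => //; apply: rpred_nat. Qed.

Lemma integral_coefs_natN n c : integral_coefs c -> integral_coefs (- n%:R :: c).
Proof. by move=> cO; apply: integral_coefs_cons => //; apply/vringN/vring_nat. Qed.

Lemma integral_coefs0 c : integral_coefs c -> integral_coefs (0 :: c).
Proof. exact: (integral_coefs_nat 0). Qed.
End IntegralExpressions.

(** Membership in the valuation ring by recursion on the syntax of the
    expression, so that the arithmetic of Puiseux series is never unfolded. *)
Ltac vring_tac := unfold_coefs; repeat match goal with
  | |- is_true (?x \in _) => first [ assumption | match x with
    | _ + _ => apply vringD
    | - _ => apply vringN
    | _ * _ => apply vringM
    | _ ^+ _ => apply vringX
    | _ => exact (vring_nat _ _)
    | _ => exact (vring_nat _ 1)
    end ]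
  end.

Ltac integral_coefs_tac := repeat match goal with
  | |- is_true (integral_coefs (0 :: _)) => apply integral_coefs0
  | |- is_true (integral_coefs (- _ :: _)) => apply integral_coefs_natN
  | |- is_true (integral_coefs (_ :: _)) => apply integral_coefs_nat
  end; exact: isT.

Section PuiseuxBitangents.
Variable F : numClosedFieldType.
Local Notation K := (puiseux F).
Implicit Types (x y a s : K) (c : seq K).
Local Notation t := (pmonom F 1).
Local Notation sqrt_t := (pmonom F (1 / 2%:R)).

Let char0 n : (0 < n)%N -> n%:R != 0 :> K. Proof. exact: natr_neq0. Qed.
Let sqrtK x : exists y, y ^+ 2 = x. Proof. exact: puiseux_sqrt. Qed.
Let tm : t \in vmax. Proof. exact: pmonom_vmax. Qed.
Let tO : t \in vring. Proof. exact: vmax_ring. Qed.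
Let sm : sqrt_t \in vmax. Proof. exact: pmonom_vmax. Qed.
Let sO : sqrt_t \in vring. Proof. exact: vmax_ring. Qed.
Let s2 : sqrt_t ^+ 2 = t. Proof. by rewrite expr2 pmonomD. Qed.

Lemma vunitN x : x \in vunit -> - x \in vunit.
Proof.
by move=> /andP[xO x0]; apply/andP; split; [rewrite rpredN|rewrite pcoefN oppr_eq0].
Qed.

Lemma vunit_sqr x : x ^+ 2 \in vunit -> x \in vunit.
Proof.
move=> /[dup] x2 /vunit_ring/vring_sqr xO.
by apply: (vunit_prod xO xO); rewrite -expr2.
Qed.

Lemma lead_exp_tn n u : u \in vunit -> lead_exp (t ^+ n * u) n%:R.
Proof.
move=> uu; apply: lead_expMu => //; elim: n => [|n IH].
  by rewrite expr0; apply: (lead_exp_monom F 0).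
by rewrite exprS -[n.+1]add1n natrD; apply: lead_expM => //; apply: (lead_exp_monom F 1).
Qed.

Lemma horner_seq_vring c s : integral_coefs c -> s \in vring -> horner_seq c s \in vring.
Proof.
move=> + sO'; elim: c => [|x c IH] /=; first by rewrite rpred0.
by move=> /andP[xO /IH cO]; rewrite rpredD ?rpredM.
Qed.

Lemma integral_coefs_behead c : integral_coefs c -> integral_coefs (behead c).
Proof. by case: c => // x c /andP[]. Qed.

Lemma horner2_vring c0 c1 c2 c3 s a :
  integral_coefs c0 -> integral_coefs c1 -> integral_coefs c2 -> integral_coefs c3 ->
  s \in vring -> a \in vring -> horner2 c0 c1 c2 c3 s a \in vring.
Proof.
move=> h0 h1 h2 h3 hs ha; rewrite /horner2.
by rewrite !rpredD ?rpredM ?rpredX // horner_seq_vring.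
Qed.

Lemma horner2_vunit c0 c1 c2 c3 s a :
  integral_coefs c0 -> integral_coefs c1 -> integral_coefs c2 -> integral_coefs c3 ->
  s \in vmax -> a \in vring -> horner2_const c0 c1 c2 c3 a \in vunit ->
  horner2 c0 c1 c2 c3 s a \in vunit.
Proof.
move=> h0 h1 h2 h3 hs ha hu; rewrite horner2_lead; apply: vunitD => //.
by apply: vmaxMl => //; apply: horner2_vring => //;
  [exact: integral_coefs_behead..|exact: vmax_ring].
Qed.

(** [hensel_cubic] for an equation with coefficients that are polynomials in s:
    the approximate root has to be an exact root for s = 0. *)
Lemma hensel_series c0 c1 c2 c3 s a :
  integral_coefs c0 -> integral_coefs c1 -> integral_coefs c2 -> integral_coefs c3 ->
  s \in vmax -> a \in vring -> horner2_const c0 c1 c2 c3 a = 0 ->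
  head 0 c1 + head 0 c2 * a *+ 2 + head 0 c3 * a ^+ 2 *+ 3 \in vunit ->
  exists2 y, y \in vmax & horner2 c0 c1 c2 c3 s (a + y) = 0.
Proof.
move=> h0 h1 h2 h3 hs ha hc hd; have hsO := vmax_ring hs.
have pO c : integral_coefs c -> horner_seq (behead c) s \in vring.
  by move=> hh; apply: horner_seq_vring => //; apply: integral_coefs_behead.
apply: hensel_cubic => //; try exact: horner_seq_vring.
  rewrite -[X in X \in _]/(horner2 c0 c1 c2 c3 s a) horner2_lead hc add0r.
  by apply: vmaxMl => //; apply: horner2_vring => //; apply: integral_coefs_behead.
rewrite (horner_seq_lead c1) (horner_seq_lead c2) (horner_seq_lead c3).
rewrite (_ : _ + _ = (head 0 c1 + head 0 c2 * a *+ 2 + head 0 c3 * a ^+ 2 *+ 3)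
  + s * (horner_seq (behead c1) s + horner_seq (behead c2) s * a *+ 2
         + horner_seq (behead c3) s * a ^+ 2 *+ 3)); last by ring.
apply: vunitD => //; apply: vmaxMl => //.
by rewrite !rpredD ?rpredMn ?rpredM ?rpredX // pO.
Qed.

(** The equation is linear modulo the maximal ideal, with the unit root
    e / k1. *)
Lemma unit_root_cubic e k1 k2 k3 : e \in vunit -> k1 \in vunit ->
  k2 \in vmax -> k3 \in vmax ->
  exists2 x : K, x \in vunit & - e + k1 * x + k2 * x ^+ 2 + k3 * x ^+ 3 = 0.
Proof.
move=> eu k1u k2m k3m; pose a := e / k1.
have au : a \in vunit by apply: vunitM => //; apply: vunitV.
have aO := vunit_ring au.
have [||||y ym ye] := @hensel_cubic F a (- e) k1 k2 k3 aO.
- exact: vmax_ring.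
- exact: vmax_ring.
- rewrite /a mulrCA divff ?vunit_neq0 // mulr1 addNr add0r.
  by apply: rpredD; apply: vmaxMl => //; apply: rpredX.
- rewrite -addrA; apply: vunitD => //.
  by apply: rpredD; apply: rpredMn; apply: vmaxMl => //; apply: rpredX.
by exists (a + y) => //; apply: vunitD.
Qed.

Lemma alpha_vunit : alpha t \in vunit.
Proof.
have -> : alpha t = 1%:R + t * (1 + 2%:R * t + t ^+ 4).
  by rewrite /alpha /coef_e13 /coef_e22 /coef_e112 /coef_e1111; ring.
by apply: vunitD; [apply: natr_vunit|apply: vmaxMl => //; vring_tac].
Qed.

Lemma delta_vunit : delta t \in vunit.
Proof.
have -> : delta t = 1%:R + t * (- 2%:R - t + 4%:R * t ^+ 4).
  by rewrite /delta /coef_e13; ring.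
by apply: vunitD; [apply: natr_vunit|apply: vmaxMl => //; vring_tac].
Qed.

Lemma gamma_neq0 : gamma t != 0.
Proof.
have -> : gamma t = t * (3%:R + t * (- 6%:R + 6%:R * t ^+ 3)).
  by rewrite /gamma /coef_e22; ring.
rewrite mulf_neq0 ?(lead_exp_neq0 (lead_exp_monom F 1)) //.
apply: vunit_neq0.
by apply: vunitD; [apply: natr_vunit|apply: vmaxMl => //; vring_tac].
Qed.

Lemma disc_vunit : beta t ^+ 2 - 4%:R * alpha t * gamma t \in vunit.
Proof.
have -> : beta t ^+ 2 - 4%:R * alpha t * gamma t = 9%:R + t * (- 12%:R - 24%:R * t
   + 84%:R * t ^+ 3 - 96%:R * t ^+ 4 - 36%:R * t ^+ 5 + 120%:R * t ^+ 6 + 120%:R * t ^+ 9).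
  by rewrite /alpha /beta /gamma /delta /coef_e13 /coef_e22 /coef_e112 /coef_e1111; ring.
by apply: vunitD; [apply: natr_vunit|apply: vmaxMl => //; vring_tac].
Qed.

Lemma sing_res_neq0 : sing_res t != 0.
Proof.
rewrite sing_res_expansion mulf_neq0 ?expf_neq0 ?(lead_exp_neq0 (lead_exp_monom F 1)) //.
rewrite horner_seq_lead; apply: vunit_neq0; apply: vunitD.
  exact: natr_vunit.
apply: vmaxMl => //; apply: horner_seq_vring => //; apply: integral_coefs_behead.
by integral_coefs_tac.
Qed.

Lemma root_of_series (g : K -> K) k c0 c1 c2 c3 s a :
  (forall x, g x = k * horner2 c0 c1 c2 c3 s x) ->
  integral_coefs c0 -> integral_coefs c1 -> integral_coefs c2 -> integral_coefs c3 ->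
  s \in vmax -> a \in vring -> horner2_const c0 c1 c2 c3 a = 0 ->
  head 0 c1 + head 0 c2 * a *+ 2 + head 0 c3 * a ^+ 2 *+ 3 \in vunit ->
  exists2 y, y \in vmax & g (a + y) = 0.
Proof.
move=> gE h0 h1 h2 h3 hs ha hc hd.
have [y ym ye] := hensel_series h0 h1 h2 h3 hs ha hc hd.
by exists y => //; rewrite gE ye mulr0.
Qed.

Lemma unit_of_series (g : K -> K) k c0 c1 c2 c3 s a :
  (forall x, g x = k * horner2 c0 c1 c2 c3 s x) ->
  integral_coefs c0 -> integral_coefs c1 -> integral_coefs c2 -> integral_coefs c3 ->
  s \in vmax -> a \in vring -> horner2_const c0 c1 c2 c3 a \in vunit ->
  exists2 u, u \in vunit & g a = k * u.
Proof.
move=> gE h0 h1 h2 h3 hs ha hc; exists (horner2 c0 c1 c2 c3 s a); last exact: gE.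
exact: horner2_vunit.
Qed.

Let n16 : 16%:R != 0 :> K. Proof. exact: char0. Qed.

Lemma line_cubic_root1_ex :
  exists2 y, y \in vmax & line_cubic t (root1 t (- 27%:R + y)) = 0.
Proof.
apply: (root_of_series (g := fun a => line_cubic t (root1 t a)) (line_cubic_root1 t));
  try integral_coefs_tac; rewrite ?rpredN ?rpred_nat //; cbv [horner2_const head].
  by ring.
by rewrite !mul0r !mul0rn !addr0 natr_vunit.
Qed.

Lemma line_cubic_root2_ex :
  exists2 y, y \in vmax & line_cubic t (root2 t (117%:R + y)) = 0.
Proof.
have [||||||||y ym ye] := root_of_series (g := fun a => 16%:R * line_cubic t (root2 t a))
  (a := 117%:R) (line_cubic_root2 (char0 (ltn0Sn 1)) t);
  try integral_coefs_tac; rewrite ?rpredN ?rpred_nat //; cbv [horner2_const head].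
- by ring.
- by rewrite !mul0r !mul0rn !addr0 vunitN // natr_vunit.
by exists y => //; apply: (mulfI n16); rewrite ye mulr0.
Qed.

Lemma line_cubic_root3_ex :
  exists2 y, y \in vmax & line_cubic t (root3 t (- 3%:R + y)) = 0.
Proof.
have [||||||||y ym ye] := root_of_series (g := fun a => 16%:R * line_cubic t (root3 t a))
  (a := - 3%:R) (line_cubic_root3 (char0 (ltn0Sn 1)) t);
  try integral_coefs_tac; rewrite ?rpredN ?rpred_nat //; cbv [horner2_const head].
- by ring.
- rewrite (_ : _ + _ = 144%:R); first exact: natr_vunit.
  by ring.
by exists y => //; apply: (mulfI n16); rewrite ye mulr0.
Qed.

Lemma diag_cubic_root0_ex :
  exists2 y, y \in vmax & diag_cubic (alpha t) (beta t) (gamma t) (delta t) y = 0.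
Proof.
have gm : gamma t \in vmax.
  have -> : gamma t = t * (3%:R - 6%:R * t + 6%:R * t ^+ 4).
    by rewrite /gamma /coef_e22; ring.
  by apply: vmaxMl => //; vring_tac.
have dO := vunit_ring delta_vunit.
have bO : beta t \in vring by vring_tac.
have [||||y ym ye] := @hensel_cubic0 F (- 4%:R * gamma t * delta t)
  (9%:R * delta t ^+ 2) (- 6%:R * beta t * delta t)
  (beta t ^+ 2 - 4%:R * alpha t * gamma t).
- by apply: vmaxMl => //; apply: vmaxMr => //; rewrite rpredN rpred_nat.
- by rewrite expr2; do ![apply: vunitM => //]; [apply: natr_vunit|exact: delta_vunit..].
- by rewrite !rpredM ?rpredN ?rpred_nat.
- exact: vunit_ring disc_vunit.
by exists y => //; rewrite diag_cubic_coef -[RHS]ye; ring.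
Qed.

Lemma diag_cubic_root_ex j : j ^+ 2 = - 36%:R -> exists2 y, y \in vmax &
  diag_cubic (alpha t) (beta t) (gamma t) (delta t)
    (- 1 + 3%:R * sqrt_t ^+ 4 + sqrt_t ^+ 5 * (j + y)) = 0.
Proof.
move=> jE; have ju : j \in vunit.
  by apply: vunit_sqr; rewrite jE vunitN // natr_vunit.
have gE a := diag_cubic_expansion sqrt_t a; rewrite s2 in gE.
apply: (root_of_series (g := fun a => diag_cubic (alpha t) (beta t) (gamma t) (delta t)
    (- 1 + 3%:R * sqrt_t ^+ 4 + sqrt_t ^+ 5 * a)) gE);
  try integral_coefs_tac; rewrite ?vunit_ring //; cbv [horner2_const head].
  by rewrite jE; ring.
rewrite (_ : _ + _ = - (18%:R * j)); last by ring.
by rewrite vunitN // vunitM // natr_vunit.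
Qed.

(** This is for the two roots m close to 1/4, for which the cubic satisfied by
    the coordinates has the residue Y (Y - 3/2)^2.  Its root near 0 is t^n x, with x a unit since
    the constant term has valuation n, and the other two roots are units since
    their product is congruent to 3 (1 - m). *)
Lemma small_triple n m u : (0 < n)%N -> m \in vring -> 1 - m \in vunit ->
  line_cubic t m = 0 -> 16%:R * line_e3 t m = t ^+ n * u -> u \in vunit ->
  exists T b (c : K), [/\ general_triple t m (T, b, c), lead_exp T n%:R,
    lead_exp b 0 & lead_exp c 0].
Proof.
move=> n0 mO m1 mE e3E uu.
have de0 := vunit_neq0 delta_vunit; have dO := vunit_ring delta_vunit.
have tnm : t ^+ n \in vmax.
  by case: n n0 {e3E} => // n _; rewrite exprS vmaxMl // rpredX.
have tnO := vmax_ring tnm.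
have u16 : u / 16%:R \in vunit by rewrite vunitM // vunitV // natr_vunit.
have k1u : 3%:R * delta t * (1 - m) \in vunit.
  by rewrite !vunitM ?natr_vunit ?delta_vunit.
have [||x xu xE] := unit_root_cubic u16 k1u
  (k2 := - 3%:R * delta t * t ^+ n) (k3 := delta t * t ^+ n * t ^+ n).
- by apply: vmaxMr => //; rewrite rpredM ?rpredN ?rpred_nat.
- by apply: vmaxMr => //; rewrite rpredM.
pose T := t ^+ n * x.
have Tm : T \in vmax by apply: vmaxMl => //; apply: vunit_ring.
have TO := vmax_ring Tm.
have e3E' : line_e3 t m = t ^+ n * (u / 16%:R).
  by apply: (mulfI n16); rewrite e3E; field.
have pu : T ^+ 2 - 3%:R * T + 3%:R * (1 - m) \in vunit.
  rewrite addrC; apply: vunitD; first by rewrite vunitM ?natr_vunit.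
  by apply: rpredB; [rewrite expr2; apply: vmaxMl|apply: vmaxMr => //; apply: rpred_nat].
have sTO : 3%:R - T \in vring by rewrite rpredB ?rpred_nat.
have [b [c [bu cu bcs bcp]]] := vunit_quadratic sTO pu.
exists T, b, c; split; [|exact: lead_exp_tn|exact/vunit_lead|exact/vunit_lead].
apply: general_tripleI => //; rewrite e3E' /T.
by apply: (eq_lincomb (k := t ^+ n) xE); ring.
Qed.

Lemma neq0_series (g : K -> K) k c0 c1 c2 c3 s a :
  (forall x, g x = k * horner2 c0 c1 c2 c3 s x) ->
  integral_coefs c0 -> integral_coefs c1 -> integral_coefs c2 -> integral_coefs c3 ->
  s \in vmax -> a \in vring -> horner2_const c0 c1 c2 c3 a \in vunit -> k != 0 ->
  g a != 0.
Proof.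
move=> gE h0 h1 h2 h3 hs ha hc k0.
have [u uu ->] := unit_of_series gE h0 h1 h2 h3 hs ha hc.
by rewrite mulf_neq0 // vunit_neq0.
Qed.

Let t0 : t != 0. Proof. exact: lead_exp_neq0 (lead_exp_monom F 1). Qed.
Let n4V : (4%:R : K)^-1 \in vunit. Proof. by rewrite vunitV // natr_vunit. Qed.
Let n4O : (4%:R : K)^-1 \in vring. Proof. exact: vunit_ring. Qed.
Let n4 : 4%:R != 0 :> K. Proof. exact: char0. Qed.

Lemma nat_addm_vunit n x : (0 < n)%N -> x \in vmax -> n%:R + x \in vunit.
Proof. by move=> n0 xm; apply: vunitD => //; apply: natr_vunit. Qed.

Lemma general_triple2 : exists2 m, exists2 y, y \in vmax & m = root2 t (117%:R + y) &
  exists a b (c : K), [/\ general_triple t m (a, b, c), uniq [:: a; b; c], lead_exp a 4%:R,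
    lead_exp b 0 & lead_exp c 0].
Proof.
have [y ym mE] := line_cubic_root2_ex; have yO := vmax_ring ym.
have aO : 117%:R + y \in vring by rewrite rpredD ?rpred_nat.
exists (root2 t (117%:R + y)); first by exists y.
have [|||||||u uu ue] := unit_of_series (g := fun a => 16%:R * line_e3 t (root2 t a))
  (a := 117%:R + y) (line_e3_root2 (char0 (ltn0Sn 1)) t); try integral_coefs_tac; try done.
  cbv [horner2_const head]; rewrite (_ : _ + _ = 108%:R + - 18%:R * y); last by ring.
  by apply: nat_addm_vunit => //; apply: vmaxMr => //; rewrite rpredN rpred_nat.
have [||T [b [c [gT l1 l2 l3]]]] := small_triple (n := 4) isT _ _ mE ue uu.
- by rewrite /root2; vring_tac.
- rewrite (_ : 1 - _ = (3%:R + t * (3%:R - 9%:R * t + 33%:R * t ^+ 2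
      - t ^+ 3 * (117%:R + y))) / 4%:R);
    last by rewrite /root2; field.
  apply: vunitM => //; apply: nat_addm_vunit => //; apply: vmaxMl => //; vring_tac.
exists T, b, c; split=> //.
apply: (general_triple_uniq char0 gT); [exact: gamma_neq0| |].
  by apply: line_cubic_neq0 mE; apply: vunit_neq0 delta_vunit.
suff : 16%:R * line_disc t (root2 t (117%:R + y)) != 0.
  by rewrite mulf_eq0 negb_or => /andP[].
apply: (neq0_series (g := fun a => 16%:R * line_disc t (root2 t a))
  (line_disc_root2 (char0 (ltn0Sn 1)) t)); try integral_coefs_tac; try done;
  last exact: oner_neq0.
by cbv [horner2_const head]; rewrite !mul0r !addr0 natr_vunit.
Qed.

Lemma general_triple3 : exists2 m, exists2 y, y \in vmax & m = root3 t (- 3%:R + y) &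
  exists a b (c : K), [/\ general_triple t m (a, b, c), uniq [:: a; b; c], lead_exp a 2%:R,
    lead_exp b 0 & lead_exp c 0].
Proof.
have [y ym mE] := line_cubic_root3_ex; have yO := vmax_ring ym.
have aO : - 3%:R + y \in vring by rewrite rpredD ?rpredN ?rpred_nat.
exists (root3 t (- 3%:R + y)); first by exists y.
have [|||||||u uu ue] := unit_of_series (g := fun a => 16%:R * line_e3 t (root3 t a))
  (a := - 3%:R + y) (line_e3_root3 (char0 (ltn0Sn 1)) t); try integral_coefs_tac; try done.
  cbv [horner2_const head]; rewrite (_ : _ + _ = 216%:R + - 18%:R * y); last by ring.
  by apply: nat_addm_vunit => //; apply: vmaxMr => //; rewrite rpredN rpred_nat.
have [||T [b [c [gT l1 l2 l3]]]] := small_triple (n := 2) isT _ _ mE ue uu.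
- by rewrite /root3; vring_tac.
- rewrite (_ : 1 - _ = (3%:R + t * (3%:R - t * (- 3%:R + y))) / 4%:R);
    last by rewrite /root3; field.
  apply: vunitM => //; apply: nat_addm_vunit => //; apply: vmaxMl => //; vring_tac.
exists T, b, c; split=> //.
apply: (general_triple_uniq char0 gT); [exact: gamma_neq0| |].
  by apply: line_cubic_neq0 mE; apply: vunit_neq0 delta_vunit.
suff : 16%:R * line_disc t (root3 t (- 3%:R + y)) != 0.
  by rewrite mulf_eq0 negb_or => /andP[].
apply: (neq0_series (g := fun a => 16%:R * line_disc t (root3 t a))
  (line_disc_root3 (char0 (ltn0Sn 1)) t)); try integral_coefs_tac; try done;
  last exact: oner_neq0.
by cbv [horner2_const head]; rewrite !mul0r !addr0 natr_vunit.
Qed.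

(** The first root m is close to 1, where the cubic for the coordinates has the
    residue Y^2 (Y - 3).  Its root near 3 is written 3 - t^2 x, and the other two
    are t^2 b and t^2 c with b + c = x and bc a unit. *)
Lemma general_triple1 : exists2 m, exists2 y, y \in vmax & m = root1 t (- 27%:R + y) &
  exists a b (c : K), [/\ general_triple t m (a, b, c), uniq [:: a; b; c], lead_exp a 0,
    lead_exp b 2%:R & lead_exp c 2%:R].
Proof.
have [y ym mE] := line_cubic_root1_ex; have yO := vmax_ring ym.
have aO : - 27%:R + y \in vring by rewrite rpredD ?rpredN ?rpred_nat.
exists (root1 t (- 27%:R + y)); first by exists y.
have [|||||||u uu ue] := unit_of_series (g := fun a => line_e3 t (root1 t a))
  (a := - 27%:R + y) (line_e3_root1 t); try integral_coefs_tac; try done.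
  cbv [horner2_const head]; rewrite (_ : _ + _ = 27%:R + 9%:R * y); last by ring.
  by apply: nat_addm_vunit => //; apply: vmaxMr => //; rewrite rpred_nat.
have de0 := vunit_neq0 delta_vunit; have dO := vunit_ring delta_vunit.
pose g := 6%:R + t * (- 12%:R - t * (- 27%:R + y)).
have gu : g \in vunit by apply: nat_addm_vunit => //; apply: vmaxMl => //; vring_tac.
have m1 : 1 - root1 t (- 27%:R + y) = t ^+ 2 * g by rewrite /root1 /g; ring.
have t2m : t ^+ 2 \in vmax by rewrite expr2 vmaxMl.
have t2O := vmax_ring t2m.
have eu : - (9%:R * delta t * g) + t ^+ 2 * u \in vunit.
  apply: vunitD; last by rewrite vmaxMl // vunit_ring.
  by rewrite vunitN // !vunitM ?natr_vunit ?delta_vunit.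
have k1u : - (9%:R * delta t) + t ^+ 2 * (- 3%:R * delta t * g) \in vunit.
  apply: vunitD; first by rewrite vunitN // vunitM ?natr_vunit ?delta_vunit.
  by rewrite vmaxMl // !rpredM ?rpredN ?rpred_nat // vunit_ring.
have [||x xu xE] := unit_root_cubic eu k1u
  (k2 := 6%:R * delta t * t ^+ 2) (k3 := - delta t * t ^+ 2 * t ^+ 2).
- by apply: vmaxMr => //; rewrite rpredM ?rpred_nat.
- by apply: vmaxMr => //; rewrite rpredM ?rpredN.
pose T := 3%:R + t ^+ 2 * - x.
have Tu : T \in vunit.
  by apply: nat_addm_vunit => //; rewrite vmaxMl // rpredN vunit_ring.
have T0 := vunit_neq0 Tu.
have LT : delta t * (T * (T ^+ 2 - 3%:R * T + 3%:R * (t ^+ 2 * g))) = t ^+ 4 * u.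
  by apply: (eq_lincomb (k := t ^+ 2) xE); rewrite /T; ring.
have vu : u / (delta t * T) \in vunit by rewrite vunitM // vunitV // vunitM // delta_vunit.
have [b [c [bu cu bcs bcp]]] := vunit_quadratic (vunit_ring xu) vu.
have gT : general_triple t (root1 t (- 27%:R + y)) (T, t ^+ 2 * b, t ^+ 2 * c).
  apply: general_tripleI => //; rewrite ?m1 //; first by rewrite LT ue.
    by rewrite -mulrDr bcs /T; ring.
  apply: (mulfI (mulf_neq0 de0 T0)); rewrite -[RHS]mulrA LT.
  transitivity (delta t * T * t ^+ 4 * (b * c)); first by ring.
  by rewrite bcp; field; rewrite de0 T0.
exists T, (t ^+ 2 * b), (t ^+ 2 * c); split=> //; last 1 first.
- exact: lead_exp_tn.
- apply: (general_triple_uniq char0 gT); [exact: gamma_neq0| |].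
    by apply: line_cubic_neq0 mE; apply: vunit_neq0 delta_vunit.
  apply: (neq0_series (g := fun a => line_disc t (root1 t a)) (line_disc_root1 t));
    try integral_coefs_tac; try done; last by rewrite expf_neq0.
  cbv [horner2_const head]; rewrite (_ : _ + _ = 9%:R + - 3%:R * y); last by ring.
  by apply: nat_addm_vunit => //; apply: vmaxMr => //; rewrite rpredN rpred_nat.
- exact/vunit_lead.
exact: lead_exp_tn.
Qed.
End PuiseuxBitangents.

(** * Counting bitangents by valuation *)
Section Assembly.
Variable F : numClosedFieldType.
Local Notation K := (puiseux F).
Implicit Types (x y z : K).
Local Notation t := (pmonom F 1).
Local Notation sqrt_t := (pmonom F (1 / 2%:R)).
Local Notation cubic := (diag_cubic (alpha t) (beta t) (gamma t) (delta t)).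

Let char0 n : (0 < n)%N -> n%:R != 0 :> K. Proof. exact: natr_neq0. Qed.

(** The valuation as a rational number, with the default value 0 at 0. *)
Definition qval x : rat := fine (pval x).

Lemma qvalE x q : lead_exp x q -> qval x = q.
Proof. by move=> /pvalP; rewrite /qval => ->. Qed.

Lemma qval_lead x : x != 0 -> lead_exp x (qval x).
Proof. by move=> /lead_exp_ex[q /[dup] /qvalE ->]. Qed.

Lemma has_val_ratio p q x y z : x != 0 -> y != 0 -> z != 0 ->
  has_val p q (x / z, y / z) = (qval x - qval z == p) && (qval y - qval z == q).
Proof.
move=> /qval_lead xl /qval_lead yl /qval_lead /lead_expV zl.
have /pvalP xz := lead_expM xl zl; have /pvalP yz := lead_expM yl zl.
by rewrite /has_val xz yz !eqe.
Qed.

Lemma diag_cubic_roots3 : exists r1 r2 r3,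
  [/\ uniq [:: r1; r2; r3], forall r, r \in [:: r1; r2; r3] <-> cubic r = 0,
     lead_exp (1 + r1) 0 /\ lead_exp (1 - 2%:R * r1) 0,
     lead_exp (1 + r2) 2%:R /\ lead_exp (1 - 2%:R * r2) 0 &
     lead_exp (1 + r3) 2%:R /\ lead_exp (1 - 2%:R * r3) 0].
Proof.
have tm : t \in vmax by apply: pmonom_vmax.
have sm : sqrt_t \in vmax by apply: pmonom_vmax.
have sO := vmax_ring sm.
have s2 : sqrt_t ^+ 2 = t by rewrite expr2 pmonomD.
have [j jE] := puiseux_sqrt (- 36%:R : K).
have ju : j \in vunit by apply: vunit_sqr; rewrite jE vunitN // natr_vunit.
have [r1 r1m r1E] := diag_cubic_root0_ex F.
have [y2 y2m r2E] := diag_cubic_root_ex jE.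
have jE' : (- j) ^+ 2 = - 36%:R by rewrite sqrrN.
have [y3 y3m r3E] := diag_cubic_root_ex jE'.
set r2 := - 1 + _ + sqrt_t ^+ 5 * (j + y2) in r2E.
set r3 := - 1 + _ + sqrt_t ^+ 5 * (- j + y3) in r3E.
have near_m1 x : x \in vring ->
    let r := - 1 + 3%:R * sqrt_t ^+ 4 + sqrt_t ^+ 5 * x in
    [/\ 1 + r \in vmax, lead_exp (1 + r) 2%:R & lead_exp (1 - 2%:R * r) 0].
  move=> xO r; have -> : 1 + r = t ^+ 2 * (3%:R + sqrt_t * x).
    by rewrite -s2 /r; ring.
  have uu : 3%:R + sqrt_t * x \in vunit by apply: nat_addm_vunit => //; apply: vmaxMl.
  split.
  - by apply: vmaxMl (vunit_ring uu); rewrite expr2; apply: vmaxMl => //; apply: vmax_ring.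
  - exact: lead_exp_tn.
  apply/vunit_lead; have -> : 1 - 2%:R * r =
      3%:R + sqrt_t * (- 2%:R * sqrt_t ^+ 3 * (3%:R + sqrt_t * x)).
    by rewrite /r; ring.
  apply: nat_addm_vunit => //; apply: vmaxMl => //.
  by rewrite !rpredM ?rpredN ?rpred_nat ?rpredX // vunit_ring.
have jy2O : j + y2 \in vring by apply: rpredD; [apply: vunit_ring|apply: vmax_ring].
have jy3O : - j + y3 \in vring.
  by apply: rpredD; [rewrite rpredN; apply: vunit_ring|apply: vmax_ring].
have [r2m l2 l2'] := near_m1 _ jy2O; have [r3m l3 l3'] := near_m1 _ jy3O.
(* The residue of r1 is 0, those of r2 and r3 are -1. *)
have far r : 1 + r \in vmax -> r1 != r.
  move=> rm; apply: contraTneq (natr_vunit F (ltn0Sn 0)) => r1r.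
  have : 1%:R \in (vmax : {pred K}).
    by rewrite (_ : 1%:R = (1 + r) - r1) ?rpredB // r1r; ring.
  by move=> /andP[_ /eqP h]; apply/negP => /andP[_]; rewrite h eqxx.
have r23 : r2 != r3.
  rewrite -subr_eq0 (_ : r2 - r3 = sqrt_t ^+ 5 * (2%:R * j + (y2 - y3))); last first.
    by rewrite /r2 /r3; ring.
  rewrite mulf_neq0 ?expf_neq0 ?(lead_exp_neq0 (lead_exp_monom F _)) //.
  by apply/vunit_neq0/vunitD; [apply: vunitM => //; apply: natr_vunit|rewrite rpredB].
have ur : uniq [:: r1; r2; r3] by rewrite /= !inE negb_or !far // r23.
exists r1, r2, r3; split=> //; last first.
  split; apply/vunit_lead; first by apply: (@nat_addm_vunit F 1).
  by apply: (@nat_addm_vunit F 1) => //; rewrite rpredN vmaxMr // rpred_nat.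
move=> r; split; first by rewrite !inE => /or3P[]/eqP->.
move=> rE; apply: (cubic_roots (k0 := - 4%:R * gamma t * delta t) (k1 := 9%:R * delta t ^+ 2)
  (k2 := - 6%:R * beta t * delta t) (vunit_neq0 (disc_vunit F)) ur) => y yr.
have : cubic y = 0 by move: yr; rewrite !inE => /or4P[]/eqP->.
by rewrite diag_cubic_coef => <-; ring.
Qed.

(** The roots are separated by their leading terms: m1 has residue 1, m2 and m3
    have residue 1/4, and m2 - m3 = 3 t^2 + .... *)
Lemma line_cubic_roots3 m1 m2 m3 y1 y2 y3 :
  y1 \in vmax -> m1 = root1 t (- 27%:R + y1) ->
  y2 \in vmax -> m2 = root2 t (117%:R + y2) ->
  y3 \in vmax -> m3 = root3 t (- 3%:R + y3) ->
  line_cubic t m1 = 0 -> line_cubic t m2 = 0 -> line_cubic t m3 = 0 ->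
  uniq [:: m1; m2; m3] /\ forall m, m \in [:: m1; m2; m3] <-> line_cubic t m = 0.
Proof.
move=> y1m m1E y2m m2E y3m m3E e1 e2 e3.
have tm : t \in vmax by apply: pmonom_vmax.
have tO := vmax_ring tm.
have y1O := vmax_ring y1m; have y2O := vmax_ring y2m; have y3O := vmax_ring y3m.
have n4 : 4%:R != 0 :> K by apply: char0.
have neq (m m' u : K) n : 4%:R * (m - m') = t ^+ n * u -> u \in vunit -> m != m'.
  move=> mm uu; rewrite -subr_eq0; apply: contraTneq (uu) => z.
  move/eqP: mm; rewrite z mulr0 eq_sym mulf_eq0 expf_eq0.
  rewrite (negPf (lead_exp_neq0 (lead_exp_monom F 1))) andbF /= => /eqP ->.
  by apply/negP => /vunit_neq0; rewrite eqxx.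
have m12 : m1 != m2.
  apply: (neq _ _ (3%:R + t * (3%:R - 33%:R * t + 81%:R * t ^+ 2
     + 4%:R * t ^+ 3 * (- 27%:R + y1) - t ^+ 3 * (117%:R + y2))) 0%N).
    by rewrite m1E m2E /root1 /root2; field.
  apply: nat_addm_vunit => //; apply: vmaxMl => //.
  by vring_tac.
have m13 : m1 != m3.
  apply: (neq _ _ (3%:R + t * (3%:R - 24%:R * t + 48%:R * t ^+ 2
     + 4%:R * t ^+ 3 * (- 27%:R + y1) - t * (- 3%:R + y3))) 0%N).
    by rewrite m1E m3E /root1 /root3; field.
  apply: nat_addm_vunit => //; apply: vmaxMl => //.
  by vring_tac.
have m23 : m2 != m3.
  apply: (neq _ _ (12%:R + (t * (- 33%:R + t * (117%:R + y2)) - y3)) 2%N).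
    by rewrite m2E m3E /root2 /root3; field.
  apply: nat_addm_vunit => //; rewrite rpredB //; apply: vmaxMl => //.
  by vring_tac.
have um : uniq [:: m1; m2; m3] by rewrite /= !inE negb_or m12 m13 m23.
split=> // m; split; first by rewrite !inE => /or3P[]/eqP->.
have k30 : 16%:R * alpha t ^+ 2 != 0.
  by rewrite mulf_neq0 ?char0 // expf_neq0 // (vunit_neq0 (alpha_vunit F)).
move=> mE; apply: (cubic_roots (k0 := - delta t ^+ 2)
  (k1 := beta t ^+ 2 - 4%:R * alpha t * gamma t) (k2 := 8%:R * alpha t * beta t)
  k30 um) => y yr.
rewrite -line_cubic_coef.
by move: yr; rewrite !inE => /or4P[]/eqP->.
Qed.

Definition affine_coords (T : K * K * K) : K * K := (T.1.1 / T.2, T.1.2 / T.2).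

Lemma affine_lineE (T : K * K * K) : T.2 != 0 ->
  row3 T.1.1 T.1.2 T.2 = T.2 *: affine_line (affine_coords T).
Proof.
move=> z0; rewrite -[affine_line _]/(row3 _ _ _) row3Z /=.
by rewrite mulr1 ![T.2 * _]mulrC !mulfVK.
Qed.

Lemma quartic_smooth : smooth_plane_quartic (quartic F).
Proof.
rewrite quartic_polyE; apply: quartic_poly_smooth.
- exact: char0.
- exact: vunit_neq0 (alpha_vunit F).
- exact: gamma_neq0.
- exact: vunit_neq0 (delta_vunit F).
exact: sing_res_neq0.
Qed.

Lemma quartic_bitangents : exists s : seq (K * K),
    [/\ uniq s, size s = 28%N &
        forall l : 'rV[K]_3, bitangent (quartic F) l <->
          exists2 AB, AB \in s & (l == affine_line AB)%MS] /\
    [/\ count (has_val 0 0) s = 4%N, count (has_val (-2) 0) s = 4%N,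
        count (has_val 0 (-2)) s = 4%N, count (has_val 2 2) s = 4%N &
        count (has_val (-2) (-2)) s = 2%N] /\
    [/\ count (has_val (-4) (-4)) s = 2%N, count (has_val 2 0) s = 2%N,
        count (has_val 4 0) s = 2%N, count (has_val 0 2) s = 2%N &
        count (has_val 0 4) s = 2%N].
Proof.
have [r1 [r2 [r3 [ur rP [l1 l1'] [l2 l2'] [l3 l3']]]]] := diag_cubic_roots3.
have [m1 [y1 y1m m1E] [a1 [b1 [c1 [g1 u1 la1 lb1 lc1]]]]] := general_triple1 F.
have [m2 [y2 y2m m2E] [a2 [b2 [c2 [g2 u2 la2 lb2 lc2]]]]] := general_triple2 F.
have [m3 [y3 y3m m3E] [a3 [b3 [c3 [g3 u3 la3 lb3 lc3]]]]] := general_triple3 F.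
have [e1 _ _ _] := g1; have [e2 _ _ _] := g2; have [e3 _ _ _] := g3.
have [um mP] := line_cubic_roots3 y1m m1E y2m m2E y3m m3E e1 e2 e3.
pose rs : seq K := [:: r1; r2; r3].
pose Ts : seq (K * (K * K * K)) :=
  [:: (m1, (a1, b1, c1)); (m2, (a2, b2, c2)); (m3, (a3, b3, c3))].
have mP' (m : K) : m \in unzip1 Ts <-> line_cubic t m = 0 := mP m.
have um' : uniq (unzip1 Ts) := um.
have TsP mT : mT \in Ts -> general_triple t mT.1 mT.2 /\
    uniq [:: mT.2.1.1; mT.2.1.2; mT.2.2].
  by rewrite !inE => /or3P[]/eqP->.
have [d dE] := puiseux_sqrt (- 3%:R : K).
have n2 : 2%:R != 0 :> K by apply: char0.
have n3 : 3%:R != 0 :> K by apply: char0.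
pose w := (- 1 + d) / 2%:R.
have hw : w ^+ 2 + w + 1 = 0.
  transitivity ((d ^+ 2 + 3%:R) / 4%:R); first by rewrite /w; field; rewrite ?char0.
  by rewrite dE addNr mul0r.
have al0 := vunit_neq0 (alpha_vunit F); have de0 := vunit_neq0 (delta_vunit F).
have ga0 := gamma_neq0 F; have disc0 := vunit_neq0 (disc_vunit F).
pose L := lines28 rs Ts.
have LP l := bitangent_lines28 char0 (@puiseux_sqrt F) hw al0 ga0 de0 disc0 rP mP' TsP l.
have uL : uniq L := lines28_uniq char0 ga0 de0 ur rP um' TsP.
have Lnz (T : K * K * K) : T \in L -> [/\ T.1.1 != 0, T.1.2 != 0 & T.2 != 0].
  have nz x q : lead_exp x q -> x != 0 := @lead_exp_neq0 F x q.
  rewrite inE mem_cat => /or3P[/eqP->|/flatten_mapP[r rr]|/flatten_mapP[mT mTs]].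
  - by rewrite !oner_neq0.
  - have [n1 n1'] : 1 + r != 0 /\ 1 - 2%:R * r != 0.
      by move: rr; rewrite !inE => /or3P[]/eqP->; split; apply: nz; eassumption.
    by rewrite !inE => /or3P[]/eqP->.
  have [na nb nc] : [/\ mT.2.1.1 != 0, mT.2.1.2 != 0 & mT.2.2 != 0].
    by move: mTs; rewrite !inE => /or3P[]/eqP->; split; apply: nz; eassumption.
  by case: mT na nb nc {mTs} => m [[a b] c] /= na nb nc;
    rewrite !inE => /or4P[||| /or3P[]]/eqP->.
exists (map affine_coords L); split; last first.
  (* The counts only depend on the list of the valuations of the coordinates of
     the lines, which is explicit. *)
  have cnt p q : count (has_val p q) (map affine_coords L) =
     count (fun v : rat * rat * rat => (v.1.1 - v.2 == p) && (v.1.2 - v.2 == q))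
       (map (fun T => (qval T.1.1, qval T.1.2, qval T.2)) L).
    rewrite !count_map; apply: eq_in_count => -[[x y] z] /Lnz[x0 y0 z0] /=.
    exact: has_val_ratio.
  have lead1 : lead_exp (1 : K) 0 := lead_exp_monom F 0.
  have qvals := (qvalE lead1, qvalE l1, qvalE l1', qvalE l2, qvalE l2', qvalE l3, qvalE l3',
    (qvalE la1, qvalE lb1, qvalE lc1, qvalE la2, qvalE lb2, qvalE lc2,
     qvalE la3, qvalE lb3, qvalE lc3)).
  rewrite !cnt /L /lines28 /rs /Ts /= !qvals.
  by [].
split.
- rewrite map_inj_in_uniq // => -[[x y] z] [[x' y'] z'] TL TL' e.
  have hx : x / z = x' / z' := congr1 fst e.
  have hy : y / z = y' / z' := congr1 snd e.
  have [/= _ _ z0] := Lnz _ TL; have [/= _ _ z0'] := Lnz _ TL'.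
  have s3 := lines28_sum TsP TL; have s3' := lines28_sum TsP TL'.
  have zz : z = z'.
    apply: (mulfI n3); rewrite -{1}s3' -s3.
    have -> : x = x' / z' * z by rewrite -hx mulfVK.
    have -> : y = y' / z' * z by rewrite -hy mulfVK.
    by field.
  by rewrite -zz in hx hy *; rewrite (mulIf _ hx) ?(mulIf _ hy) ?invr_eq0.
- by [].
move=> l; rewrite quartic_polyE LP; split.
  move=> [T [c [TL c0 ->]]]; exists (affine_coords T); first exact: map_f.
  have [x0 y0 z0] := Lnz _ TL; apply/row_eqmx_scale.
    rewrite scaler_eq0 negb_or c0 row3_eq0 (negPf x0) //.
  by exists (c * T.2); rewrite ?mulf_neq0 // affine_lineE // scalerA.
move=> [AB /mapP[T TL ->] /andP[lA Al]].
have [x0 y0 z0] := Lnz _ TL.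
have l0 : l != 0.
  apply/eqP => l0; have /sub_rVP[a] := Al; rewrite l0 scaler0 => /eqP.
  by rewrite -[affine_line _]/(row3 _ _ _) row3_eq0 oner_eq0 !andbF.
have lAl : (l == affine_line (affine_coords T))%MS by rewrite lA.
have /(row_eqmx_scale _ l0)[c c0 lE] := lAl.
exists T, (c / T.2); split=> //; first by rewrite mulf_neq0 // invr_eq0.
by rewrite affine_lineE // scalerA mulfVK.
Qed.
End Assembly.

Theorem proposition5p2 (R : realType) :
  smooth_plane_quartic (quartic R[i]) /\
  exists s : seq (puiseux R[i] * puiseux R[i]),
    [/\ uniq s,
        size s = 28%N &
        forall l : 'rV[puiseux R[i]]_3,
          bitangent (quartic R[i]) l <->
          exists2 AB, AB \in s & (l == affine_line AB)%MS] /\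
    [/\ count (has_val 0 0) s = 4%N,
        count (has_val (-2) 0) s = 4%N,
        count (has_val 0 (-2)) s = 4%N,
        count (has_val 2 2) s = 4%N &
        count (has_val (-2) (-2)) s = 2%N] /\
    [/\ count (has_val (-4) (-4)) s = 2%N,
        count (has_val 2 0) s = 2%N,
        count (has_val 4 0) s = 2%N,
        count (has_val 0 2) s = 2%N &
        count (has_val 0 4) s = 2%N].
Proof.
split; first exact: quartic_smooth.
exact: quartic_bitangents.
Qed.
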